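(* Assume that the communication graph is undirected and connected with symmetric, nonnegative, doubly stochastic weight matrix $W$, that each $f_i$ is $L$-smooth, that the Riemannian gradient samples are unbiased with variance bounded by $\sigma^2$, and that they are uniformly bounded in norm by $A_1$ (all as detailed in the context). Consider Algorithm 1 (described in the context) with $\mathbf{X}_0\in\mathcal{S}$ and $t\ge\lceil\log_{\sigma_2}(\frac{1}{2\sqrt N})\rceil$. Suppose that the step size $\alpha>0$ satisfies $\alpha\le\min\{1,\frac1M,\frac{\Phi}{L_t}\}$ and that the step size $\beta>0$ satisfies $$\beta\le\min\Big\{\bar\beta,\ \frac{1}{9L_G},\ \frac{1}{4[\alpha\delta_1L_G(16\Gamma_0+\Gamma_2)+2C_1]}\Big\},\qquad \bar\beta:=\min\Big\{\frac{(1-\rho_t)\delta_1}{10A+L_G},\frac{\alpha\delta_1}{5(10A+L_G)}\Big\}.$$ Then, for every $K\ge 0$, $$\min_{k=0,\dots,K}\frac1N E[\|\mathbf{X}_k-\hat{\mathbf{X}}_k\|_F^2]\le\frac{8\beta\Gamma_0\Big(f(\hat X_0)-f^*+\tilde\Gamma_3+\sigma^2\sum_{k=0}^K\big(\frac{2\Gamma_2\beta+D_3+\frac\beta2}{N_k}+\frac{2\beta\Gamma_2}{N_{k+1}}\big)\Big)+\Gamma_1}{K+1}$$ and $$\min_{k=0,\dots,K}E[\|\mathrm{grad}f(\hat X_k)\|_F^2]\le\frac{\tilde\Gamma_1+(16+\Gamma_0\alpha^2\delta_1^2)\Big[f(\hat X_0)-f^*+\tilde\Gamma_3+\sigma^2\sum_{k=0}^K\big(\frac{2\beta\Gamma_2+\tilde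 D_3}{N_k}+\frac{2\beta\Gamma_2}{N_{k+1}}\big)\Big]}{\beta\,(K+1)}.$$
   Context: Manifold. $\mathcal{M}=\mathrm{St}(n,r)=\{X\in\mathbb{R}^{n\times r}:X^\top X=I_r\}$ with tangent space $T_X\mathcal{M}=\{u\in\mathbb{R}^{n\times r}:X^\top u+u^\top X=0\}$, inner product $\langle u,v\rangle=\mathrm{tr}(u^\top v)$, and orthogonal projection $\mathcal{P}_{T_X\mathcal{M}}(Y)=Y-\frac12X(X^\top Y+Y^\top X)$. For differentiable $\phi$, $\mathrm{grad}\,\phi(X)=\mathcal{P}_{T_X\mathcal{M}}(\nabla\phi(X))$. The polar retraction is $\mathcal{R}_X(v)=(X+v)(I_r+v^\top v)^{-1/2}$, $v\in T_X\mathcal{M}$, and $M>0$ is a constant with $\|\mathcal{R}_X(v)-(X+v)\|_F\le M\|v\|_F^2$ for all $X\in\mathrm{St}(n,r)$, $v\in T_X\mathcal{M}$. For $\mathbf{X}=[X_1^\top,\dots,X_N^\top]^\top\in\mathrm{St}(n,r)^N$ the induced arithmetic mean (IAM) is $\hat X\in\arg\min_{Y\in\mathrm{St}(n,r)}\sum_{i=1}^N\|Y-X_i\|_F^2$, and $\hat{\mathbf{X}}=(\mathbf{1}_N\otimes I_n)\hat X$. $\hat X_k$, $\hat{\mathbf{X}}_k$ are those of $\mathbf{X}_k$. Problem. $N$ agents, $\mathcal{N}=\{1,\dots,N\}$, minimize $f=\frac1N\sum_{i=1}^Nf_i$ over $\mathrm{St}(n,r)$, where $f_i(X)=\mathbb{E}_{\xi_i}F_i(X,\xi_i)$;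 $f^*=\min_{X\in\mathrm{St}(n,r)}f(X)$. Each $f_i$ is differentiable on $\mathbb{R}^{n\times r}$ with $\|\nabla f_i(X)-\nabla f_i(Y)\|_F\le L\|X-Y\|_F$. Put $L_n=\max_{i}\max_{X\in\mathrm{St}(n,r)}\|\nabla f_i(X)\|_2$ and $L_G=L+2L_n$. Network. The graph $\mathcal{G}=(\mathcal{N},\mathcal{E})$ is undirected and connected; $W=(w_{ij})\in\mathbb{R}^{N\times N}$ has $w_{ij}>0$ if $(i,j)\in\mathcal{E}$ or $i=j$, $w_{ij}=0$ otherwise, $W=W^\top$, $W\mathbf{1}_N=\mathbf{1}_N$. $W^t_{ij}$ is the $(i,j)$ entry of $W^t$; $\sigma_2\in[0,1)$ is the second largest singular value of $W$; $L_t=1-\sigma_N(W^t)\in(0,2]$ with $\sigma_N(W^t)$ the smallest eigenvalue of $W^t$. (If $\sigma_2=0$ the condition on $t$ is just $t\ge1$.) Local region. $\delta_1,\delta_2>0$ are given constants with $\delta_1\le\frac{1}{5\sqrt r}\delta_2$, $\delta_2\le\frac16$, and $\mathcal{S}$ is the set of $\mathbf{X}\in\mathrm{St}(n,r)^N$ with $\|\mathbf{X}-\hat{\mathbf{X}}\|_F^2\le N\delta_1^2$ and $\max_i\|X_i-\hat X\|_F\le\delta_2$. $\Phi$ is a constant with $1\le\Phi\le 2-\max_i\|X_i-\hat X\|_F^2$ for all $\mathbf{X}\in\mathcal{S}$ (e.g. $\Phi=2-\delta_2^2$). Stochastic oracle. $G_i(X,\xi_i)\in T_X\mathcal{M}$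 satisfies, for all $i$ and $X\in\mathrm{St}(n,r)$: $E_{\xi_i}[G_i(X,\xi_i)]=\mathrm{grad}f_i(X)$, $E_{\xi_i}[\|G_i(X,\xi_i)-\mathrm{grad}f_i(X)\|_F^2]\le\sigma^2$, and $\|G_i(X,\xi_i)\|_F\le A_1$ for all $\xi_i$ in the support. $A_2$ is a constant with $\max_{X\in\mathrm{St}(n,r)}\|\nabla f_i(X)\|_F\le A_2$ for all $i$; $A=\max\{A_1,A_2\}$. Algorithm 1. Sample sizes $N_k$ are positive integers; $F_i(X_{i,k}):=\frac{1}{N_k}\sum_{j=1}^{N_k}G_i(X_{i,k},\xi_{i,k}^{[j]})$, where $\xi_{i,k}^{[j]}$, $j=1,\dots,N_k$, are i.i.d. realizations of $\xi_i$ drawn independently of the past. Given a (deterministic) $\mathbf{X}_0\in\mathcal{S}$, $Y_{i,0}=F_i(X_{i,0})$, and integer $t\ge1$, for $k=0,1,\dots$ and all $i$: $v_{i,k}=\mathcal{P}_{T_{X_{i,k}}\mathcal{M}}Y_{i,k}$; $X_{i,k+1}=\mathcal{R}_{X_{i,k}}\big(\alpha\mathcal{P}_{T_{X_{i,k}}\mathcal{M}}[\sum_{j=1}^NW_{ij}^tX_{j,k}]-\beta v_{i,k}\big)$; $Y_{i,k+1}=\sum_{j=1}^NW_{ij}^tY_{j,k}+F_i(X_{i,k+1})-F_i(X_{i,k})$. Stack $\mathbf{X}_k=[X_{1,k}^\top,\dots,X_{N,k}^\top]^\top$, $\mathbf{Y}_k=[Y_{1,k}^\top,\dots,Y_{N,k}^\top]^\top$;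 $\bar F_k=\frac1N\sum_iF_i(X_{i,k})$, $\bar{\mathbf{F}}_k=(\mathbf{1}_N\otimes I_n)\bar F_k$. Constants. $\rho_t=\sqrt{1-(\alpha L_t\Phi-\alpha^2L_t^2)}$; $\Gamma_0=\frac{2}{(1-\rho_t)^2}$; $\Gamma_1=\frac{2}{1-\rho_t^2}\|\mathbf{X}_0-\hat{\mathbf{X}}_0\|_F^2$; $\Gamma_2=\frac{2}{(1-\sigma_2^t)^2}$; $\Gamma_3=\frac{2}{1-\sigma_2^{2t}}\cdot\frac1N E\|\mathbf{Y}_0-\bar{\mathbf{F}}_0\|_F^2$; $D_1=(\delta_1^2+5)L_G+2MA$; $D_4=\frac{4r\delta_1^2}{\beta^2L_G}$; $D_2=3L_G+2\alpha A+13L_G\tilde C\alpha^2+D_4$ with $\tilde C=\frac{\delta_2^2}{r}$; $D_3=\frac{1+4L_G^2\beta^2}{2L_G}$; $\tilde D_3=D_3+\frac{5\beta}{8}$; $C_0=\frac{D_4\Gamma_0\alpha^2\delta_1^2}{25}+\Gamma_1(D_2+D_4)$; $C_1=D_2\Gamma_0+D_4\Gamma_0+D_1$; $\tilde\Gamma_1=2L_G^2\beta\Gamma_1$; $\tilde\Gamma_3=C_0+\frac\beta2(\Gamma_3+16\alpha^2L_G^2\Gamma_2\Gamma_1)$. (The condition on $\beta$ is to be read as an inequality on $\beta$, since $C_1$ itself depends on $\beta$.) *)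

(* Defs.v *)
From mathcomp Require Import all_boot all_order all_algebra.
From mathcomp Require Import all_classical all_reals all_analysis.

Set Implicit Arguments.
Unset Strict Implicit.
Unset Printing Implicit Defensive.

Import Order.TTheory GRing.Theory Num.Theory.
Import numFieldNormedType.Exports.

Local Open Scope classical_set_scope.
Local Open Scope ring_scope.

Definition maximum_of (R : realType) (S : set R) (m : R) : Prop :=
  S m /\ ubound S m.

Definition minimum_of (R : realType) (S : set R) (m : R) : Prop :=
  S m /\ lbound S m.

Section Matrices.
Variable R : realType.

(* The library norm [`|A|] on matrices is the max norm; it is used only through
   [differentiable] and ['D_v], which do not depend on the choice of a norm in
   finite dimension. *)
Definition frob_inner m n (A B : 'M[R]_(m, n)) : R := \tr (A^T *m B).

Definition fnorm m n (A : 'M[R]_(m, n)) : R := Num.sqrt (frob_inner A A).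

(* Spectral norm, as the operator norm induced by the Euclidean norms. *)
Definition opnorm2 m n (A : 'M[R]_(m, n)) : R :=
  sup [set fnorm (A *m u) | u in [set u : 'cV[R]_n | fnorm u <= 1]].

(* [s] lists the singular values of [A] with multiplicity, in nonincreasing
   order, so that [s`_1] is the second largest one. *)
Definition singular_values m n (A : 'M[R]_(m, n)) (s : seq R) : Prop :=
  [/\ sorted >=%R s,
      all (fun x => 0 <= x) s &
      char_poly (A^T *m A) = \prod_(x <- s) ('X - (x ^+ 2)%:P)].

Definition posdef n (A : 'M[R]_n) : Prop :=
  A^T = A /\ forall u : 'cV[R]_n, u != 0 -> 0 < (u^T *m A *m u) ord0 ord0.

(* [A^(-1/2)]: for positive definite [A], the (unique) positive definite [B]
   with [B^2 A = I]; [xget] returns 0 when there is none. *)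
Definition invsqrtmx n (A : 'M[R]_n) : 'M[R]_n :=
  xget 0 [set B | posdef B /\ B *m B *m A = 1%:M].

End Matrices.

Section Stiefel.
Variables (R : realType) (n r : nat).
Implicit Types (X Y v : 'M[R]_(n, r)) (phi : 'M[R]_(n, r) -> R).

Definition stiefel : set 'M[R]_(n, r) := [set X | X^T *m X = 1%:M].

Definition tangent X : set 'M[R]_(n, r) :=
  [set u | X^T *m u + u^T *m X = 0].

Definition proj_tangent X Y : 'M[R]_(n, r) :=
  Y - 2^-1 *: (X *m (X^T *m Y + Y^T *m X)).

Definition polar_retraction X v : 'M[R]_(n, r) :=
  (X + v) *m invsqrtmx (1%:M + v^T *m v).

Definition egrad phi X : 'M[R]_(n, r) :=
  \matrix_(a, b) 'D_(delta_mx a b) phi X.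

Definition rgrad phi X : 'M[R]_(n, r) := proj_tangent X (egrad phi X).

End Stiefel.

(* The elements of [St(n,r)^N] are families [X : 'I_N -> 'M_(n, r)] rather than
   matrices with [N * n] rows: [stack_sqdist X Y] is the squared Frobenius norm
   of [X - (1_N (x) I_n) Y]. *)
Section Stacks.
Variables (R : realType) (N n r : nat).
Implicit Types (X : 'I_N -> 'M[R]_(n, r)) (Y : 'M[R]_(n, r)).

Definition stack_sqdist X Y : R := \sum_i fnorm (X i - Y) ^+ 2.

Definition stiefelN : set ('I_N -> 'M[R]_(n, r)) :=
  [set X | forall i, stiefel (X i)].

Definition is_iam X Y : Prop :=
  stiefel Y /\ forall Z, stiefel Z ->
    \sum_i fnorm (Y - X i) ^+ 2 <= \sum_i fnorm (Z - X i) ^+ 2.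

(* [Xhat] chooses an induced arithmetic mean, which need not be unique, for
   every point of [St(n,r)^N]. *)
Definition iam_selection (Xhat : ('I_N -> 'M[R]_(n, r)) -> 'M[R]_(n, r)) :=
  forall X, stiefelN X -> is_iam X (Xhat X).

Definition local_region (Xhat : ('I_N -> 'M[R]_(n, r)) -> 'M[R]_(n, r))
    (delta1 delta2 : R) : set ('I_N -> 'M[R]_(n, r)) :=
  [set X | [/\ stiefelN X,
               stack_sqdist X (Xhat X) <= N%:R * delta1 ^+ 2 &
               forall i, fnorm (X i - Xhat X) <= delta2]].

Definition stack_mean X : 'M[R]_(n, r) := N%:R^-1 *: \sum_i X i.

End Stacks.

Section Network.
Variables (R : realType) (N : nat).

Definition connected_graph (e : rel 'I_N) : Prop :=
  symmetric e /\ forall i j, connect e i j.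

Definition mixing_matrix (e : rel 'I_N) (W : 'M[R]_N) : Prop :=
  [/\ forall i j, e i j || (i == j) -> 0 < W i j,
      forall i j, ~~ (e i j || (i == j)) -> W i j = 0,
      W^T = W &
      W *m const_mx 1 = const_mx 1 :> 'cV[R]_N].

End Network.

Definition borel_mx (R : realType) (n r : nat) :=
  g_sigma_algebraType (@open 'M[R]_(n, r)).

Section Oracle.
Variables (R : realType) (N n r : nat) (dXi : measure_display).
Variables (Xi : 'I_N -> measurableType dXi) (D : forall i, probability (Xi i) R).
Variables (f : 'I_N -> 'M[R]_(n, r) -> R).
Variables (G : forall i, 'M[R]_(n, r) -> Xi i -> 'M[R]_(n, r)).

(* [D i] is the law of [xi_i].  Measurability, needed for the expectations
   along the algorithm to make sense, is joint in the point and the sample. *)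
Definition oracle_measurable : Prop := forall i a b,
  measurable_fun ((@stiefel R n r : set (borel_mx R n r)) `*` [set: Xi i])
    (fun p : borel_mx R n r * Xi i => G p.1 p.2 a b).

Definition oracle_tangent : Prop := forall i X xi,
  stiefel X -> tangent X (G (i := i) X xi).

Definition oracle_unbiased : Prop := forall i X, stiefel X -> forall a b,
  'E_(D i)[fun xi => G X xi a b]%E = (rgrad (f i) X a b)%:E.

Definition oracle_variance (sigma : R) : Prop := forall i X, stiefel X ->
  ('E_(D i)[fun xi => (fnorm (G X xi - rgrad (f i) X) ^+ 2)%R] <= (sigma ^+ 2)%:E)%E.

(* "For all samples in the support": for almost every sample, simultaneously
   for all points of the manifold. *)
Definition oracle_bounded (A1 : R) : Prop := forall i,
  {ae D i, forall xi, forall X, stiefel X -> fnorm (G X xi) <= A1}.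

End Oracle.

Section Sampling.
Variables (R : realType) (N : nat) (dXi dOm : measure_display).
Variables (Xi : 'I_N -> measurableType dXi) (D : forall i, probability (Xi i) R).
Variables (Om : measurableType dOm) (P : probability Om R).
Variables (xi : forall i : 'I_N, nat -> nat -> {RV P >-> Xi i}).
Variable Nk : nat -> nat.

(* [xi i k j], [j < Nk k], are the samples drawn by agent [i] at iteration [k];
   [past k] is the sigma-algebra generated by the samples of all agents at the
   iterations before [k]. *)
Definition past (k : nat) : set (set Om) :=
  <<s [set E | exists i l j (B : set (Xi i)),
        [/\ (l < k)%N, (j < Nk l)%N, measurable B & E = xi i l j @^-1` B]] >>.

Definition samples_law : Prop := forall i k j (B : set (Xi i)),
  (j < Nk k)%N -> measurable B -> P (xi i k j @^-1` B) = D i B.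

(* For each agent, the samples of iteration [k] are mutually independent and
   jointly independent of the past.  Nothing is required of the joint law of
   the samples of different agents within one iteration. *)
Definition samples_independent : Prop :=
  forall i k (E : set Om) (B : nat -> set (Xi i)),
    past k E -> (forall j, measurable (B j)) ->
    P (E `&` \bigcap_(j in `I_(Nk k)) (xi i k j @^-1` B j)) =
    (P E * \prod_(j < Nk k) P (xi i k j @^-1` B j))%E.

End Sampling.

Section Algorithm.
Variables (R : realType) (N n r : nat) (dXi dOm : measure_display).
Variables (Xi : 'I_N -> measurableType dXi).
Variables (Om : measurableType dOm) (P : probability Om R).
Variables (G : forall i, 'M[R]_(n, r) -> Xi i -> 'M[R]_(n, r)).
Variables (xi : forall i : 'I_N, nat -> nat -> {RV P >-> Xi i}).
Variable Nk : nat -> nat.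
Variables (W : 'M[R]_N) (t : nat) (alpha beta : R).
Variable X0 : 'I_N -> 'M[R]_(n, r).

(* The sampled gradient of agent [i] at iteration [k], as a function of the
   point. *)
Definition batch_grad (w : Om) (k : nat) (i : 'I_N) (X : 'M[R]_(n, r)) :=
  (Nk k)%:R^-1 *: \sum_(j < Nk k) G X (xi i k j w).

Definition next_X (X Y : 'I_N -> 'M[R]_(n, r)) (i : 'I_N) : 'M[R]_(n, r) :=
  polar_retraction (X i)
    (alpha *: proj_tangent (X i) (\sum_j (W ^+ t) i j *: X j)
     - beta *: proj_tangent (X i) (Y i)).

Fixpoint iterates (w : Om) (k : nat) :
    ('I_N -> 'M[R]_(n, r)) * ('I_N -> 'M[R]_(n, r)) :=
  if k is k'.+1 then
    let: (X, Y) := iterates w k' in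
    let X' := next_X X Y in
    (X', fun i => \sum_j (W ^+ t) i j *: Y j
                  + batch_grad w k'.+1 i (X' i) - batch_grad w k' i (X i))
  else (X0, fun i => batch_grad w 0 i (X0 i)).

Definition iter_X w k := (iterates w k).1.
Definition iter_Y w k := (iterates w k).2.

Definition mean_batch_grad w k : 'M[R]_(n, r) :=
  stack_mean (fun i => batch_grad w k i (iter_X w k i)).

End Algorithm.

(* Main.v *)
From HB Require Import structures.
Require Import Defs.
From mathcomp Require Import all_boot all_order all_fingroup all_algebra complex.
From mathcomp Require Import all_classical all_reals all_analysis.
From mathcomp Require Import measurable_realfun.
From mathcomp Require Import ring lra.

(* Almost every sample path is a deterministic iteration with bounded inputs.
   Since [C1] contains [D4 * Gamma0], the condition on [beta] forces
   [delta1 <= alpha / 640], so the local region is so small that, path by path, it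
   is invariant, the consensus error and the tracking error contract, and
   [f (Xhat X_k)] decreases, all up to multiples of the squared gradient noise.
   The first-order effects of the noise are absorbed by Young's inequality, which
   the large constant [D3] pays for; unbiasedness and independence serve only to
   bound the second moment of the noise by [sigma ^+ 2 / Nk k], one sample at a
   time.  Summing over [k] and integrating gives both rates.  The selection [Xhat]
   need not be measurable, so the expectations to be bounded are suprema over
   the simple functions below; the bounds themselves are measurable. *)

Set Implicit Arguments.
Unset Strict Implicit.
Unset Printing Implicit Defensive.

Import Order.TTheory GRing.Theory Num.Theory.
Import numFieldNormedType.Exports.

Local Open Scope classical_set_scope.
Local Open Scope ring_scope.

(** * The Frobenius norm *)

(** The obstacle is that the errors feed on one another: the consensus error [a] is created by the
    squared directions [b], the tracking error [y] by [a], [b] and the noise, and the decrease of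
    [f] loses terms such as [P * a], of first order in the gradient norm [P]. The loop is closed by
    the weight [D = d1 ^+ 2 / be]. Inside the region [a <= D * be], so Young's inequality trades
    [P * a] for a small multiple of [be * P ^+ 2] plus a multiple of [D * a]. Summing the
    contraction of [a] then bounds [D] times the sum of the [a k] by an initial term plus
    [10 / 3 * (d1 / al) ^+ 2] times [be] times the sum of the [b k], which is negligible since
    [d1 / al <= 1 / 640]. The geometry enters mostly through one identity, [stiefel_dist_gram]: the
    symmetric part of [X^T *m (Y - X)] is quadratic in [Y - X], so the deviations from Euclidean
    averaging are of second order. *)

Local Notation dot := frob_inner.

Section Frobenius.
Variable R : realType.

Lemma col_mulmx m n p (A : 'M[R]_(m, n)) (B : 'M[R]_(n, p)) j :
  col j (A *m B) = A *m col j B.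
Proof. by rewrite !colE mulmxA. Qed.

Lemma dotE m n (A B : 'M[R]_(m, n)) : dot A B = \sum_i \sum_j A i j * B i j.
Proof.
rewrite /dot /mxtrace exchange_big /=.
by apply: eq_bigr => j _; rewrite mxE; apply: eq_bigr => i _; rewrite mxE.
Qed.

Lemma dotC m n (A B : 'M[R]_(m, n)) : dot A B = dot B A.
Proof.
by rewrite !dotE; apply: eq_bigr => i _; apply: eq_bigr => j _; rewrite mulrC.
Qed.

Lemma dotDr m n (A B C : 'M[R]_(m, n)) : dot A (B + C) = dot A B + dot A C.
Proof. by rewrite /dot mulmxDr mxtraceD. Qed.

Lemma dotZr m n c (A B : 'M[R]_(m, n)) : dot A (c *: B) = c * dot A B.
Proof. by rewrite /dot -scalemxAr mxtraceZ. Qed.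

Lemma dotDl m n (A B C : 'M[R]_(m, n)) : dot (A + B) C = dot A C + dot B C.
Proof. by rewrite dotC dotDr dotC [dot C B]dotC. Qed.

Lemma dotZl m n c (A B : 'M[R]_(m, n)) : dot (c *: A) B = c * dot A B.
Proof. by rewrite dotC dotZr dotC. Qed.

Lemma dotNr m n (A B : 'M[R]_(m, n)) : dot A (- B) = - dot A B.
Proof. by rewrite -scaleN1r dotZr mulN1r. Qed.

Lemma dotNl m n (A B : 'M[R]_(m, n)) : dot (- A) B = - dot A B.
Proof. by rewrite dotC dotNr dotC. Qed.

Definition dotL := (dotDl, dotDr, dotNl, dotNr, dotZl, dotZr).

Lemma dot0r m n (A : 'M[R]_(m, n)) : dot A 0 = 0.
Proof. by rewrite -[X in dot _ X](scale0r 0) dotZr mul0r. Qed.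

Lemma dot0l m n (A : 'M[R]_(m, n)) : dot 0 A = 0.
Proof. by rewrite dotC dot0r. Qed.

Lemma dot_sumr m n I (s : seq I) (p : pred I) (A : 'M[R]_(m, n)) F :
  dot A (\sum_(i <- s | p i) F i) = \sum_(i <- s | p i) dot A (F i).
Proof.
by apply: (big_morph (dot A) (fun x y => dotDr A x y)); rewrite dot0r.
Qed.

Lemma dot_ge0 m n (A : 'M[R]_(m, n)) : 0 <= dot A A.
Proof.
by rewrite dotE; do 2 (apply: sumr_ge0 => ? _); rewrite -expr2 sqr_ge0.
Qed.

Lemma fnorm_ge0 m n (A : 'M[R]_(m, n)) : 0 <= fnorm A.
Proof. exact: sqrtr_ge0. Qed.
Hint Resolve fnorm_ge0 : core.

Lemma fnorm2 m n (A : 'M[R]_(m, n)) : fnorm A ^+ 2 = dot A A.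
Proof. by rewrite sqr_sqrtr // dot_ge0. Qed.

Lemma fnorm_entry m n (A : 'M[R]_(m, n)) i j : `|A i j| <= fnorm A.
Proof.
rewrite -sqrtr_sqr ler_wsqrtr // dotE (bigD1 i) //= (bigD1 j) //= expr2.
rewrite -addrA lerDl addr_ge0 //.
  by apply: sumr_ge0 => k _; rewrite -expr2 sqr_ge0.
by do 2 (apply: sumr_ge0 => ? _); rewrite -expr2 sqr_ge0.
Qed.

Lemma fnorm_eq0 m n (A : 'M[R]_(m, n)) : fnorm A = 0 -> A = 0.
Proof.
move=> A0; apply/matrixP => i j; rewrite mxE.
by apply/eqP; rewrite -normr_le0 -A0 fnorm_entry.
Qed.

Lemma fnorm0 m n : fnorm (0 : 'M[R]_(m, n)) = 0.
Proof. by rewrite /fnorm dot0l sqrtr0. Qed.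

Lemma fnormZ m n c (A : 'M[R]_(m, n)) : fnorm (c *: A) = `|c| * fnorm A.
Proof.
by rewrite /fnorm !dotL mulrA -expr2 sqrtrM ?sqr_ge0 // sqrtr_sqr.
Qed.

Lemma fnormN m n (A : 'M[R]_(m, n)) : fnorm (- A) = fnorm A.
Proof. by rewrite -scaleN1r fnormZ normrN1 mul1r. Qed.

Lemma fnormC m n (A B : 'M[R]_(m, n)) : fnorm (A - B) = fnorm (B - A).
Proof. by rewrite -opprB fnormN. Qed.

Lemma dot_le m n (A B : 'M[R]_(m, n)) : dot A B <= fnorm A * fnorm B.
Proof.
have [A0|A0] := eqVneq (fnorm A) 0.
  by rewrite (fnorm_eq0 A0) fnorm0 mul0r dot0l.
have [B0|B0] := eqVneq (fnorm B) 0.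
  by rewrite (fnorm_eq0 B0) fnorm0 mulr0 dot0r.
have hA : 0 < fnorm A by rewrite lt_neqAle eq_sym A0 fnorm_ge0.
have hB : 0 < fnorm B by rewrite lt_neqAle eq_sym B0 fnorm_ge0.
have := dot_ge0 (fnorm B *: A - fnorm A *: B).
rewrite !dotL -!fnorm2 [dot B A]dotC => H.
have hAB := mulr_gt0 hA hB.
by rewrite -(ler_pM2l hAB); lra.
Qed.

Lemma dot_norm m n (A B : 'M[R]_(m, n)) : `|dot A B| <= fnorm A * fnorm B.
Proof.
by rewrite ler_norml dot_le andbT lerNl -dotNl (le_trans (dot_le _ _)) // fnormN.
Qed.

Lemma fnorm2D m n (A B : 'M[R]_(m, n)) :
  fnorm (A + B) ^+ 2 = fnorm A ^+ 2 + 2 * dot A B + fnorm B ^+ 2.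
Proof. by rewrite !fnorm2 !dotL [dot B A]dotC; ring. Qed.

Lemma fnorm2B m n (A B : 'M[R]_(m, n)) :
  fnorm (A - B) ^+ 2 = fnorm A ^+ 2 - 2 * dot A B + fnorm B ^+ 2.
Proof. by rewrite fnorm2D fnormN dotNr; ring. Qed.

Lemma fnorm2D_le m n (A B : 'M[R]_(m, n)) :
  fnorm (A + B) ^+ 2 <= 2 * fnorm A ^+ 2 + 2 * fnorm B ^+ 2.
Proof. by have := sqr_ge0 (fnorm (A - B)); rewrite fnorm2B fnorm2D; lra. Qed.

Lemma fnorm2B_le m n (A B : 'M[R]_(m, n)) :
  fnorm (A - B) ^+ 2 <= 2 * fnorm A ^+ 2 + 2 * fnorm B ^+ 2.
Proof. by have := fnorm2D_le A (- B); rewrite fnormN. Qed.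

Lemma fnormD m n (A B : 'M[R]_(m, n)) : fnorm (A + B) <= fnorm A + fnorm B.
Proof.
rewrite -(@ler_pXn2r _ 2) ?nnegrE ?addr_ge0 // fnorm2D.
by have := dot_le A B; lra.
Qed.

Lemma fnormB m n (A B : 'M[R]_(m, n)) : fnorm (A - B) <= fnorm A + fnorm B.
Proof. by rewrite -(fnormN B) fnormD. Qed.

Lemma fnorm_sum m n I (s : seq I) (p : pred I) (F : I -> 'M[R]_(m, n)) :
  fnorm (\sum_(i <- s | p i) F i) <= \sum_(i <- s | p i) fnorm (F i).
Proof.
elim/big_rec2 : _ => [|i y x _ h]; first by rewrite fnorm0.
by rewrite (le_trans (fnormD _ _)) // lerD2l.
Qed.

Lemma fnorm_le_sqr m n (A : 'M[R]_(m, n)) c :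
  0 <= c -> fnorm A ^+ 2 <= c ^+ 2 -> fnorm A <= c.
Proof. by move=> c0; rewrite ler_pXn2r ?nnegrE. Qed.

Lemma dot_mulmx m n p (A : 'M[R]_(m, n)) (B : 'M[R]_(n, p)) C :
  dot (A *m B) C = dot B (A^T *m C).
Proof. by rewrite /dot trmx_mul mulmxA. Qed.

Lemma dot_tr m n (A B : 'M[R]_(m, n)) : dot A^T B^T = dot A B.
Proof.
rewrite !dotE exchange_big; apply: eq_bigr => i _; apply: eq_bigr => j _.
by rewrite !mxE.
Qed.

Lemma dot_mulmxl m n p (A : 'M[R]_(m, n)) (B : 'M[R]_(n, p)) C :
  dot (A *m B) C = dot A (C *m B^T).
Proof. by rewrite -dot_tr trmx_mul dot_mulmx -dot_tr !trmxK trmx_mul !trmxK. Qed.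

Lemma fnorm_tr m n (A : 'M[R]_(m, n)) : fnorm A^T = fnorm A.
Proof. by rewrite /fnorm dot_tr. Qed.

Lemma fnorm2_row m n (A : 'M[R]_(m, n)) :
  fnorm A ^+ 2 = \sum_i fnorm (row i A) ^+ 2.
Proof.
rewrite fnorm2 dotE; apply: eq_bigr => i _; rewrite fnorm2 dotE big_ord1.
by apply: eq_bigr => j _; rewrite !mxE.
Qed.

Lemma fnorm2_col m n (A : 'M[R]_(m, n)) :
  fnorm A ^+ 2 = \sum_j fnorm (col j A) ^+ 2.
Proof.
rewrite -fnorm_tr fnorm2_row; apply: eq_bigr => i _.
by rewrite -tr_col fnorm_tr.
Qed.

Lemma fnormM m n p (A : 'M[R]_(m, n)) (B : 'M[R]_(n, p)) :
  fnorm (A *m B) <= fnorm A * fnorm B.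
Proof.
apply: fnorm_le_sqr; first by rewrite mulr_ge0.
rewrite exprMn [fnorm A ^+ 2](fnorm2_row A) [fnorm B ^+ 2](fnorm2_col B) mulr_suml fnorm2 dotE.
apply: ler_sum => i _; rewrite mulr_sumr; apply: ler_sum => j _.
rewrite -expr2 -real_normK ?num_real // -exprMn ler_pXn2r ?nnegrE ?mulr_ge0 //.
have -> : (A *m B) i j = dot (row i A)^T (col j B).
  by rewrite /dot trmxK -row_mul -col_mulmx trace_mx11 [in RHS]mxE [in RHS]mxE.
by rewrite (le_trans (dot_norm _ _)) // fnorm_tr.
Qed.

Definition psd n (T : 'M[R]_n) := forall u : 'cV_n, 0 <= dot u (T *m u).

(** The inner product is the sum of the quadratic forms of [T] at the columns of [A]. *)
Lemma dot_psd m n (T : 'M[R]_n) (A : 'M[R]_(n, m)) : psd T -> 0 <= dot A (T *m A).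
Proof.
move=> hT; rewrite -[X in 0 <= X]dot_tr [X in 0 <= X]dotE.
have -> : \sum_i \sum_j A^T i j * (T *m A)^T i j
  = \sum_i dot (col i A) (T *m col i A).
  apply: eq_bigr => i _; rewrite -col_mulmx dotE.
  by apply: eq_bigr => j _; rewrite big_ord1 !mxE.
by apply: sumr_ge0 => i _.
Qed.

Lemma psd_gram m n (A : 'M[R]_(m, n)) : psd (A^T *m A).
Proof. by move=> u; rewrite -mulmxA -dot_mulmx dot_ge0. Qed.

Lemma opnorm2_le m n p (A : 'M[R]_(m, n)) (B : 'M[R]_(n, p)) :
  fnorm (A *m B) <= opnorm2 A * fnorm B.
Proof.
(* The Frobenius norm bounds the set, so [sup] is a genuine supremum and not its default value. *)
have hub : has_ubound [set fnorm (A *m u) | u in [set u : 'cV[R]_n | fnorm u <= 1]].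
  exists (fnorm A) => _ [u /= u1 <-].
  by rewrite (le_trans (fnormM _ _)) // ler_piMr.
have op0 : 0 <= opnorm2 A.
  apply: (ub_le_sup hub); exists 0; first by rewrite /= fnorm0 ler01.
  by rewrite mulmx0 fnorm0.
have hv (u : 'cV_n) : fnorm (A *m u) <= opnorm2 A * fnorm u.
  have [u0|u0] := eqVneq (fnorm u) 0.
    by rewrite (fnorm_eq0 u0) mulmx0 !fnorm0 mulr0.
  have hu : 0 < fnorm u by rewrite lt_neqAle eq_sym u0 fnorm_ge0.
  rewrite -ler_pdivrMr //; apply: (ub_le_sup hub).
  exists ((fnorm u)^-1 *: u) => /=.
    by rewrite fnormZ ger0_norm ?invr_ge0 // mulVf.
  by rewrite -scalemxAr fnormZ ger0_norm ?invr_ge0 // mulrC.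
apply: fnorm_le_sqr; first by rewrite mulr_ge0.
rewrite exprMn !fnorm2_col mulr_sumr; apply: ler_sum => j _.
by rewrite -exprMn col_mulmx ler_pXn2r ?nnegrE ?mulr_ge0.
Qed.

Lemma opnorm2_ge0 m n (A : 'M[R]_(m, n)) : 0 <= opnorm2 A.
Proof.
rewrite /opnorm2; apply: ub_le_sup.
  exists (fnorm A) => _ [u /= u1 <-].
  by rewrite (le_trans (fnormM _ _)) // ler_piMr.
exists 0; first by rewrite /= fnorm0 ler01.
by rewrite mulmx0 fnorm0.
Qed.

End Frobenius.
#[global] Hint Extern 0 (is_true (_ <= fnorm _)) => exact: fnorm_ge0 : core.

(** * The spectral theorem for real symmetric matrices *)

Section Spectral.
Variable R : realType.

(** A complex eigenvector exists by algebraic closedness. Its real and imaginary parts [x] and [y]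
    span an invariant real space; once the eigenvalue is known to be real, whichever of the two is
    nonzero is a real eigenvector. *)
Lemma sym_eigenvector n (A : 'M[R]_n.+1) : A^T = A ->
  exists a (u : 'rV_n.+1), u != 0 /\ u *m A = a *: u.
Proof.
move=> As; have [a /eigenvalueP [v vA v0]] :=
  eigenvalue_closed (map_mx (real_complex R) A) (ltn0Sn n).
pose x := map_mx (@complex.Re R) v; pose y := map_mx (@complex.Im R) v.
pose al := complex.Re a; pose be := complex.Im a.
have hx : x *m A = al *: x - be *: y.
  apply/rowP => j; move/rowP: vA => /(_ j) /(congr1 (@complex.Re R)).
  rewrite !mxE raddf_sum /=; case: (a) @al @be => al be /=.
  case: (v ord0 j) => p q /= <-; apply: eq_bigr => k _.
  by rewrite !mxE; case: (v ord0 k) => ? ? /=; ring.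
have hy : y *m A = al *: y + be *: x.
  apply/rowP => j; move/rowP: vA => /(_ j) /(congr1 (@complex.Im R)).
  rewrite !mxE raddf_sum /=; case: (a) @al @be {hx} => al be /=.
  case: (v ord0 j) => p q /= <-; apply: eq_bigr => k _.
  by rewrite !mxE; case: (v ord0 k) => ? ? /=; ring.
have xy0 : 0 < dot x x + dot y y.
  rewrite lt_neqAle addr_ge0 ?dot_ge0 // andbT eq_sym.
  apply: contra_neq v0 => /eqP; rewrite paddr_eq0 ?dot_ge0 // -!fnorm2.
  rewrite !sqrf_eq0 => /andP[/eqP /fnorm_eq0 x0 /eqP /fnorm_eq0 y0].
  apply/rowP => j; move/rowP: x0 => /(_ j); move/rowP: y0 => /(_ j).
  by rewrite !mxE; case: (v ord0 j) => ? ? /= -> ->.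
(* By symmetry the pairing of [x *m A] with [y] equals that of [x] with [y *m A], which reads
   [be * (dot x x + dot y y) = 0]. *)
have be0 : be = 0.
  have : dot (x *m A) y = dot x (y *m A) by rewrite dot_mulmxl As.
  rewrite hx hy !dotL => h; apply/eqP; rewrite -(mulrI_eq0 _ (mulfI (lt0r_neq0 xy0))).
  by apply/eqP; lra.
rewrite be0 scale0r subr0 in hx; rewrite be0 scale0r addr0 in hy.
have [x0|x0] := eqVneq x 0; last by exists al, x.
exists al, y; split => //; apply: contraTneq xy0 => ->.
by rewrite x0 !dot0l addr0 ltxx.
Qed.

End Spectral.

Section Spectral.
Variable R : realType.

(** The reflection along [u - e] exchanges the two unit vectors [e] and [u]; its first row is the
    image of [e]. *)
Lemma householder n (u : 'rV[R]_n.+1) : fnorm u = 1 ->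
  exists H : 'M[R]_n.+1, [/\ H^T = H, H *m H = 1%:M & row ord0 H = u].
Proof.
move=> u1; pose e := delta_mx ord0 ord0 : 'rV[R]_n.+1.
(* The reflection is undefined when [u = e], where the identity serves. *)
have [->|ue] := eqVneq u e.
  exists 1%:M; rewrite trmx1 mulmx1; split => //.
  by rewrite rowE mulmx1.
have [w wE] : exists w, w = u - e by exists (u - e).
pose c := dot w w.
have c0 : c != 0.
  rewrite /c wE -fnorm2 sqrf_eq0; apply: contra_neq ue => /fnorm_eq0.
  by move/eqP; rewrite subr_eq0 => /eqP.
have e1 : dot e e = 1.
  rewrite dotE big_ord1 (bigD1 ord0) //= big1 ?addr0 ?mxE ?eqxx ?mulr1 // => i i0.
  by rewrite mxE (negPf i0) andbF mulr0.
have cE : c = 2 - 2 * dot u e.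
  by rewrite /c -fnorm2 wE fnorm2B u1 fnorm2 e1; ring.
have we : dot w e = - (c / 2) by rewrite cE wE !dotL e1; field.
have sc (a b : 'rV[R]_n.+1) : a *m b^T = (dot a b)%:M.
  by rewrite [LHS]mx11_scalar -trace_mx11 /dot mxtrace_mulC -mxtrace_tr trmx_mul trmxK.
exists (1%:M - (2 / c) *: (w^T *m w)); split.
- by rewrite linearB /= trmx1 linearZ /= trmx_mul trmxK.
- rewrite mulmxBl mul1mx mulmxBr mulmx1 -!scalemxAl -!scalemxAr.
  rewrite -mulmxA (mulmxA w) sc mul_scalar_mx -!scalemxAr -/c !scalerA.
  rewrite (_ : 2 / c * (2 / c * c) = 2 / c + 2 / c); last by field.
  by rewrite scalerDl opprB addrK subrK.
- rewrite rowE mulmxBr mulmx1 -scalemxAr mulmxA -/e sc dotC we mul_scalar_mx scalerA.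
  rewrite (_ : _ * _ = -1); last by field.
  by rewrite scaleN1r opprK wE subrKC.
Qed.

Lemma sym_spectral_step n (A H : 'M[R]_(1 + n)) a (Q : 'M[R]_n) (d : 'rV_n) :
  H^T = H -> H *m H = 1%:M -> Q^T *m Q = 1%:M ->
  A = H *m block_mx a%:M 0 0 (Q *m diag_mx d *m Q^T) *m H ->
  exists (P : 'M[R]_(1 + n)) (d' : 'rV_(1 + n)),
    P^T *m P = 1%:M /\ A = P *m diag_mx d' *m P^T.
Proof.
move=> Hs HH QQ AE; exists (H *m block_mx 1%:M 0 0 Q), (row_mx a%:M d); split.
  rewrite trmx_mul Hs mulmxA -(mulmxA _ H H) HH mulmx1 tr_block_mx mulmx_block.
  by rewrite !trmx0 !trmx1 !(mul0mx, mulmx0, mulmx1, addr0, add0r) QQ -scalar_mx_block.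
rewrite trmx_mul Hs {1}AE !mulmxA; congr (_ *m _).
rewrite -!mulmxA; congr (_ *m _); rewrite mulmxA.
rewrite diag_mx_row tr_block_mx !mulmx_block.
rewrite !trmx0 !trmx1 !(mul0mx, mulmx0, mulmx1, mul1mx, addr0, add0r) !mulmxA.
congr block_mx; apply/matrixP => i j; rewrite !ord1 !mxE eqxx mulr1n //.
Qed.

(** Deflation: conjugating by a Householder reflection whose first row is a unit eigenvector makes
    the first row of the matrix a multiple of the first basis vector. Symmetry clears the first
    column as well, and the remaining block is handled by induction. *)
Theorem sym_spectral n (A : 'M[R]_n) : A^T = A ->
  exists (P : 'M[R]_n) (d : 'rV_n), P^T *m P = 1%:M /\ A = P *m diag_mx d *m P^T.
Proof.
elim: n A => [|n IH] A As.
  by exists 1%:M, 0; rewrite trmx1 !mulmx1; split=> //; apply/matrixP => -[].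
have [a [u0 [u00 u0A]]] := sym_eigenvector As.
pose u := (fnorm u0)^-1 *: u0.
have u1 : fnorm u = 1.
  have h : fnorm u0 != 0 by apply: contra_neq u00 => /fnorm_eq0.
  by rewrite fnormZ ger0_norm ?invr_ge0 // mulVf.
have uA : u *m A = a *: u by rewrite -scalemxAl u0A !scalerA mulrC.
have [H [Hs HH Hu]] := householder u1.
have [B BD] : exists B, B = H *m A *m H by exists (H *m A *m H).
have Bs : B^T = B by rewrite BD !trmx_mul As Hs mulmxA.
have B0 : row ord0 B = a *: delta_mx ord0 ord0.
  rewrite BD 2!row_mul Hu uA -scalemxAl -Hu -row_mul HH.
  by rewrite rowE mulmx1.
pose B' : 'M[R]_(1 + n) := B.
have Bul : ulsubmx B' = a%:M.
  rewrite [LHS]mx11_scalar; congr _%:M; rewrite !mxE.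
  have := congr1 (fun v : 'rV_n.+1 => v ord0 ord0) B0; rewrite !mxE mulr1 => <-.
  by congr (B _ _); apply/val_inj.
have Bur : ursubmx B' = 0.
  apply/matrixP => i j; rewrite !mxE.
  have := congr1 (fun v : 'rV_n.+1 => v ord0 (rshift 1 j)) B0.
  rewrite !mxE /= mulr0 => <-.
  by congr (B _ _); apply/val_inj; rewrite /= ?ord1.
have Bdl : dlsubmx B' = 0.
  by rewrite -[LHS]trmxK trmx_dlsub [B'^T]Bs Bur trmx0.
have B's : (drsubmx B')^T = drsubmx B' by rewrite trmx_drsub [B'^T]Bs.
have [Q [d [QQ hB]]] := IH _ B's.
have BE : B' = block_mx a%:M 0 0 (drsubmx B').
  by rewrite -[LHS]submxK Bul Bur Bdl.
apply: (sym_spectral_step (H := H) (a := a) (d := d) Hs HH QQ).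
by rewrite -hB -BE /B' BD !mulmxA HH mul1mx -mulmxA HH mulmx1.
Qed.

End Spectral.

(** * The polar retraction and the tangent projection *)

Section InvSqrt.
Variable R : realType.

Lemma quadE n (A : 'M[R]_n) (u : 'cV_n) :
  (u^T *m A *m u) ord0 ord0 = dot u (A *m u).
Proof. by rewrite -mulmxA /dot -trace_mx11. Qed.

Lemma fnorm_psd_le n m (T : 'M[R]_n) (A : 'M[R]_(n, m)) : psd T ->
  fnorm A <= fnorm ((1%:M + T) *m A).
Proof.
move=> hT; rewrite -(@ler_pXn2r _ 2) ?nnegrE // mulmxDl mul1mx fnorm2D.
by have := dot_psd A hT; have := sqr_ge0 (fnorm (T *m A)); lra.
Qed.

Lemma fnorm_psd_ler n m (T : 'M[R]_n) (A : 'M[R]_(m, n)) : T^T = T -> psd T ->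
  fnorm A <= fnorm (A *m (1%:M + T)).
Proof.
move=> Ts hT; rewrite -fnorm_tr -[X in _ <= X]fnorm_tr trmx_mul.
by rewrite linearD /= trmx1 Ts fnorm_psd_le.
Qed.

(** Uniqueness of the inverse square root, needed to identify the value that [xget] selects. As [B]
    and [C] have the same square, [E = B - C] satisfies [B *m E + E *m C = 0]. Pairing with [E]
    gives two nonnegative numbers of sum zero, and positive definiteness of [B] then kills every
    column of [E]. *)
Lemma posdef_sqr_inj n (B C A : 'M[R]_n) : posdef B -> posdef C ->
  B *m B *m A = 1%:M -> C *m C *m A = 1%:M -> B = C.
Proof.
move=> [Bs hB] [Cs hC] hBA hCA.
have ABB : A *m (B *m B) = 1%:M by exact: mulmx1C.
have BC : B *m B = C *m C.
  by rewrite -[LHS]mul1mx -hCA -!mulmxA ABB mulmx1.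
have psdB : psd B.
  move=> u; have [->|u0] := eqVneq u 0; first by rewrite dot0l.
  by rewrite -quadE ltW ?hB.
have psdC : psd C.
  move=> u; have [->|u0] := eqVneq u 0; first by rewrite dot0l.
  by rewrite -quadE ltW ?hC.
pose E := B - C.
have EE : B *m E + E *m C = 0.
  by rewrite /E mulmxBr mulmxBl BC addrA subrK subrr.
have h1 : 0 <= dot E (E *m C).
  by rewrite -dot_tr trmx_mul Cs dot_psd.
have h2 := dot_psd E psdB.
have h0 : dot E (B *m E) = 0.
  have : dot E (B *m E + E *m C) = 0 by rewrite EE dot0r.
  by rewrite dotDr; lra.
have hcol j : col j E = 0.
  apply/eqP; apply: contraT => /hB; rewrite quadE => hj.
  suff : 0 < dot E (B *m E) by rewrite h0 ltxx.
  rewrite -[X in 0 < X]dot_tr [X in 0 < X]dotE.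
  have cE i : \sum_k E^T i k * (B *m E)^T i k = dot (col i E) (B *m col i E).
    rewrite -col_mulmx dotE.
    by apply: eq_bigr => k _; rewrite big_ord1 !mxE.
  rewrite (bigD1 j) //= cE ltr_wpDr //.
  by apply: sumr_ge0 => i _; rewrite cE psdB.
apply/eqP; rewrite -subr_eq0; apply/eqP/matrixP => i j.
by have /colP/(_ i) := hcol j; rewrite !mxE.
Qed.

(* The square root of [1 + v^T v] is written [1 + T], as the second-order
   properties of the retraction come from [T] being positive semidefinite. *)
Lemma invsqrtmx_gram m n (v : 'M[R]_(m, n)) :
  let B := invsqrtmx (1%:M + v^T *m v) in
  exists T : 'M[R]_n, [/\ T^T = T, psd T,
    (1%:M + T) *m (1%:M + T) = 1%:M + v^T *m v, B^T = B &
    B *m (1%:M + T) = 1%:M].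
Proof.
move=> B0; set A := 1%:M + v^T *m v.
have As : A^T = A by rewrite /A linearD /= trmx1 trmx_mul trmxK.
have [P [d [PP AE]]] := sym_spectral As.
have PPt : P *m P^T = 1%:M by exact: mulmx1C.
have d1 i : 1 <= d ord0 i.
  have pA : P^T *m A *m P = diag_mx d.
    by rewrite AE !mulmxA PP mul1mx -mulmxA PP mulmx1.
  have -> : d ord0 i = (P^T *m A *m P) i i by rewrite pA mxE eqxx mulr1n.
  have -> : (P^T *m A *m P) i i = dot (col i P) (A *m col i P).
    rewrite -col_mulmx dotE -mulmxA mxE; apply: eq_bigr => k _.
    by rewrite big_ord1 !mxE.
  rewrite /A mulmxDl mul1mx dotDr.
  have -> : dot (col i P) (col i P) = 1.
    have := congr1 (fun M : 'M[R]_n => M i i) PP; rewrite !mxE eqxx mulr1n => <-.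
    by rewrite dotE; apply: eq_bigr => k _; rewrite big_ord1 !mxE.
  by rewrite lerDl psd_gram.
(* Functional calculus: [P *m diag_mx (map_mx f d) *m P^T] stands for [f(A)], and products of such
   matrices are computed on the eigenvalues, which are all at least 1. *)
have dfun (f g : R -> R) :
  (P *m diag_mx (map_mx f d) *m P^T) *m (P *m diag_mx (map_mx g d) *m P^T) =
  P *m diag_mx (map_mx (fun x => f x * g x) d) *m P^T.
  rewrite !mulmxA; congr (_ *m _); rewrite -!mulmxA; congr (_ *m _).
  rewrite (mulmxA P^T) PP mul1mx mulmx_diag; congr diag_mx.
  by apply/rowP => i; rewrite !mxE.
have dfun_ext (f g : R -> R) : (forall x, 1 <= x -> f x = g x) ->
  map_mx f d = map_mx g d.
  by move=> fg; apply/rowP => i; rewrite !mxE fg.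
have dsym (f : R -> R) : (P *m diag_mx (map_mx f d) *m P^T)^T =
    P *m diag_mx (map_mx f d) *m P^T.
  by rewrite !trmx_mul trmxK tr_diag_mx mulmxA.
have dquad (f : R -> R) (u : 'cV_n) :
    dot u (P *m diag_mx (map_mx f d) *m P^T *m u) =
    \sum_i f (d ord0 i) * (P^T *m u) i ord0 ^+ 2.
  rewrite -!mulmxA dotC dot_mulmx dotC dotE; apply: eq_bigr => i _.
  by rewrite big_ord1 mul_diag_mx !mxE; ring.
pose T := P *m diag_mx (map_mx (fun x => Num.sqrt x - 1) d) *m P^T.
have TE : 1%:M + T = P *m diag_mx (map_mx Num.sqrt d) *m P^T.
  have -> : map_mx Num.sqrt d = const_mx 1 + map_mx (fun x => Num.sqrt x - 1) d.
    by apply/rowP => i; rewrite !mxE subrKC.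
  by rewrite linearD /= diag_const_mx mulmxDr mulmxDl mulmx1 PPt.
have TT : (1%:M + T) *m (1%:M + T) = A.
  rewrite TE dfun AE; congr (_ *m diag_mx _ *m _); apply/rowP => i.
  by rewrite !mxE -expr2 sqr_sqrtr // (le_trans ler01).
pose C := P *m diag_mx (map_mx (fun x => (Num.sqrt x)^-1) d) *m P^T.
have CT : C *m (1%:M + T) = 1%:M.
  rewrite TE dfun (dfun_ext _ (fun=> 1)); last first.
    by move=> x x1; rewrite mulVf // gt_eqF // sqrtr_gt0 (lt_le_trans ltr01).
  rewrite (_ : map_mx _ d = const_mx 1) ?diag_const_mx ?mulmx1 //.
  by apply/rowP => i; rewrite !mxE.
have CA : C *m C *m A = 1%:M.
  by rewrite -TT mulmxA -(mulmxA C) CT mulmx1 CT.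
have Cpd : posdef C.
  split; first exact: dsym.
  move=> u u0; rewrite quadE dquad.
  have : P^T *m u != 0.
    by apply: contra_neq u0 => h; rewrite -[u]mul1mx -PPt -mulmxA h mulmx0.
  case/cV0Pn => i hi; rewrite (bigD1 i) //= ltr_wpDr //.
    apply: sumr_ge0 => j _; rewrite mulr_ge0 ?sqr_ge0 // invr_ge0 sqrtr_ge0 //.
  by rewrite mulr_gt0 ?exprn_even_gt0 //= invr_gt0 sqrtr_gt0 (lt_le_trans ltr01).
have BE : B0 = C.
  rewrite /B0 /invsqrtmx -/A; case: xgetP => [B _ [Bpd BA]|/(_ C)].
    exact: (posdef_sqr_inj Bpd Cpd BA CA).
  by case.
exists T; split=> //; first exact: dsym; last 2 first.
- by rewrite BE dsym.
- by rewrite BE.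
move=> u; rewrite dquad; apply: sumr_ge0 => i _.
by rewrite mulr_ge0 ?sqr_ge0 // subr_ge0 -sqrtr1 ler_wsqrtr.
Qed.

(** Continuity of the retraction, hence its measurability, rests on this bound. With [E] the
    difference of the two square roots, the difference of the inverses is [B *m E *m C], where [B]
    and [C] are contractions. The difference of the squares is [(1%:M + T) *m E + E *m (1%:M + U)]
    up to sign; pairing it with [E] yields at least [2 * fnorm E ^+ 2]. *)
Lemma invsqrtmx_lip m n (v w : 'M[R]_(m, n)) :
  fnorm (invsqrtmx (1%:M + v^T *m v) - invsqrtmx (1%:M + w^T *m w)) <=
  fnorm (v^T *m v - w^T *m w).
Proof.
have [T [Ts hT TT Bs BT]] := invsqrtmx_gram v.
have [U [Us hU UU Cs CU]] := invsqrtmx_gram w.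
set B := invsqrtmx _ in Bs BT *; set C := invsqrtmx _ in Cs CU *.
pose E := U - T.
have BCE : B - C = B *m E *m C.
  have UC : (1%:M + U) *m C = 1%:M by exact: mulmx1C.
  have -> : E = (1%:M + U) - (1%:M + T) by rewrite /E opprD addrACA subrr add0r.
  by rewrite mulmxBr mulmxBl BT mul1mx -mulmxA UC mulmx1.
have hBx k (x : 'M[R]_(n, k)) : fnorm (B *m x) <= fnorm x.
  rewrite (le_trans (fnorm_psd_le (B *m x) hT)) // mulmxA.
  by rewrite (mulmx1C BT) mul1mx.
have hCx k (x : 'M[R]_(k, n)) : fnorm (x *m C) <= fnorm x.
  rewrite (le_trans (fnorm_psd_ler (x *m C) Us hU)) // -mulmxA CU mulmx1 //.
rewrite BCE (le_trans (hCx _ _)) // (le_trans (hBx _ _)) //.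
have hE : (1%:M + T) *m E + E *m (1%:M + U) = w^T *m w - v^T *m v.
  have -> : w^T *m w - v^T *m v = (1%:M + w^T *m w) - (1%:M + v^T *m v).
    by rewrite opprD addrACA subrr add0r.
  rewrite -TT -UU /E !(mulmxDl, mulmxDr, mulmxBl, mulmxBr, mulmxN, mulNmx, mul1mx, mulmx1).
  move: (T *m U) (T *m T) (U *m U) => a b c.
  by apply/matrixP => i j; rewrite !mxE; ring.
have h1 := dot_psd E hT.
have h2 : 0 <= dot E (E *m U) by rewrite -dot_tr trmx_mul Us dot_psd.
have : 2 * fnorm E ^+ 2 <= fnorm E * fnorm (v^T *m v - w^T *m w).
  rewrite [fnorm (v^T *m v - _)]fnormC -hE.
  apply: le_trans (dot_le _ _).
  by rewrite fnorm2 mulmxDl mulmxDr mul1mx mulmx1 !dotDr; lra.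
have [->|E0] := eqVneq (fnorm E) 0; first by rewrite fnorm_ge0.
have Ep : 0 < fnorm E by rewrite lt_neqAle eq_sym E0 fnorm_ge0.
by rewrite expr2 mulrCA ler_pM2l //; have := fnorm_ge0 E; lra.
Qed.

End InvSqrt.

Section Stiefel.
Variables (R : realType) (n r : nat).
Implicit Types (X Y Z v : 'M[R]_(n, r)).

Lemma stiefel_fnorm m X (A : 'M[R]_(r, m)) : stiefel X -> fnorm (X *m A) = fnorm A.
Proof. by move=> hX; rewrite /fnorm dot_mulmx mulmxA hX mul1mx. Qed.

(** Both sides equal [X^T *m Y + Y^T *m X - 2] times the identity. A chord of the manifold is thus
    tangent up to a quadratic error, which is the source of the second-order estimates below. *)
Lemma stiefel_dist_gram X Y : stiefel X -> stiefel Y ->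
  X^T *m (Y - X) + (Y - X)^T *m X = - ((Y - X)^T *m (Y - X)).
Proof.
move=> hX hY; rewrite [(Y - X)^T]linearB /= !(mulmxDl, mulmxDr, mulmxN, mulNmx) hX hY.
move: (X^T *m Y) (Y^T *m X) => a b.
by apply/matrixP => i j; rewrite !mxE; ring.
Qed.

Lemma dot_tr_sym m (A S : 'M[R]_m) : S^T = S -> dot A^T S = dot A S.
Proof. by move=> hS; rewrite -dot_tr trmxK hS. Qed.

Lemma dot_sym m (A S : 'M[R]_m) : S^T = S -> dot A S = 2^-1 * dot (A + A^T) S.
Proof. by move=> hS; rewrite dotDl dot_tr_sym //; field. Qed.

Lemma tangent_gram X v : stiefel X -> tangent X v ->
  (X + v)^T *m (X + v) = 1%:M + v^T *m v.
Proof.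
move=> hX hv; rewrite [(X + v)^T]linearD /= mulmxDl !mulmxDr hX.
have hv0 : X^T *m v + v^T *m X = 0 by [].
by rewrite addrA -(addrA 1%:M) hv0 addr0.
Qed.

Lemma polar_retractionP X v : stiefel X -> tangent X v ->
  exists T, [/\ T^T = T, psd T, (1%:M + T) *m (1%:M + T) = 1%:M + v^T *m v,
    polar_retraction X v *m (1%:M + T) = X + v & stiefel (polar_retraction X v)].
Proof.
move=> hX hv; have [T [Ts hT TT Bs BT]] := invsqrtmx_gram v.
exists T; rewrite /polar_retraction; set B := invsqrtmx _ in Bs BT *.
split=> //; first by rewrite -mulmxA BT mulmx1.
rewrite /stiefel /= trmx_mul Bs mulmxA -(mulmxA B) tangent_gram //.
by rewrite -TT mulmxA BT mul1mx (mulmx1C BT).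
Qed.

Lemma polar_stiefel X v : stiefel X -> tangent X v -> stiefel (polar_retraction X v).
Proof. by move=> hX /(polar_retractionP hX)[T []]. Qed.

(** With [Q] the retracted point, [X + v - Z = (Q - Z) + Q *m T]. In the cross term the symmetric
    [T] sees only the symmetric part of [Q^T *m (Q - Z)], half the Gram matrix of [Z - Q], so the
    term is nonnegative and retracting never moves away from a point of the manifold. *)
Lemma polar_dist X v Z : stiefel X -> tangent X v -> stiefel Z ->
  fnorm (polar_retraction X v - Z) <= fnorm (X + v - Z).
Proof.
move=> hX hv hZ; have [T [Ts hT _ <- hQ]] := polar_retractionP hX hv.
set Q := polar_retraction X v in hQ *; clearbody Q.
have -> : Q *m (1%:M + T) - Z = (Q - Z) + Q *m T.
  by rewrite mulmxDr mulmx1 addrAC.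
rewrite -(@ler_pXn2r _ 2) ?nnegrE // [leRHS]fnorm2D -addrA lerDl.
rewrite addr_ge0 ?sqr_ge0 // mulr_ge0 //.
rewrite dotC dot_mulmx dotC dot_sym //.
have -> : Q^T *m (Q - Z) + (Q^T *m (Q - Z))^T = (Z - Q)^T *m (Z - Q).
  rewrite trmx_mul trmxK -[RHS]opprK -stiefel_dist_gram // -[Q - Z]opprB.
  by rewrite [(- _)^T]linearN /= mulmxN mulNmx opprD.
rewrite dot_mulmx trmxK.
by rewrite mulr_ge0 ?invr_ge0 // -dot_tr trmx_mul Ts dot_psd.
Qed.

(** The residual is [- Q *m T], of norm [fnorm T]. Since [v^T *m v = 2 *: T + T *m T] and [T] has
    nonnegative inner product with its square, [2 * fnorm T] is at most the norm of [v^T *m v]. *)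
Lemma polar_second_order X v : stiefel X -> tangent X v ->
  fnorm (polar_retraction X v - (X + v)) <= 2^-1 * fnorm v ^+ 2.
Proof.
move=> hX hv; have [T [Ts hT TT <- hR]] := polar_retractionP hX hv.
rewrite mulmxDr mulmx1 opprD addNKr fnormN stiefel_fnorm //.
have hK : v^T *m v = 2 *: T + T *m T.
  apply: (addrI 1%:M); rewrite -TT !(mulmxDl, mulmxDr, mul1mx, mulmx1).
  move: (T *m T) => a; apply/matrixP => i j; rewrite !mxE; ring.
have h3 : 0 <= dot T (T *m T) by exact: dot_psd.
have h4 : fnorm (v^T *m v) <= fnorm v ^+ 2.
  by rewrite (le_trans (fnormM _ _)) // fnorm_tr expr2.
suff : 2 * fnorm T <= fnorm (v^T *m v) by lra.
rewrite -(@ler_pXn2r _ 2) ?nnegrE ?mulr_ge0 // hK fnorm2D.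
rewrite dotZl fnormZ ger0_norm //.
by have := sqr_ge0 (fnorm (T *m T)); lra.
Qed.

Lemma proj_tangent_tangent X Y : stiefel X -> tangent X (proj_tangent X Y).
Proof.
move=> hX; rewrite /tangent /= /proj_tangent; set S := X^T *m Y + Y^T *m X.
have Ss : S^T = S by rewrite linearD /= !trmx_mul !trmxK addrC.
rewrite [(Y - _)^T]linearB /= [(_ *: _)^T]linearZ /= trmx_mul Ss mulmxBr mulmxBl.
rewrite -scalemxAr -scalemxAl mulmxA hX mul1mx -mulmxA hX mulmx1.
rewrite /S; move: (X^T *m Y) (Y^T *m X) => a b.
by apply/matrixP => i j; rewrite !mxE; lra.
Qed.

Lemma proj_tangentD X Y Z :
  proj_tangent X (Y + Z) = proj_tangent X Y + proj_tangent X Z.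
Proof.
rewrite /proj_tangent [(Y + Z)^T]linearD /= !(mulmxDr, mulmxDl).
move: (X *m (X^T *m Y)) (X *m (Y^T *m X)) (X *m (X^T *m Z)) (X *m (Z^T *m X)) => a b c d.
by apply/matrixP => i j; rewrite !mxE; ring.
Qed.

Lemma proj_tangentZ X c Y : proj_tangent X (c *: Y) = c *: proj_tangent X Y.
Proof.
rewrite /proj_tangent [(c *: Y)^T]linearZ /= -scalemxAr -scalemxAl -scalerDr -scalemxAr.
by rewrite scalerBr !scalerA mulrC.
Qed.

Lemma proj_tangentB X Y Z :
  proj_tangent X (Y - Z) = proj_tangent X Y - proj_tangent X Z.
Proof. by rewrite -scaleN1r proj_tangentD proj_tangentZ scaleN1r. Qed.

Lemma proj_tangent0 X : proj_tangent X 0 = 0.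
Proof. by rewrite /proj_tangent trmx0 mulmx0 mul0mx addr0 mulmx0 scaler0 subr0. Qed.

Lemma proj_tangent_sum X I (s : seq I) (p : pred I) F :
  proj_tangent X (\sum_(i <- s | p i) F i) = \sum_(i <- s | p i) proj_tangent X (F i).
Proof.
by apply: (big_morph _ (proj_tangentD X)); rewrite proj_tangent0.
Qed.

Lemma dot_tangent_normal X v (S : 'M[R]_r) : tangent X v -> S^T = S ->
  dot v (X *m S) = 0.
Proof.
move=> hv hS; rewrite dotC dot_mulmx dotC dot_sym // trmx_mul trmxK.
by rewrite hv dot0l mulr0.
Qed.

Lemma gram_sym X Y : (X^T *m Y + Y^T *m X)^T = X^T *m Y + Y^T *m X.
Proof. by rewrite linearD /= !trmx_mul !trmxK addrC. Qed.

Lemma dot_tangent_proj X v Y : tangent X v -> dot v (proj_tangent X Y) = dot v Y.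
Proof.
move=> hv; rewrite /proj_tangent dotDr dotNr dotZr dot_tangent_normal ?gram_sym //.
by rewrite mulr0 subr0.
Qed.

Lemma fnorm_proj_tangent X Y : stiefel X -> fnorm (proj_tangent X Y) <= fnorm Y.
Proof.
move=> hX; have [->|h0] := eqVneq (fnorm (proj_tangent X Y)) 0; first exact: fnorm_ge0.
have h : 0 < fnorm (proj_tangent X Y) by rewrite lt_neqAle eq_sym h0 fnorm_ge0.
rewrite -(ler_pM2l h) -expr2 fnorm2 dot_tangent_proj; first exact: dot_le.
exact: proj_tangent_tangent.
Qed.

Lemma tangentD X v w : tangent X v -> tangent X w -> tangent X (v + w).
Proof.
rewrite /tangent /= => hv hw.
by rewrite [(v + w)^T]linearD /= mulmxDr mulmxDl addrACA hv hw addr0.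
Qed.

Lemma tangentZ X c v : tangent X v -> tangent X (c *: v).
Proof.
rewrite /tangent /= => hv.
by rewrite [(c *: v)^T]linearZ /= -scalemxAr -scalemxAl -scalerDr hv scaler0.
Qed.

Lemma tangentB X v w : tangent X v -> tangent X w -> tangent X (v - w).
Proof. by move=> hv hw; rewrite -scaleN1r; apply/tangentD/tangentZ. Qed.

End Stiefel.

(** * Mixing matrices *)

Section Network.
Variable R : realType.

Lemma char_poly_orthogonal N (P : 'M[R]_N) (d : 'rV_N) : P^T *m P = 1%:M ->
  char_poly (P *m diag_mx d *m P^T) = \prod_(i < N) ('X - (d ord0 i)%:P).
Proof.
move=> PP; pose c := map_mx (@polyC R).
have cPP : c _ _ P *m c _ _ P^T = 1%:M.
  by rewrite -map_mxM (mulmx1C PP) map_mx1.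
have -> : \prod_(i < N) ('X - (d ord0 i)%:P) = char_poly (diag_mx d).
  rewrite char_poly_trig ?diag_mx_is_trig //.
  by apply: eq_bigr => i _; rewrite mxE eqxx mulr1n.
rewrite /char_poly.
have -> : char_poly_mx (P *m diag_mx d *m P^T) =
    c _ _ P *m char_poly_mx (diag_mx d) *m c _ _ P^T.
  rewrite /char_poly_mx mulmxBr mulmxBl !map_mxM; congr (_ - _).
  by rewrite mul_mx_scalar -scalemxAl cPP scalemx1.
by rewrite !det_mulmx mulrAC -det_mulmx cPP det1 mul1r.
Qed.

(** Turns the definition by a characteristic polynomial into a statement on an eigenbasis of
    [A^T *m A]: [i0] and [i1] are the positions of the two largest singular values. *)
Lemma singular_valuesP N (A : 'M[R]_N) (s : seq R) : (1 < N)%N ->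
  singular_values A s ->
  exists (P : 'M[R]_N) (d : 'rV_N), [/\ P^T *m P = 1%:M,
    A^T *m A = P *m diag_mx d *m P^T, 0 <= s`_1 &
    exists i0 i1, [/\ i0 != i1, s`_1 ^+ 2 <= d ord0 i0, s`_1 ^+ 2 <= d ord0 i1 &
      forall i, i != i0 -> d ord0 i <= s`_1 ^+ 2]].
Proof.
move=> N1 [s_sort s_ge0 s_char].
have As : (A^T *m A)^T = A^T *m A by rewrite trmx_mul trmxK.
have [P [d [PP AE]]] := sym_spectral As; exists P, d.
rewrite AE char_poly_orthogonal // in s_char.
pose dt := [tuple d ord0 i | i < N].
(* Two products of monic linear factors agree only if their roots agree up to order. *)
have : perm_eq [seq x ^+ 2 | x <- s] dt.
  apply: prod_XsubC_eq; rewrite big_map -s_char big_tuple.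
  by apply: eq_bigr => i _; rewrite tnth_mktuple.
case/tuple_permP => p sE.
have s_size : size s = N by have := congr1 size sE; rewrite size_map size_tuple.
have dp (i : 'I_N) : d ord0 (p i) = s`_i ^+ 2.
  have := congr1 (fun t => nth 0 t i) sE.
  by rewrite (nth_map 0) ?s_size // -tnth_nth !tnth_mktuple.
have sn i : (i < N)%N -> 0 <= s`_i.
  by move=> iN; apply: (allP s_ge0); rewrite mem_nth // s_size.
have s_le i j : (i <= j < N)%N -> s`_j <= s`_i.
  move=> /andP[ij jN].
  have := sorted_leq_nth (rev_trans le_trans) (@lexx _ _) 0 s_sort.
  by apply; rewrite // inE s_size // (leq_ltn_trans ij).
have s_le2 i j : (i <= j < N)%N -> s`_j ^+ 2 <= s`_i ^+ 2.
  move=> ijN; rewrite ler_pXn2r ?nnegrE ?s_le //; case/andP: ijN => ij jN; apply: sn => //.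
  by rewrite (leq_ltn_trans ij).
split=> //; first exact: sn.
pose o0 : 'I_N := Ordinal (ltnW N1); pose o1 : 'I_N := Ordinal N1.
exists (p o0), (p o1); split; rewrite ?dp ?s_le2 //=.
  by rewrite (inj_eq perm_inj).
move=> i; rewrite -(permKV p i) (inj_eq perm_inj) dp => i0; apply: s_le2.
by rewrite ltn_ord andbT lt0n.
Qed.

Section Mixing.
Variables (N : nat) (e : rel 'I_N) (W : 'M[R]_N).
Hypothesis N1 : (1 < N)%N.
Hypothesis he : connected_graph e.
Hypothesis hW : mixing_matrix e W.

Let Wge0 i j : 0 <= W i j.
Proof.
case: hW => Wpos W0 _ _; case: (boolP (e i j || (i == j))) => h.
  by rewrite ltW ?Wpos.
by rewrite W0.
Qed.

Let Wrow i : \sum_j W i j = 1.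
Proof.
case: hW => _ _ _ /colP /(_ i); rewrite !mxE => <-.
by apply: eq_bigr => j _; rewrite mxE mulr1.
Qed.

Let Wsym i j : W i j = W j i.
Proof. by case: hW => _ _ {2}<- _; rewrite mxE. Qed.

(** The inner sum is the variance of [u] under the probability vector given by row [i] of [W].
    Summed over [i], the second moments give [fnorm u ^+ 2] because the columns sum to 1 too. *)
Lemma mixing_variance (u : 'cV[R]_N) :
  \sum_i \sum_j W i j * (u j ord0 - (W *m u) i ord0) ^+ 2 =
  fnorm u ^+ 2 - fnorm (W *m u) ^+ 2.
Proof.
rewrite !fnorm2 !dotE.
have -> : \sum_i \sum_(j < 1) u i j * u i j = \sum_i \sum_j W i j * u j ord0 ^+ 2.
  rewrite [RHS]exchange_big /=; apply: eq_bigr => i _.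
  rewrite big_ord1 -mulr_suml -expr2.
  by under eq_bigr do rewrite Wsym; rewrite Wrow mul1r.
rewrite -sumrB; apply: eq_bigr => i _; rewrite big_ord1.
set m := (W *m u) i ord0.
have mE : m = \sum_j W i j * u j ord0 by rewrite /m mxE.
transitivity (\sum_j W i j * u j ord0 ^+ 2 - \sum_j W i j * u j ord0 * (2 * m)
  + \sum_j W i j * m ^+ 2).
  by rewrite -sumrB -big_split /=; apply: eq_bigr => j _; ring.
by rewrite -!mulr_suml -mE Wrow; ring.
Qed.

Lemma mixing_contract (u : 'cV[R]_N) : fnorm (W *m u) <= fnorm u.
Proof.
rewrite -(@ler_pXn2r _ 2) ?nnegrE // -subr_ge0 -mixing_variance.
by do 2 (apply: sumr_ge0 => ? _); rewrite mulr_ge0 // sqr_ge0.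
Qed.

(** If [W] does not shorten [u], all the row variances vanish, so [u] is constant along edges, hence
    constant by connectedness, hence zero. *)
Lemma mixing_strict (u : 'cV[R]_N) : \sum_i u i ord0 = 0 ->
  fnorm u <= fnorm (W *m u) -> u = 0.
Proof.
move=> u0 hu.
have hz : fnorm u ^+ 2 - fnorm (W *m u) ^+ 2 = 0.
  apply/eqP; rewrite eq_le !subr_le0 subr_ge0.
  by rewrite !ler_pXn2r ?nnegrE // hu mixing_contract.
have hij i j : W i j * (u j ord0 - (W *m u) i ord0) ^+ 2 = 0.
  have := mixing_variance u; rewrite hz.
  move/eqP; rewrite psumr_eq0; last first.
    by move=> k _; apply: sumr_ge0 => l _; rewrite mulr_ge0 // sqr_ge0.
  move=> /allP /(_ i); rewrite mem_index_enum => /(_ isT) /=.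
  rewrite psumr_eq0; last by move=> l _; rewrite mulr_ge0 // sqr_ge0.
  by move=> /allP /(_ j); rewrite mem_index_enum => /(_ isT) /eqP.
have hpos i j : e i j || (i == j) -> u j ord0 = (W *m u) i ord0.
  case: hW => Wpos _ _ _ /Wpos Wij; have := hij i j => /eqP.
  by rewrite mulf_eq0 gt_eqF //= sqrf_eq0 subr_eq0 => /eqP.
(* Both ends of the edge carry the value [(W *m u) i ord0]; for [i] itself this uses the positive
   diagonal of [W]. *)
have hedge i j : e i j -> u i ord0 = u j ord0.
  by move=> eij; rewrite (hpos i i) ?eqxx ?orbT // (hpos i j) ?eij.
have hconst i j : u i ord0 = u j ord0.
  case: he => _ /(_ i j) /connectP [p + ->].
  by elim: p i => //= k p IH i /andP[/hedge -> /IH].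
apply/colP => i; rewrite mxE.
move: u0; under eq_bigr do rewrite (hconst _ i).
rewrite sumr_const card_ord => /eqP; rewrite mulrn_eq0 => /orP[|/eqP //].
by rewrite -leqn0 leqNgt (ltnW N1).
Qed.

Variables (s : seq R).
Hypothesis hs : singular_values W s.

Let quad_spec (P : 'M[R]_N) (d : 'rV_N) (u : 'cV[R]_N) :
  W^T *m W = P *m diag_mx d *m P^T ->
  fnorm (W *m u) ^+ 2 = \sum_i d ord0 i * (P^T *m u) i ord0 ^+ 2.
Proof.
move=> WE; rewrite fnorm2 dot_mulmx mulmxA WE -!mulmxA dotC dot_mulmx dotC dotE.
by apply: eq_bigr => i _; rewrite big_ord1 mul_diag_mx !mxE; ring.
Qed.

Let orth_norm (P : 'M[R]_N) (u : 'cV[R]_N) : P^T *m P = 1%:M ->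
  fnorm u ^+ 2 = \sum_i (P^T *m u) i ord0 ^+ 2.
Proof.
move=> PP; have -> : fnorm u ^+ 2 = fnorm (P^T *m u) ^+ 2.
  by rewrite !fnorm2 dot_mulmx trmxK mulmxA (mulmx1C PP) mul1mx.
by rewrite fnorm2 dotE; apply: eq_bigr => i _; rewrite big_ord1 expr2.
Qed.

(** Were the second singular value at least 1, two eigendirections would not be shortened by [W].
    Some nonzero combination of them has zero sum, contradicting [mixing_strict]. *)
Lemma second_singular_lt1 : 0 <= s`_1 < 1.
Proof.
have [P [d [PP WE s0 [i0 [i1 [i01 d0 d1 _]]]]]] := singular_valuesP N1 hs.
rewrite s0 /= ltNge; apply/negP => s1.
have s12 : 1 <= s`_1 ^+ 2 by rewrite expr_ge1.
pose S (i : 'I_N) := \sum_k P k i.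
(* The coefficients [S i1] and [- S i0] cancel the coordinate sum; when both sums vanish, the first
   eigenvector alone will do. *)
pose c0 := if (S i0 == 0) && (S i1 == 0) then 1 else S i1.
pose c1 := if (S i0 == 0) && (S i1 == 0) then 0 else - S i0.
pose c : 'cV[R]_N := c0 *: delta_mx i0 ord0 + c1 *: delta_mx i1 ord0.
have ci k : c k ord0 = c0 * (k == i0)%:R + c1 * (k == i1)%:R.
  by rewrite !mxE eqxx !andbT.
have i10 : (i1 == i0) = false by rewrite eq_sym (negPf i01).
have hu : \sum_k (P *m c) k ord0 = 0.
  have -> : \sum_k (P *m c) k ord0 = c0 * S i0 + c1 * S i1.
    under eq_bigr do rewrite mxE.
    rewrite exchange_big /=.
    under eq_bigr do rewrite -mulr_suml ci -/(S _).
    rewrite (bigD1 i0) //= (bigD1 i1) /= ?i10 // big1; last first.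
      by move=> k /andP[/negPf -> /negPf ->]; rewrite !mulr0 addr0 mulr0.
    by rewrite !eqxx (negPf i01) ?i10 !mulr0 !mulr1; ring.
  rewrite /c0 /c1; case: ifP => [/andP[/eqP -> _]|_]; ring.
have PPc : P^T *m (P *m c) = c by rewrite mulmxA PP mul1mx.
have : P *m c = 0.
  apply: mixing_strict => //; rewrite -(@ler_pXn2r _ 2) ?nnegrE //.
  rewrite (quad_spec _ WE) (orth_norm _ PP) PPc; apply: ler_sum => k _.
  rewrite ci; case: eqVneq => [->|k0].
    by rewrite ler_peMl ?sqr_ge0 // (le_trans s12).
  case: eqVneq => [->|k1]; last by rewrite !mulr0 addr0 expr0n mulr0.
  by rewrite ler_peMl ?sqr_ge0 // (le_trans s12).
move=> Pc0; have c00 : c = 0 by rewrite -PPc Pc0 mulmx0.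
have := ci i0; have := ci i1; rewrite c00 !mxE !eqxx (negPf i01) i10.
rewrite !mulr0 !mulr1 addr0 add0r => h1 h0; move: h1 h0; rewrite /c0 /c1.
case: ifP => [_ _ /eqP|/negP h /eqP h1 h0]; first by rewrite eq_sym oner_eq0.
by apply: h; rewrite -h0 eqxx andbT; move: h1; rewrite eq_sym oppr_eq0.
Qed.

(** The all-ones vector is fixed by [W^T *m W], and every eigenvalue other than the one at [i0] is
    below 1, so this vector spans the direction [i0]. A vector of zero sum has no coordinate
    there. *)
Lemma mixing_second (u : 'cV[R]_N) : \sum_i u i ord0 = 0 ->
  fnorm (W *m u) <= s`_1 * fnorm u.
Proof.
move=> u0; have /andP[s0 s1] := second_singular_lt1.
have [P [d [PP WE _ [i0 [i1 [_ _ _ dle]]]]]] := singular_valuesP N1 hs.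
have s12 : s`_1 ^+ 2 < 1 by rewrite expr_lt1.
pose o : 'cV[R]_N := const_mx 1.
have Wo : W^T *m W *m o = o.
  by case: hW => _ _ -> Wo; rewrite -mulmxA !Wo.
have PPt := mulmx1C PP.
have hd i : (d ord0 i - 1) * (P^T *m o) i ord0 = 0.
  have : P^T *m (W^T *m W *m o) = P^T *m o by rewrite Wo.
  rewrite WE !mulmxA PP mul1mx -mulmxA => /colP /(_ i).
  by rewrite mul_diag_mx mxE mulrBl mul1r => ->; rewrite subrr.
have ho i : i != i0 -> (P^T *m o) i ord0 = 0.
  move=> /dle di; have /eqP := hd i; rewrite mulf_eq0 => /orP[|/eqP //].
  by rewrite subr_eq0 => /eqP di1; move: (le_lt_trans di s12); rewrite di1 ltxx.
have ho0 : (P^T *m o) i0 ord0 != 0.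
  apply/eqP => h0.
  have : P^T *m o = 0.
    apply/colP => i; rewrite [RHS]mxE; have [->//|/ho //] := eqVneq i i0.
  move/(congr1 (mulmx P)); rewrite mulmxA PPt mul1mx mulmx0 => /colP /(_ i0).
  by rewrite !mxE => /eqP; rewrite oner_eq0.
have hu0 : (P^T *m u) i0 ord0 = 0.
  have : dot (P^T *m o) (P^T *m u) = 0.
    rewrite dot_mulmx trmxK mulmxA PPt mul1mx dotE -[RHS]u0.
    by apply: eq_bigr => i _; rewrite big_ord1 mxE mul1r.
  rewrite dotE; under eq_bigr do rewrite big_ord1.
  rewrite (bigD1 i0) //= big1.
    by rewrite addr0 => /eqP; rewrite mulf_eq0 (negPf ho0) => /eqP.
  by move=> i /ho ->; rewrite mul0r.
rewrite -(@ler_pXn2r _ 2) ?nnegrE ?mulr_ge0 // exprMn.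
rewrite (quad_spec _ WE) (orth_norm _ PP) mulr_sumr; apply: ler_sum => i _.
have [->|/dle di] := eqVneq i i0; first by rewrite hu0 expr0n !mulr0.
by rewrite ler_wpM2r ?sqr_ge0.
Qed.

Lemma mixing_pow_ge0 t i j : 0 <= (W ^+ t) i j.
Proof.
elim: t i j => [|t IH] i j; first by rewrite expr0 mxE ler0n.
by rewrite exprSr mxE; apply: sumr_ge0 => k _; rewrite mulr_ge0.
Qed.

End Mixing.
End Network.

(** * Averages and consensus *)

Section Averages.
Variables (R : realType) (N : nat).
Implicit Types (g h : 'I_N -> R).

Definition avg g : R := N%:R^-1 * \sum_i g i.

Lemma avg_ge0 g : (forall i, 0 <= g i) -> 0 <= avg g.
Proof. by move=> g0; rewrite mulr_ge0 ?invr_ge0 ?sumr_ge0. Qed.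

Lemma avg_le g h : (forall i, g i <= h i) -> avg g <= avg h.
Proof. by move=> gh; rewrite ler_wpM2l ?invr_ge0 // ler_sum. Qed.

Lemma avg_eq g h : (forall i, g i = h i) -> avg g = avg h.
Proof. by move=> gh; congr (_ * _); apply: eq_bigr. Qed.

Lemma avgD g h : avg (fun i => g i + h i) = avg g + avg h.
Proof. by rewrite /avg big_split mulrDr. Qed.

Lemma avgZ c g : avg (fun i => c * g i) = c * avg g.
Proof. by rewrite /avg -mulr_sumr mulrCA. Qed.

Lemma avg_const c : (0 < N)%N -> avg (fun=> c) = c.
Proof.
move=> N0; rewrite /avg sumr_const card_ord -[c *+ N]mulr_natl mulrA mulVf ?mul1r //.
by rewrite pnatr_eq0 -lt0n.
Qed.

Lemma avg_CS g h :
  avg (fun i => g i * h i) <= Num.sqrt (avg (fun i => g i ^+ 2)) *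
                              Num.sqrt (avg (fun i => h i ^+ 2)).
Proof.
have fE (k : 'I_N -> R) : Num.sqrt (avg (fun i => k i ^+ 2)) =
    Num.sqrt N%:R^-1 * fnorm (\row_i k i).
  rewrite sqrtrM ?invr_ge0 //; congr (_ * Num.sqrt _).
  by rewrite dotE big_ord1; apply: eq_bigr => i _; rewrite mxE expr2.
rewrite !fE mulrACA -expr2 sqr_sqrtr ?invr_ge0 // ler_wpM2l ?invr_ge0 //.
apply: le_trans (dot_le _ _); rewrite dotE big_ord1.
by apply: ler_sum => i _; rewrite !mxE.
Qed.

Lemma avg_sqr g : (0 < N)%N -> avg g ^+ 2 <= avg (fun i => g i ^+ 2).
Proof.
move=> N0; have : 0 <= avg (fun i => (g i - avg g) ^+ 2).
  by apply: avg_ge0 => i; exact: sqr_ge0.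
have -> : avg (fun i => (g i - avg g) ^+ 2) =
    avg (fun i => g i ^+ 2 + ((- 2 * avg g) * g i + avg g ^+ 2)).
  by apply: avg_eq => i; ring.
by rewrite avgD avgD avgZ avg_const //; lra.
Qed.

Lemma le_avg_sum g i : (forall i, 0 <= g i) -> g i <= N%:R * avg g.
Proof.
move=> g0; have N0 : N%:R != 0 :> R by rewrite pnatr_eq0 -lt0n (leq_ltn_trans _ (ltn_ord i)).
rewrite /avg mulrA divff // mul1r (bigD1 i) //= lerDl.
by apply: sumr_ge0 => j _.
Qed.

Variables (n r : nat).
Implicit Types (x y : 'I_N -> 'M[R]_(n, r)).

Lemma fnorm_mean x : fnorm (stack_mean x) <= avg (fun i => fnorm (x i)).
Proof. by rewrite fnormZ ger0_norm ?invr_ge0 // ler_wpM2l ?invr_ge0 // fnorm_sum. Qed.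

Lemma fnorm_mean_le x c : (0 < N)%N -> (forall i, fnorm (x i) <= c) ->
  fnorm (stack_mean x) <= c.
Proof.
by move=> N0 xc; rewrite (le_trans (fnorm_mean _)) // -[leRHS]avg_const // avg_le.
Qed.

Lemma fnorm2_mean x : (0 < N)%N ->
  fnorm (stack_mean x) ^+ 2 <= avg (fun i => fnorm (x i) ^+ 2).
Proof.
move=> N0; apply: le_trans (avg_sqr _ N0).
by rewrite ler_pXn2r ?nnegrE ?avg_ge0 ?fnorm_mean // => i; exact: fnorm_ge0.
Qed.

Lemma dot_mean x Y : dot Y (stack_mean x) = avg (fun i => dot Y (x i)).
Proof. by rewrite dotZr dot_sumr. Qed.

Lemma stack_meanD x y : stack_mean (fun i => x i + y i) = stack_mean x + stack_mean y.
Proof. by rewrite /stack_mean big_split scalerDr. Qed.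

Lemma stack_meanZ c x : stack_mean (fun i => c *: x i) = c *: stack_mean x.
Proof. by rewrite /stack_mean -scaler_sumr !scalerA mulrC. Qed.

Lemma stack_meanB x y : stack_mean (fun i => x i - y i) = stack_mean x - stack_mean y.
Proof. by rewrite /stack_mean sumrB scalerBr. Qed.

Lemma stack_mean_const Y : (0 < N)%N -> stack_mean (fun _ : 'I_N => Y : 'M[R]_(n, r)) = Y.
Proof.
move=> N0; rewrite /stack_mean sumr_const card_ord -[Y *+ N]scaler_nat scalerA mulVf ?scale1r //.
by rewrite pnatr_eq0 -lt0n.
Qed.

Lemma stack_mean_eq x y : (forall i, x i = y i) -> stack_mean x = stack_mean y.
Proof. by move=> xy; congr (_ *: _); apply: eq_bigr. Qed.

Lemma avg_dev x : (0 < N)%N -> avg (fun i => fnorm (x i) ^+ 2) =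
  fnorm (stack_mean x) ^+ 2 + avg (fun i => fnorm (x i - stack_mean x) ^+ 2).
Proof.
move=> N0.
rewrite (@avg_eq (fun i => fnorm (x i - stack_mean x) ^+ 2)
  (fun i => fnorm (x i) ^+ 2 + (- 2 * dot (stack_mean x) (x i) + fnorm (stack_mean x) ^+ 2))).
  rewrite avgD avgD avgZ -dot_mean avg_const // -fnorm2; ring.
by move=> i; rewrite fnorm2B dotC; ring.
Qed.

Lemma stack_mean_dev x : (0 < N)%N -> stack_mean (fun i => x i - stack_mean x) = 0.
Proof. by move=> N0; rewrite stack_meanB stack_mean_const // subrr. Qed.

Lemma stack_mean_eq0 x : (0 < N)%N -> stack_mean x = 0 -> \sum_i x i = 0.
Proof.
move=> N0 /eqP; rewrite scaler_eq0 invr_eq0 pnatr_eq0 => /orP[|/eqP //].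
by rewrite -leqn0 leqNgt N0.
Qed.

End Averages.

Section Consensus.
Variables (R : realType) (N : nat).

(* [V] stands for [W ^+ t] and [s] for [sigma_2 ^+ t]. *)
Definition consensus_matrix (V : 'M[R]_N) (s : R) : Prop :=
  [/\ forall i j, 0 <= V i j, forall i, \sum_j V i j = 1, V^T = V, 0 <= s <= 1 &
      forall u : 'cV[R]_N, \sum_i u i ord0 = 0 -> fnorm (V *m u) <= s * fnorm u].

Lemma mixing_pow (e : rel 'I_N) (W : 'M[R]_N) (sv : seq R) t : (1 < N)%N ->
  connected_graph e -> mixing_matrix e W -> singular_values W sv ->
  consensus_matrix (W ^+ t) (sv`_1 ^+ t).
Proof.
move=> N1 he hW hs; have /andP[s0 s1] := second_singular_lt1 N1 he hW hs.
have [_ _ Ws W1] := hW.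
split.
- by move=> i j; exact: mixing_pow_ge0 hW _ _ _.
- elim: t => [|t IH] i.
    rewrite (bigD1 i) //= expr0 mxE eqxx big1 ?addr0 // => j ji.
    by rewrite mxE eq_sym (negPf ji).
  rewrite exprSr; under eq_bigr do rewrite mxE.
  rewrite exchange_big /= -(IH i); apply: eq_bigr => k _.
  rewrite -mulr_sumr; have /colP /(_ k) := W1; rewrite !mxE => h.
  rewrite (_ : \sum_i _ = 1) ?mulr1 // -h.
  by apply: eq_bigr => j _; rewrite mxE mulr1.
- elim: t => [|t IH]; first by rewrite expr0 trmx1.
  by rewrite [in LHS]exprS trmx_mul IH Ws exprSr.
- by rewrite exprn_ge0 // exprn_ile1 // ltW.
- move=> u u0; elim: t => [|t IH]; first by rewrite !expr0 mul1mx mul1r.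
  rewrite !exprS -mulmxA -mulrA.
  apply: le_trans (ler_wpM2l s0 IH); apply: (mixing_second N1 he hW hs).
  (* Powers of [W] keep the sum zero, because [W] is symmetric and fixes the all-ones vector. *)
  clear IH; elim: t => [|t IH]; first by rewrite expr0 mul1mx.
  rewrite exprS -mulmxA; move: IH; set w := W ^+ t *m u => IH; rewrite -[RHS]IH.
  transitivity (dot (const_mx 1 : 'cV_N) (W *m w)).
    by rewrite dotE; apply: eq_bigr => i _; rewrite big_ord1 [X in X * _]mxE mul1r.
  rewrite dotC dot_mulmx Ws W1 dotE.
  by apply: eq_bigr => i _; rewrite big_ord1 [X in _ * X]mxE mulr1.
Qed.

(** An eigenvector for an eigenvalue other than 1 has zero sum by double stochasticity, so the
    contraction bounds that eigenvalue by [s] in absolute value. It serves to bound [Lt] by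
    [1 + s]. *)
Lemma consensus_eigenvalue V s a : consensus_matrix V s ->
  eigenvalue V a -> a = 1 \/ - s <= a.
Proof.
move=> [_ V1 Vs /andP[s0 s1] hV] /eigenvalueP [v vV v0].
have [|a1] := eqVneq a 1; [by left|right].
have Vv : V *m v^T = a *: v^T by rewrite -[in LHS]Vs -trmx_mul vV linearZ.
have sum0 : \sum_i v^T i ord0 = 0.
  have : (a - 1) * \sum_i v^T i ord0 = 0.
    rewrite mulrBl mul1r mulr_sumr; apply/eqP; rewrite subr_eq0; apply/eqP.
    have aE i : a * v^T i ord0 = \sum_j V i j * v^T j ord0.
      by have /colP /(_ i) := Vv; rewrite !mxE => <-.
    under eq_bigr do rewrite aE.
    rewrite exchange_big /=; apply: eq_bigr => j _; rewrite -mulr_suml.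
    rewrite (_ : \sum_i V i j = 1) ?mul1r // -(V1 j).
    by apply: eq_bigr => i _; rewrite -[in LHS]Vs mxE.
  by move/eqP; rewrite mulf_eq0 subr_eq0 (negPf a1) => /eqP.
have := hV _ sum0; rewrite Vv fnormZ fnorm_tr ler_pM2r; last first.
  by rewrite lt_neqAle fnorm_ge0 andbT eq_sym; apply: contra_neq v0 => /fnorm_eq0.
by rewrite ler_norml => /andP[].
Qed.

Variables (V : 'M[R]_N) (s : R) (n r : nat).
Hypothesis N0 : (0 < N)%N.
Hypothesis hV : consensus_matrix V s.
Implicit Types (x y e X : 'I_N -> 'M[R]_(n, r)).

Definition mix x i : 'M[R]_(n, r) := \sum_j V i j *: x j.

Let V0 i j : 0 <= V i j. Proof. by case: hV. Qed.
Let V1 i : \sum_j V i j = 1. Proof. by case: hV. Qed.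
Let Vsym i j : V i j = V j i. Proof. by case: hV => _ _ {2}<-; rewrite mxE. Qed.
Let s0 : 0 <= s. Proof. by case: hV => _ _ _ /andP[]. Qed.
Let s1 : s <= 1. Proof. by case: hV => _ _ _ /andP[]. Qed.

Lemma mix_const (Y : 'M[R]_(n, r)) i : mix (fun=> Y) i = Y.
Proof. by rewrite /mix -scaler_suml V1 scale1r. Qed.

Lemma mixB x y i : mix (fun j => x j - y j) i = mix x i - mix y i.
Proof. by rewrite /mix -sumrB; apply: eq_bigr => j _; rewrite scalerBr. Qed.

Lemma mixBc x Y i : mix (fun j => x j - Y) i = mix x i - Y.
Proof. by rewrite mixB mix_const. Qed.

Lemma mean_mix x : stack_mean (mix x) = stack_mean x.
Proof.
rewrite /stack_mean /mix exchange_big /=; congr (_ *: _); apply: eq_bigr => j _.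
rewrite -scaler_suml (_ : \sum_i V i j = 1) ?scale1r // -(V1 j).
by apply: eq_bigr => i _.
Qed.

Lemma avg_mix (g : 'I_N -> R) : avg (fun i => \sum_j V i j * g j) = avg g.
Proof.
rewrite /avg exchange_big /=; congr (_ * _); apply: eq_bigr => j _.
rewrite -mulr_suml (_ : \sum_i V i j = 1) ?mul1r // -(V1 j).
by apply: eq_bigr => i _.
Qed.

Lemma mix_contract x : \sum_i x i = 0 ->
  avg (fun i => fnorm (mix x i) ^+ 2) <= s ^+ 2 * avg (fun i => fnorm (x i) ^+ 2).
Proof.
move=> x0; rewrite /avg mulrCA ler_wpM2l ?invr_ge0 //.
have sE y : \sum_i fnorm (y i) ^+ 2 =
    \sum_a \sum_b fnorm (\col_i y i a b) ^+ 2.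
  under eq_bigr do rewrite fnorm2 dotE.
  rewrite exchange_big /=; apply: eq_bigr => a _.
  rewrite exchange_big /=; apply: eq_bigr => b _.
  by rewrite fnorm2 dotE; apply: eq_bigr => i _; rewrite big_ord1 !mxE.
rewrite !sE mulr_sumr; apply: ler_sum => a _; rewrite mulr_sumr; apply: ler_sum => b _.
have -> : \col_i mix x i a b = V *m \col_i x i a b.
  apply/colP => i; rewrite !mxE summxE; apply: eq_bigr => j _.
  by rewrite !mxE.
case: hV => _ _ _ _ hVu.
rewrite -exprMn ler_pXn2r ?nnegrE ?mulr_ge0 // hVu //.
have /matrixP /(_ a b) := x0; rewrite summxE mxE => h; rewrite -[RHS]h.
by apply: eq_bigr => i _; rewrite mxE.
Qed.

Lemma mix_dev x :
  avg (fun i => fnorm (mix x i - stack_mean x) ^+ 2) <=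
  s ^+ 2 * avg (fun i => fnorm (x i - stack_mean x) ^+ 2).
Proof.
rewrite (@avg_eq _ _ _ (fun i => fnorm (mix (fun j => x j - stack_mean x) i) ^+ 2)).
  by apply: mix_contract; apply: stack_mean_eq0 => //; exact: stack_mean_dev.
by move=> i; rewrite mixBc.
Qed.

Lemma avg_dot_mix x : \sum_i x i = 0 ->
  `|avg (fun i => dot (x i) (mix x i))| <= s * avg (fun i => fnorm (x i) ^+ 2).
Proof.
move=> x0; have h := mix_contract x0.
have a0 : 0 <= avg (fun i => fnorm (x i) ^+ 2) by apply: avg_ge0 => i; exact: sqr_ge0.
have : `|avg (fun i => dot (x i) (mix x i))| <=
    avg (fun i => fnorm (x i) * fnorm (mix x i)).
  rewrite /avg normrM ger0_norm ?invr_ge0 // ler_wpM2l ?invr_ge0 //.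
  by rewrite (le_trans (ler_norm_sum _ _ _)) // ler_sum // => i _; exact: dot_norm.
move/le_trans; apply; apply: le_trans (avg_CS _ _) _.
apply: le_trans (ler_wpM2l (sqrtr_ge0 _) (ler_wsqrtr h)) _.
move: (avg _) a0 => p p0.
by rewrite sqrtrM ?sqr_ge0 // sqrtr_sqr ger0_norm // mulrCA -expr2 sqr_sqrtr.
Qed.

(** Pairwise differences see only the deviations [x] from the mean. Expanding the squares gives
    twice the average of [fnorm (x i) ^+ 2] minus twice the correlation of [x] with its mixture,
    which is at least [- s] times that average. *)
Lemma avg_mix_dist e :
  avg (fun i => \sum_j V i j * fnorm (e i - e j) ^+ 2) <=
  2 * (1 + s) * avg (fun i => fnorm (e i) ^+ 2).
Proof.
pose x i := e i - stack_mean e.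
have xs : \sum_i x i = 0 by apply: stack_mean_eq0 => //; exact: stack_mean_dev.
have -> : avg (fun i => \sum_j V i j * fnorm (e i - e j) ^+ 2) =
    avg (fun i => fnorm (x i) ^+ 2 +
      (\sum_j V i j * fnorm (x j) ^+ 2 + - 2 * dot (x i) (mix x i))).
  apply: avg_eq => i.
  rewrite -[fnorm (x i) ^+ 2]mul1r -{1}(V1 i) mulr_suml.
  rewrite /mix dot_sumr mulr_sumr -!big_split /=; apply: eq_bigr => j _.
  have -> : e i - e j = x i - x j by rewrite /x opprB addrA subrK.
  by rewrite fnorm2B dotZr; ring.
rewrite avgD avgD avgZ avg_mix.
have := avg_dot_mix xs; rewrite ler_norml => /andP[h _].
have := avg_dev e N0; rewrite -/x => ->.
have : 0 <= fnorm (stack_mean e) ^+ 2 by exact: sqr_ge0.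
move: h; set d := avg _; set p := avg _; set q := _ ^+ 2.
by move=> h q0; have := mulr_ge0 s0 q0; lra.
Qed.

(** Relaxed averaging keeps the mean and shrinks the deviations by [1 - al + al * s]. The mean is
    kept as a separate term because it is itself of second order for an induced mean. *)
Lemma avg_relax e al : 0 <= al <= 1 ->
  avg (fun i => fnorm (e i + al *: (mix e i - e i)) ^+ 2) <=
  fnorm (stack_mean e) ^+ 2 +
  (1 - al + al * s) ^+ 2 * avg (fun i => fnorm (e i) ^+ 2).
Proof.
move=> /andP[al0 al1].
pose x i := e i - stack_mean e; pose y i := e i + al *: (mix e i - e i).
have xs : \sum_i x i = 0 by apply: stack_mean_eq0 => //; exact: stack_mean_dev.
have ym : stack_mean y = stack_mean e.
  by rewrite /y stack_meanD stack_meanZ stack_meanB mean_mix subrr scaler0 addr0.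
have := avg_dev y N0; rewrite ym => ->; rewrite lerD2l.
have -> : avg (fun i => fnorm (y i - stack_mean e) ^+ 2) =
  avg (fun i => (1 - al) ^+ 2 * fnorm (x i) ^+ 2 +
    (2 * al * (1 - al) * dot (x i) (mix x i) + al ^+ 2 * fnorm (mix x i) ^+ 2)).
  apply: avg_eq => i.
  have -> : y i - stack_mean e = (1 - al) *: x i + al *: mix x i.
    rewrite /x mixBc /y; apply/matrixP => a b; rewrite !mxE; ring.
  by rewrite fnorm2D !fnormZ dotZl dotZr !exprMn !real_normK ?num_real //; ring.
rewrite avgD avgD !avgZ.
have := avg_dot_mix xs; rewrite ler_norml => /andP[_ h].
have h2 := mix_contract xs.
have hd := avg_dev e N0; rewrite -/x in hd.
have hq := sqr_ge0 (fnorm (stack_mean e)).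
have p0 : 0 <= avg (fun i => fnorm (x i) ^+ 2) by apply: avg_ge0 => i; exact: sqr_ge0.
move: h h2 hd p0; set d := avg (fun i => dot _ _); set p := avg (fun i => fnorm (x i) ^+ 2).
set m := avg (fun i => fnorm (mix x i) ^+ 2) => h h2 hd p0.
have t1 : 2 * al * (1 - al) * d <= 2 * al * (1 - al) * (s * p).
  by rewrite ler_wpM2l // !mulr_ge0 // subr_ge0.
have t2 : al ^+ 2 * m <= al ^+ 2 * (s ^+ 2 * p) by rewrite ler_wpM2l ?sqr_ge0.
apply: le_trans (_ : (1 - al + al * s) ^+ 2 * p <= _).
  have -> : (1 - al + al * s) ^+ 2 * p = (1 - al) ^+ 2 * p +
    (2 * al * (1 - al) * (s * p) + al ^+ 2 * (s ^+ 2 * p)) by ring.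
  by rewrite lerD2l lerD.
by rewrite ler_wpM2l ?sqr_ge0 // hd lerDr.
Qed.

End Consensus.

(** * The induced arithmetic mean *)

Section State.
Variables (R : realType) (N n r : nat).
Hypothesis N0 : (0 < N)%N.
Variables (X : 'I_N -> 'M[R]_(n, r)) (Xh : 'M[R]_(n, r)).
Hypothesis hX : stiefelN X.

Lemma stiefel_fnorm2 (Z : 'M[R]_(n, r)) : stiefel Z -> fnorm Z ^+ 2 = r%:R.
Proof. by move=> hZ; rewrite fnorm2 /dot hZ mxtrace1. Qed.

Lemma proj_tangent_self (Z : 'M[R]_(n, r)) : stiefel Z -> proj_tangent Z Z = 0.
Proof.
move=> hZ; rewrite /proj_tangent hZ mulmxDr mulmx1.
by apply/matrixP => i j; rewrite !mxE; lra.
Qed.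

Lemma gram_mean (Z : 'M[R]_(n, r)) (x : 'I_N -> 'M[R]_(n, r)) :
  Z^T *m stack_mean x + (stack_mean x)^T *m Z =
  stack_mean (fun i => Z^T *m x i + (x i)^T *m Z).
Proof.
rewrite /stack_mean [(_ *: _)^T]linearZ /= [(\sum_i _)^T]linear_sum /=.
by rewrite -scalemxAr -scalemxAl mulmx_sumr mulmx_suml -scalerDr big_split.
Qed.

Hypothesis hI : is_iam X Xh.
Let hXh : stiefel Xh. Proof. by case: hI. Qed.
Let e i := X i - Xh.
Let a := avg (fun i => fnorm (e i) ^+ 2).

(** All points of the manifold have the same norm, so minimizing the sum of squared distances is
    maximizing the inner product with the Euclidean mean. *)
Lemma iam_dot Z : stiefel Z -> dot Z (stack_mean X) <= dot Xh (stack_mean X).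
Proof.
move=> hZ; case: hI => _ /(_ _ hZ).
have sE Y : stiefel Y -> \sum_i fnorm (Y - X i) ^+ 2 =
    \sum_(i < N) (2 * r%:R) - 2 * (N%:R * dot Y (stack_mean X)).
  move=> hY; rewrite dot_mean /avg mulVKf ?pnatr_eq0 -?lt0n //.
  rewrite mulr_sumr -sumrB; apply: eq_bigr => i _.
  rewrite fnorm2B !stiefel_fnorm2 //; ring.
rewrite !sE //.
have N0' : 0 < N%:R :> R by rewrite ltr0n.
by move=> h; rewrite -(ler_pM2l N0'); lra.
Qed.

(* First-order optimality of the mean along the curves [s |-> R(s v)]. *)
Lemma iam_critical v : tangent Xh v -> dot v (stack_mean X) = 0.
Proof.
move=> hv; set m := stack_mean X; set c := dot v m.
pose C := 2^-1 * fnorm v ^+ 2 * fnorm m.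
have C0 : 0 <= C by rewrite !mulr_ge0 // ?sqr_ge0.
have hs s : s * c <= s ^+ 2 * C.
  have hsv := tangentZ s hv.
  have := iam_dot (polar_stiefel hXh hsv); rewrite -/m => h1.
  have h2 := polar_second_order hXh hsv.
  set Z := polar_retraction _ _ in h1 h2.
  have h3 := dot_norm (Z - (Xh + s *: v)) m.
  have h4 := ler_wpM2r (fnorm_ge0 m) h2.
  rewrite fnormZ exprMn real_normK ?num_real // in h4.
  have : dot (Z - (Xh + s *: v)) m = dot Z m - (dot Xh m + s * c).
    by rewrite dotDl dotNl dotDl dotZl.
  move: h3; rewrite ler_norml => /andP[h3 _] hE.
  have : s ^+ 2 * C = 2^-1 * (s ^+ 2 * fnorm v ^+ 2) * fnorm m by rewrite /C; ring.
  by lra.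
(* A linear function dominated by a quadratic one has zero slope; this value of [s] shows it without
   a limit. *)
have := hs (c / (C + 1)).
have C1 : 0 < C + 1 by rewrite ltr_wpDl.
rewrite -(ler_pM2r (exprn_gt0 2 C1)).
have -> : c / (C + 1) * c * (C + 1) ^+ 2 = c ^+ 2 * C + c ^+ 2.
  by field; rewrite gt_eqF.
have -> : (c / (C + 1)) ^+ 2 * C * (C + 1) ^+ 2 = c ^+ 2 * C.
  by field; rewrite gt_eqF.
move=> h; apply/eqP; rewrite -sqrf_eq0 eq_le sqr_ge0 andbT.
by rewrite -(lerD2l (c ^+ 2 * C)) addr0.
Qed.

Lemma iam_gram i : Xh^T *m e i + (e i)^T *m Xh = - ((e i)^T *m e i).
Proof. exact: stiefel_dist_gram. Qed.

(** Criticality makes the mean of the errors normal at [Xh], hence equal to half of [Xh] times the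
    mean of the symmetric parts, each of which is minus the Gram matrix of [e i]. The Euclidean and
    the induced mean thus differ only at second order. *)
Lemma iam_mean : fnorm (stack_mean X - Xh) <= 2^-1 * a.
Proof.
have em : stack_mean X - Xh = stack_mean e.
  by rewrite /e stack_meanB stack_mean_const.
have P0 : proj_tangent Xh (stack_mean e) = 0.
  rewrite -em proj_tangentB proj_tangent_self // subr0; apply: fnorm_eq0.
  apply/eqP; rewrite -sqrf_eq0 fnorm2 dot_tangent_proj ?iam_critical //;
    exact: proj_tangent_tangent.
move/eqP: P0; rewrite /proj_tangent subr_eq0 => /eqP eE.
rewrite em eE fnormZ stiefel_fnorm // ger0_norm ?invr_ge0 // ler_wpM2l ?invr_ge0 //.
rewrite gram_mean (le_trans (fnorm_mean _)) //; apply: avg_le => i.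
by rewrite iam_gram fnormN (le_trans (fnormM _ _)) // fnorm_tr expr2.
Qed.

Variables (V : 'M[R]_N) (s : R).
Hypothesis hV : consensus_matrix V s.
Let V0 i j : 0 <= V i j. Proof. by case: hV. Qed.
Let V1 i : \sum_j V i j = 1. Proof. by case: hV. Qed.
Let s0 : 0 <= s. Proof. by case: hV => _ _ _ /andP[]. Qed.
Let s1 : s <= 1. Proof. by case: hV => _ _ _ /andP[]. Qed.

Let z i := mix V e i - e i.
Definition cons_dir i := proj_tangent (X i) (mix V X i).
Let D i := \sum_j V i j * fnorm (e i - e j) ^+ 2.

Lemma cons_dirE i : cons_dir i = proj_tangent (X i) (z i).
Proof.
rewrite /cons_dir; have -> : mix V X i = z i + X i.
  rewrite /z (mixBc hV); apply/matrixP => a' b'; rewrite !mxE; ring.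
by rewrite proj_tangentD proj_tangent_self // addr0.
Qed.

Lemma cons_dir_tangent i : tangent (X i) (cons_dir i).
Proof. exact: proj_tangent_tangent. Qed.

Lemma cons_dir_le i : fnorm (cons_dir i) <= fnorm (z i).
Proof. by rewrite cons_dirE fnorm_proj_tangent. Qed.

Let g i := \sum_j V i j *: ((e j - e i)^T *m (e j - e i)).

Lemma cons_gram i : (X i)^T *m z i + (z i)^T *m X i = - g i.
Proof.
have zE : z i = \sum_j V i j *: (X j - X i).
  rewrite /z (mixBc hV) /mix; under [RHS]eq_bigr do rewrite scalerBr.
  by rewrite sumrB -scaler_suml V1 scale1r /e opprB addrA subrK.
rewrite zE /g [(\sum_j _)^T]linear_sum /= mulmx_sumr mulmx_suml -big_split -sumrN /=.
apply: eq_bigr => j _; rewrite [(_ *: _)^T]linearZ /= -scalemxAr -scalemxAl -scalerDr.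
rewrite stiefel_dist_gram // scalerN; congr (- (_ *: _)).
by have -> : e j - e i = X j - X i by rewrite /e opprB addrA subrK.
Qed.

Lemma cons_dir_normal i : cons_dir i - z i = 2^-1 *: (X i *m g i).
Proof.
by rewrite cons_dirE /proj_tangent cons_gram mulmxN scalerN opprK addrC addKr.
Qed.

Lemma cons_g_le i : fnorm (g i) <= D i.
Proof.
rewrite (le_trans (fnorm_sum _ _ _)) //; apply: ler_sum => j _.
rewrite fnormZ ger0_norm // ler_wpM2l // (le_trans (fnormM _ _)) //.
by rewrite fnorm_tr -expr2 fnormC.
Qed.

Lemma cons_dir_dist i : fnorm (cons_dir i - z i) <= 2^-1 * D i.
Proof.
rewrite cons_dir_normal fnormZ stiefel_fnorm // ger0_norm ?invr_ge0 //.
by rewrite ler_wpM2l ?invr_ge0 ?cons_g_le.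
Qed.

(** Projecting [z i] adds the normal vector [2^-1 *: (X i *m g i)]. Its pairing with [e i] involves
    only the symmetric part of [(X i)^T *m e i], half the Gram matrix of [e i], so the correction is
    of fourth order rather than third. *)
Lemma cons_dot i : dot (e i) (cons_dir i) <= dot (e i) (z i) + 4^-1 * (fnorm (e i) ^+ 2 * D i).
Proof.
have -> : dot (e i) (cons_dir i) = dot (e i) (z i) + dot (e i) (cons_dir i - z i).
  by rewrite -dotDr subrKC.
rewrite lerD2l cons_dir_normal dotZr.
have gs : (g i)^T = g i.
  rewrite /g linear_sum /=; apply: eq_bigr => j _.
  by rewrite linearZ /= trmx_mul trmxK.
have -> : dot (e i) (X i *m g i) = 2^-1 * dot ((e i)^T *m e i) (g i).
  rewrite dotC dot_mulmx dotC dot_sym // trmx_mul trmxK; congr (_ * dot _ _).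
  have -> : e i = - (Xh - X i) by rewrite opprB.
  rewrite mulmxN [(- _)^T]linearN /= mulNmx mulmxN mulNmx opprK -opprD.
  by rewrite stiefel_dist_gram // opprK.
rewrite mulrA.
have -> : 2^-1 * 2^-1 = 4^-1 :> R by field.
rewrite ler_wpM2l ?invr_ge0 // (le_trans (dot_le _ _)) // ler_pM ?cons_g_le //.
by rewrite (le_trans (fnormM _ _)) // fnorm_tr expr2.
Qed.

Lemma cons_step i al : 0 <= al ->
  fnorm (e i + al *: cons_dir i) ^+ 2 <=
  fnorm (e i + al *: z i) ^+ 2 + al / 2 * (fnorm (e i) ^+ 2 * D i).
Proof.
move=> al0; rewrite !(fnorm2D (e i)) !fnormZ ger0_norm // !dotZr !exprMn.
have h1 := ler_wpM2l al0 (cons_dot i).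
have h2 : al ^+ 2 * fnorm (cons_dir i) ^+ 2 <= al ^+ 2 * fnorm (z i) ^+ 2.
  by rewrite ler_wpM2l ?sqr_ge0 // ler_pXn2r ?nnegrE // cons_dir_le.
by lra.
Qed.

Lemma avg_D : avg D <= 2 * (1 + s) * a.
Proof. exact: avg_mix_dist. Qed.

(** The unprojected directions [z i] average to zero by double stochasticity; what is left is the
    mean of the normal corrections, which are quadratic. *)
Lemma mean_cons_dir : fnorm (stack_mean cons_dir) <= (1 + s) * a.
Proof.
have -> : stack_mean cons_dir = stack_mean (fun i => cons_dir i - z i).
  rewrite stack_meanB [X in _ - X](_ : _ = 0) ?subr0 //.
  by rewrite /z stack_meanB (mean_mix hV) subrr.
rewrite (le_trans (fnorm_mean _)) //.
apply: le_trans (_ : 2^-1 * avg D <= _); last by have := avg_D; lra.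
by rewrite -avgZ; apply: avg_le => i; exact: cons_dir_dist.
Qed.

Lemma avg_cons_dir : avg (fun i => fnorm (cons_dir i) ^+ 2) <= 4 * a.
Proof.
apply: le_trans (_ : avg (fun i => fnorm (z i) ^+ 2) <= _).
  by apply: avg_le => i; rewrite ler_pXn2r ?nnegrE // cons_dir_le.
pose x i := e i - stack_mean e.
have xs : \sum_i x i = 0 by apply: stack_mean_eq0 => //; exact: stack_mean_dev.
have h := mix_contract hV xs.
apply: le_trans (_ : avg (fun i => 2 * fnorm (mix V x i) ^+ 2 + 2 * fnorm (x i) ^+ 2) <= _).
  apply: avg_le => i; have -> : z i = mix V x i - x i.
    rewrite /z /x [in RHS](mixBc hV); move: (mix V e i) (e i) (stack_mean e) => p q w.
    by apply/matrixP => a' b'; rewrite !mxE; ring.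
  exact: fnorm2B_le.
rewrite avgD !avgZ.
have p0 : 0 <= avg (fun i => fnorm (x i) ^+ 2) by apply: avg_ge0 => i; exact: sqr_ge0.
have hd := avg_dev e N0; rewrite -/x -/a in hd.
have hq := sqr_ge0 (fnorm (stack_mean e)).
have s2 : s ^+ 2 <= 1 by rewrite expr_le1.
have h2 := ler_wpM2r p0 s2; lra.
Qed.

(** Passing from the average to a single agent costs a factor [N], which is why [t] has to make
    [s ^+ 2 * N%:R] small. *)
Lemma mix_dev_le (x : 'I_N -> 'M[R]_(n, r)) i :
  fnorm (mix V x i - stack_mean x) ^+ 2 <=
  s ^+ 2 * N%:R * avg (fun i => fnorm (x i - stack_mean x) ^+ 2).
Proof.
have h := mix_dev N0 hV x.
apply: le_trans (@le_avg_sum _ _ (fun i => fnorm (mix V x i - stack_mean x) ^+ 2) i _) _.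
  by move=> j; exact: sqr_ge0.
by rewrite -mulrA [leRHS]mulrCA ler_wpM2l.
Qed.

End State.

(** * Smoothness on the Stiefel manifold *)

Section Gradient.
Variables (R : realType) (n r : nat).
Implicit Types (phi : 'M[R]_(n, r) -> R) (X Y D : 'M[R]_(n, r)).

Lemma derive_dot phi X D : differentiable phi X -> 'D_D phi X = dot (egrad phi X) D.
Proof.
move=> dphi; rewrite deriveE // {1}(matrix_sum_delta D) linear_sum dotE.
apply: eq_bigr => i _; rewrite linear_sum; apply: eq_bigr => j _.
by rewrite linearZ /= mxE deriveE // mulrC.
Qed.

Lemma is_derive_line phi X D (t : R) : (forall Z, differentiable phi Z) ->
  is_derive t 1 (fun t : R => phi (X + t *: D)) (dot (egrad phi (X + t *: D)) D).
Proof.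
move=> dphi.
have fE : (fun h : R => h^-1 *: (((fun t : R => phi (X + t *: D)) \o shift t) (h *: 1)
    - phi (X + t *: D))) =
  (fun h => h^-1 *: ((phi \o shift (X + t *: D)) (h *: D) - phi (X + t *: D))).
  apply/funext => h /=; congr (_ *: (phi _ - _)).
  by rewrite [h *: 1]mulr1 scalerDl addrCA.
rewrite -derive_dot //; apply: DeriveDef.
  by rewrite /derivable fE; exact: diff_derivable.
by rewrite /derive fE.
Qed.

Lemma descent phi X Y (L : R) : (forall Z, differentiable phi Z) ->
  (forall Z Z', fnorm (egrad phi Z - egrad phi Z') <= L * fnorm (Z - Z')) ->
  phi Y <= phi X + dot (egrad phi X) (Y - X) + L / 2 * fnorm (Y - X) ^+ 2.
Proof.
move=> dphi hL; pose D := Y - X.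
pose c1 := dot (egrad phi X) D; pose c2 := L * fnorm D ^+ 2.
(* Subtracting the quadratic model along the segment makes the derivative nonpositive on the
   interval, so the mean value theorem gives [psi 1 <= psi 0]. *)
pose psi t := phi (X + t *: D) - t * c1 - c2 / 2 * t ^+ 2.
have dpsi (t : R) : is_derive t 1 psi (dot (egrad phi (X + t *: D)) D - c1 - c2 * t).
  have h1 := is_derive_line X D t dphi.
  rewrite /psi; apply: is_derive_eq.
  move: (dot (egrad _ _) _) => d; rewrite /GRing.scale /=; by field.
have cpsi : {within `[0, 1], continuous psi}.
  by apply: derivable_within_continuous => t _; exact: (@ex_derive _ _ _ _ _ _ _ (dpsi t)).
have [c] := MVT ltr01 (fun t _ => dpsi t) cpsi.
rewrite in_itv /= => /andP[c0 c1'].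
rewrite /psi scale1r scale0r addr0 subr0 mulr1 expr1n expr0n /= => hM.
have hc : dot (egrad phi (X + c *: D)) D - c1 <= c2 * c.
  rewrite /c1 -dotNl -dotDl (le_trans (dot_le _ _)) // /c2.
  rewrite expr2 mulrA mulrAC ler_wpM2r // (le_trans (hL _ _)) //.
  by rewrite addrAC subrr add0r fnormZ (gtr0_norm c0) mulrA mulrAC.
have XD : X + D = Y by rewrite /D subrKC.
rewrite XD in hM; rewrite -/D -/c1.
have -> : L / 2 * fnorm D ^+ 2 = c2 / 2 by rewrite /c2; ring.
by lra.
Qed.

Lemma opnorm2_tr_le m p q (B : 'M[R]_(m, p)) (A : 'M[R]_(m, q)) :
  fnorm (B^T *m A) <= opnorm2 B * fnorm A.
Proof.
have [->|h0] := eqVneq (fnorm (B^T *m A)) 0; first by rewrite mulr_ge0 ?opnorm2_ge0.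
have h : 0 < fnorm (B^T *m A) by rewrite lt_neqAle eq_sym h0 fnorm_ge0.
rewrite -(ler_pM2l h) -expr2 fnorm2 dot_mulmx trmxK (le_trans (dot_le _ _)) //.
by rewrite [leRHS]mulrA [leRHS]mulrC ler_wpM2l // mulrC opnorm2_le.
Qed.

Lemma stiefel_tr_le m X (C : 'M[R]_(n, m)) : stiefel X -> fnorm (X^T *m C) <= fnorm C.
Proof.
move=> hX; have [->|h0] := eqVneq (fnorm (X^T *m C)) 0; first exact: fnorm_ge0.
have h : 0 < fnorm (X^T *m C) by rewrite lt_neqAle eq_sym h0 fnorm_ge0.
rewrite -(ler_pM2l h) -expr2 fnorm2 dot_mulmx trmxK dotC (le_trans (dot_le _ _)) //.
by rewrite stiefel_fnorm.
Qed.

Variables (phi : 'M[R]_(n, r) -> R) (L Ln : R).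
Hypothesis dphi : forall Z, differentiable phi Z.
Hypothesis hL : forall Z Z', fnorm (egrad phi Z - egrad phi Z') <= L * fnorm (Z - Z').
Hypothesis hLn : forall Z, stiefel Z -> opnorm2 (egrad phi Z) <= Ln.

(** The difference splits into the projection at [X] of the change of the Euclidean gradient and the
    change of projection applied to the gradient at [Y]. The latter is half a sum of four terms,
    each at most [Ln * fnorm (X - Y)]. *)
Lemma rgrad_lip X Y : stiefel X -> stiefel Y ->
  fnorm (rgrad phi X - rgrad phi Y) <= (L + 2 * Ln) * fnorm (X - Y).
Proof.
move=> hX hY; set A := egrad phi X; set B := egrad phi Y; set D := Y - X.
have hB m (C : 'M[R]_(r, m)) : fnorm (B *m C) <= Ln * fnorm C.
  by rewrite (le_trans (opnorm2_le _ _)) // ler_wpM2r // hLn.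
have hBt m (C : 'M[R]_(n, m)) : fnorm (B^T *m C) <= Ln * fnorm C.
  by rewrite (le_trans (opnorm2_tr_le _ _)) // ler_wpM2r // hLn.
have DE : fnorm (X - Y) = fnorm D by rewrite fnormC.
have -> : rgrad phi X - rgrad phi Y = proj_tangent X (A - B) +
    2^-1 *: ((D *m Y^T *m B + D *m B^T *m Y) + (X *m (D^T *m B) + X *m (B^T *m D))).
  rewrite /rgrad -/A -/B proj_tangentB; move: (proj_tangent X A) => PA.
  have -> : D^T = Y^T - X^T by rewrite /D linearB.
  rewrite /proj_tangent /D !(mulmxDl, mulmxDr, mulmxN, mulNmx) -!mulmxA.
  move: (X *m (X^T *m B)) (X *m (B^T *m X)) (Y *m (Y^T *m B)) (Y *m (B^T *m Y)) => a b c d.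
  move: (X *m (Y^T *m B)) (X *m (B^T *m Y)) => f g.
  by apply/matrixP => i j; rewrite !mxE; ring.
have h1 : fnorm (proj_tangent X (A - B)) <= L * fnorm D.
  by rewrite (le_trans (fnorm_proj_tangent _ hX)) // -DE hL.
have h2 : fnorm (D *m Y^T *m B) <= Ln * fnorm D.
  rewrite -fnorm_tr !trmx_mul trmxK (le_trans (hBt _ _)) //.
  by rewrite stiefel_fnorm // fnorm_tr.
have h3 : fnorm (D *m B^T *m Y) <= Ln * fnorm D.
  rewrite -fnorm_tr !trmx_mul trmxK (le_trans (stiefel_tr_le _ hY)) //.
  by rewrite (le_trans (hB _ _)) // fnorm_tr.
have h4 : fnorm (X *m (D^T *m B)) <= Ln * fnorm D.
  by rewrite stiefel_fnorm // -fnorm_tr trmx_mul trmxK hBt.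
have h5 : fnorm (X *m (B^T *m D)) <= Ln * fnorm D.
  by rewrite stiefel_fnorm // hBt.
rewrite DE (le_trans (fnormD _ _)) // fnormZ ger0_norm ?invr_ge0 //.
have h6 := fnormD (D *m Y^T *m B + D *m B^T *m Y) (X *m (D^T *m B) + X *m (B^T *m D)).
have h7 := fnormD (D *m Y^T *m B) (D *m B^T *m Y).
have h8 := fnormD (X *m (D^T *m B)) (X *m (B^T *m D)).
by lra.
Qed.

(** The normal part of the Euclidean gradient, paired with the chord [Y - X], sees only the
    symmetric part of [X^T *m (Y - X)], which is quadratic; replacing the gradient by its projection
    costs [Ln / 2 * fnorm (Y - X) ^+ 2]. *)
Lemma stiefel_descent X Y : stiefel X -> stiefel Y ->
  phi Y <= phi X + dot (rgrad phi X) (Y - X) + (L + Ln) / 2 * fnorm (Y - X) ^+ 2.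
Proof.
move=> hX hY; apply: le_trans (descent X Y dphi hL) _.
set B := egrad phi X; set D := Y - X.
suff : dot B D <= dot (rgrad phi X) D + Ln / 2 * fnorm D ^+ 2 by lra.
rewrite /rgrad -/B /proj_tangent dotDl dotNl dotZl -addrA lerDl.
have -> : dot (X *m (X^T *m B + B^T *m X)) D = - dot (B *m D^T) (X *m D^T).
  rewrite dot_mulmx dotC dot_sym ?gram_sym // trmx_mul trmxK stiefel_dist_gram //.
  rewrite -/D dotNl mulrN; congr (- _).
  have gs : (D^T *m D)^T = D^T *m D by rewrite trmx_mul trmxK.
  rewrite dotC dotDl -[B^T *m X]trmxK trmx_mul trmxK dot_tr_sym //.
  transitivity (dot (X^T *m B) (D^T *m D)); first by lra.
  by rewrite dot_mulmx trmxK dot_mulmxl trmxK mulmxA.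
rewrite mulrN opprK.
have h : `|dot (B *m D^T) (X *m D^T)| <= Ln * fnorm D ^+ 2.
  rewrite (le_trans (dot_norm _ _)) // (stiefel_fnorm _ hX) fnorm_tr expr2 mulrA.
  rewrite ler_wpM2r // (le_trans (opnorm2_le _ _)) // fnorm_tr ler_wpM2r //.
  exact: hLn.
by move: h; rewrite ler_norml => /andP[h _]; lra.
Qed.

End Gradient.

(** * One iteration *)

Lemma fnorm2D_young (R : realType) m n (A B : 'M[R]_(m, n)) (c : R) : 0 < c ->
  fnorm (A + B) ^+ 2 <= (1 + c) * fnorm A ^+ 2 + (1 + c^-1) * fnorm B ^+ 2.
Proof.
move=> c0; rewrite fnorm2D.
have h1 := dot_le A B.
have : 0 <= c^-1 * (c * fnorm A - fnorm B) ^+ 2.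
  by rewrite mulr_ge0 ?sqr_ge0 // invr_ge0 ltW.
have -> : c^-1 * (c * fnorm A - fnorm B) ^+ 2 =
    c * fnorm A ^+ 2 - 2 * (fnorm A * fnorm B) + c^-1 * fnorm B ^+ 2.
  by field; rewrite gt_eqF.
by lra.
Qed.

(* [7 / 3 / (7 / 3 - al)] is the weight that Young's inequality puts on the consensus
   move when it is separated from the gradient move. *)
Lemma relax_rate (R : realType) (al s d1 d2 : R) :
  0 < al <= 1 -> 0 <= s -> s ^+ 2 <= 8^-1 -> 0 <= d1 -> d1 <= al / 640 ->
  0 <= d2 -> d2 <= 6^-1 ->
  7 / 3 * (d1 ^+ 2 / 4 + (1 - al + al * s) ^+ 2 + al * d2 ^+ 2 * (1 + s)) <=
  (7 / 3 - al) * (1 - 7 / 10 * al).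
Proof.
move=> /andP[al0 al1] s0 s2 d10 d1al d20 d26.
have s3 : s <= 5 / 14 by rewrite -(@ler_pXn2r _ 2) ?nnegrE //; lra.
have h1 : d1 ^+ 2 <= al ^+ 2 / 400.
  have -> : al ^+ 2 / 400 = (al / 20) ^+ 2 by field.
  by rewrite ler_pXn2r ?nnegrE //; lra.
have h2 : (1 - al + al * s) ^+ 2 <= (1 - 9 / 14 * al) ^+ 2.
  have h := ler_wpM2l (ltW al0) s3; have h' := mulr_ge0 (ltW al0) s0.
  by rewrite ler_pXn2r ?nnegrE //; lra.
have h3 : al * d2 ^+ 2 * (1 + s) <= al * (1 / 36) * (19 / 14).
  rewrite ler_pM ?mulr_ge0 ?sqr_ge0 ?(ltW al0) ?addr_ge0 //; last by lra.
  rewrite ler_wpM2l ?(ltW al0) //.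
  have -> : 1 / 36 = 6^-1 ^+ 2 :> R by field.
  by rewrite ler_pXn2r ?nnegrE.
have h4 : al ^+ 2 <= al by rewrite expr2 ler_piMr // ltW.
by lra.
Qed.

Lemma avg_comb (R : realType) N n r (u v : 'I_N -> 'M[R]_(n, r)) (c d : R) :
  avg (fun i => fnorm (c *: u i - d *: v i) ^+ 2) <=
  2 * (c ^+ 2 * avg (fun i => fnorm (u i) ^+ 2)) +
  2 * (d ^+ 2 * avg (fun i => fnorm (v i) ^+ 2)).
Proof.
rewrite -!avgZ -avgD; apply: avg_le => i; apply: le_trans (fnorm2B_le _ _) _.
by rewrite !fnormZ !exprMn !real_normK ?num_real.
Qed.

Lemma avg_diff_lip (R : realType) N n r (c : R)
    (F F' g g' Z Z' : 'I_N -> 'M[R]_(n, r)) : 0 <= c ->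
  (forall i, fnorm (g' i - g i) <= c * fnorm (Z' i - Z i)) ->
  avg (fun i => fnorm (F' i - F i) ^+ 2) <=
  2 * (c ^+ 2 * avg (fun i => fnorm (Z' i - Z i) ^+ 2)) +
  4 * avg (fun i => fnorm (F i - g i) ^+ 2) + 4 * avg (fun i => fnorm (F' i - g' i) ^+ 2).
Proof.
move=> c0 hg; rewrite -!avgZ -!avgD; apply: avg_le => i.
have -> : F' i - F i = (g' i - g i) + ((F' i - g' i) - (F i - g i)).
  by apply/matrixP => k l; rewrite !mxE; ring.
apply: le_trans (fnorm2D_le _ _) _; rewrite -[leRHS]addrA; apply: lerD.
  by rewrite ler_wpM2l // -exprMn ler_pXn2r ?nnegrE ?mulr_ge0.
by have := fnorm2B_le (F' i - g' i) (F i - g i); lra.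
Qed.

Lemma small_sqr_bound (R : realType) (al d1 a P : R) :
  al <= 1 -> 0 < d1 -> d1 <= al / 640 -> a <= d1 ^+ 2 ->
  320 * P ^+ 2 * a <= 1 / 1280 * P ^+ 2.
Proof.
move=> al1 d10 d1al ad.
have h : d1 <= 1 / 640 by move: al1 d1al; clear; lra.
have h2 := ler_wpM2r (ltW d10) h.
have h3 : 320 * a <= 1 / 1280 by move: h h2 ad; clear; lra.
by have := ler_wpM2r (sqr_ge0 P) h3; clear; lra.
Qed.

(* The second-order terms are absorbed through [a, a' <= d1 ^+ 2 = D * be], at the price
   of the large multiples of [D]. *)
Lemma descent_scalar (R : realType) (al be d1 A LG D P a a' b y nz phi q f f' : R) :
  0 < al -> al <= 1 -> 0 < be -> 0 < d1 -> d1 <= al / 640 -> 0 < LG ->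
  be * LG <= al * d1 / 5 -> 50 * (be * A) <= al * d1 -> 0 <= A ->
  D * be = d1 ^+ 2 ->
  0 <= P -> P <= A -> 0 <= a -> 0 <= a' -> 0 <= b -> 0 <= y -> 0 <= nz ->
  a <= d1 ^+ 2 -> a' <= d1 ^+ 2 -> be ^+ 2 * b <= (al * d1 / 10) ^+ 2 ->
  q = 6 * a + 2^-1 * a' + be ^+ 2 * b -> b <= phi + y ->
  f' <= f + be / 2 * (2 * (LG ^+ 2 * a) + 2 * nz - P ^+ 2 - phi) +
    be * (1 / 1280 * (P ^+ 2 + y) + 2 * (P * (A * a))) + P * q +
    LG / 2 * (2 * (be ^+ 2 * b) + 2 * q ^+ 2) ->
  f' + 7 / 20 * (be * P ^+ 2) + 9 / 20 * (be * b) <=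
  f + 101 / 200 * (be * y) + 200 * (D * a) + 2 * (D * a') + be * nz.
Proof.
move=> al0 al1 be0 d10 d1al LG0 beL beA A0 hD P0 PA a0 a'0 b0 y0 nz0 ad a'd bb qE bphi H.
have ald : al * d1 <= d1 by rewrite ler_piMl // ltW.
have d1s : d1 <= 1 / 640 by lra.
have D0 : 0 < D by rewrite -(pmulr_lgt0 _ be0) hD exprn_gt0.
have Da0 := mulr_ge0 (ltW D0) a0; have Da'0 := mulr_ge0 (ltW D0) a'0.
have bb0 := mulr_ge0 (ltW be0) b0.
have a2 : a ^+ 2 <= be * (D * a).
  by have := ler_wpM2r a0 ad; rewrite -hD -expr2; clear; lra.
have a'2 : a' ^+ 2 <= be * (D * a').
  by have := ler_wpM2r a'0 a'd; rewrite -hD -expr2; clear; lra.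
(* The factor 7 gathers the [6 * a] inside [q] and one more [P * a] from the normal part of the
   tracker, bounded in [t4]. *)
have t1 : 7 * (P * a) <= be * P ^+ 2 / 16 + 196 * (D * a).
  rewrite -(ler_pM2l be0); have := sqr_ge0 (be * P - 56 * a); move: a2; clear; lra.
have t2 : P * a' / 2 <= be * P ^+ 2 / 16 + D * a'.
  rewrite -(ler_pM2l be0); have := sqr_ge0 (be * P - 4 * a'); move: a'2; clear; lra.
have beA1 : be * A <= 1 / 1000 by move: beA ald d1s; clear; lra.
have t3 : P * (be ^+ 2 * b) <= be * b / 1000.
  have h := ler_wpM2r (mulr_ge0 (ltW be0) bb0) PA.
  have h2 := ler_wpM2r bb0 beA1; move: h h2; clear; lra.
have t4 : 2 * (be * (P * (A * a))) <= P * a.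
  have := ler_wpM2r (mulr_ge0 P0 a0) beA1.
  have := mulr_ge0 P0 a0; clear; lra.
have beL1 : be * LG <= 1 / 3200 by move: beL ald d1s; clear; lra.
have t5 : LG * (be ^+ 2 * b) <= be * b / 3200.
  by have := ler_wpM2r bb0 beL1; clear; lra.
have t6 : be * (LG ^+ 2 * a) <= D * a.
  rewrite -(ler_pM2l be0).
  have -> : be * (be * (LG ^+ 2 * a)) = (be * LG) ^+ 2 * a by ring.
  have -> : be * (D * a) = d1 ^+ 2 * a by rewrite -hD; ring.
  rewrite ler_wpM2r // ler_pXn2r ?nnegrE ?mulr_ge0 ?(ltW be0) ?(ltW LG0) ?(ltW d10) //.
  by move: beL ald d10; clear; lra.
have q2 : q ^+ 2 <= 108 * a ^+ 2 + 3 / 4 * a' ^+ 2 + 3 * (be ^+ 2 * b) ^+ 2.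
  rewrite qE; move: (be ^+ 2 * b) => x.
  have := sqr_ge0 (6 * a - a' / 2); have := sqr_ge0 (6 * a - x).
  have := sqr_ge0 (a' / 2 - x); clear; lra.
have x1 : be ^+ 2 * b <= 1 / 100.
  apply: le_trans bb _.
  have -> : 1 / 100 = (1 / 10) ^+ 2 :> R by field.
  rewrite ler_pXn2r ?nnegrE ?divr_ge0 ?mulr_ge0 ?(ltW al0) ?(ltW d10) //.
  by move: ald d1s; clear; lra.
have x0 : 0 <= be ^+ 2 * b by rewrite mulr_ge0 ?sqr_ge0.
have t7 : LG * q ^+ 2 <= D * a + D * a' + be * b / 1000.
  apply: le_trans (ler_wpM2l (ltW LG0) q2) _.
  have u1 : LG * a ^+ 2 <= 1 / 3200 * (D * a).
    by have := ler_wpM2l (ltW LG0) a2; have := ler_wpM2r Da0 beL1; clear; lra.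
  have u2 : LG * a' ^+ 2 <= 1 / 3200 * (D * a').
    by have := ler_wpM2l (ltW LG0) a'2; have := ler_wpM2r Da'0 beL1; clear; lra.
  have u3 : LG * (be ^+ 2 * b) ^+ 2 <= 1 / 100 * (be * b / 3200).
    apply: le_trans (_ : 1 / 100 * (LG * (be ^+ 2 * b)) <= _); last by move: t5; clear; lra.
    by have := ler_wpM2l (mulr_ge0 (ltW LG0) x0) x1; rewrite expr2; clear; lra.
  by move: u1 u2 u3 Da0 Da'0 bb0; clear; lra.
have t8 := ler_wpM2l (ltW be0) bphi.
have bP0 : 0 <= be * P ^+ 2 by rewrite mulr_ge0 ?sqr_ge0 // ltW.
have by0 := mulr_ge0 (ltW be0) y0.
have PqE : P * q = 6 * (P * a) + P * a' / 2 + P * (be ^+ 2 * b).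
  by rewrite qE; ring.
rewrite PqE in H.
move: H t1 t2 t3 t4 t5 t6 t7 t8 bP0 by0 bb0 Da0 Da'0; clear; lra.
Qed.

Section Step.
Variables (R : realType) (N n r : nat).
Hypothesis N0 : (0 < N)%N.
Variables (V : 'M[R]_N) (s : R).
Hypothesis hV : consensus_matrix V s.
Hypothesis s2 : s ^+ 2 <= 8^-1.
Hypothesis sN : 4 * (s ^+ 2 * N%:R) <= 1.
Variables (f_ : 'I_N -> 'M[R]_(n, r) -> R) (L Ln : R).
Hypothesis dphi : forall i Z, differentiable (f_ i) Z.
Hypothesis hL : forall i Z Z',
  fnorm (egrad (f_ i) Z - egrad (f_ i) Z') <= L * fnorm (Z - Z').
Hypothesis hLn : forall i Z, stiefel Z -> opnorm2 (egrad (f_ i) Z) <= Ln.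
Hypothesis Ln0 : 0 <= Ln.
Variables (al be d1 d2 A : R).
Let LG := L + 2 * Ln.
Hypothesis al0 : 0 < al.
Hypothesis al1 : al <= 1.
Hypothesis be0 : 0 < be.
Hypothesis d10 : 0 < d1.
Hypothesis d12 : 5 * d1 <= d2.
Hypothesis d26 : d2 <= 6^-1.
Hypothesis d1al : d1 <= al / 640.
Hypothesis beL : be * LG <= al * d1 / 5.
Hypothesis beA : 50 * (be * A) <= al * d1.
Hypothesis LG0 : 0 < LG.
Hypothesis A0 : 0 <= A.
Hypothesis hA : forall i Z, stiefel Z -> fnorm (egrad (f_ i) Z) <= A.

Variables (X Y F : 'I_N -> 'M[R]_(n, r)) (Xh : 'M[R]_(n, r)).
Hypothesis hX : stiefelN X.
Hypothesis hI : is_iam X Xh.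
Let e i := X i - Xh.
Variable a : R.
Hypothesis aE : a = avg (fun i => fnorm (e i) ^+ 2).
Let v i := proj_tangent (X i) (Y i).
Variable b : R.
Hypothesis bE : b = avg (fun i => fnorm (v i) ^+ 2).
Let Fb := stack_mean F.
Variable y : R.
Hypothesis yE : y = avg (fun i => fnorm (Y i - Fb) ^+ 2).
Variable nz : R.
Hypothesis nzE : nz = avg (fun i => fnorm (F i - rgrad (f_ i) (X i)) ^+ 2).
Hypothesis ha : a <= d1 ^+ 2.
Hypothesis he : forall i, fnorm (e i) <= d2.
Hypothesis hy : y <= 16 * A ^+ 2.
Hypothesis hY : forall i, fnorm (Y i) <= 5 * A.
Hypothesis hYm : stack_mean Y = Fb.
Hypothesis hFt : forall i, tangent (X i) (F i).
Hypothesis hFA : forall i, fnorm (F i) <= A.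

Let w i := al *: cons_dir X V i - be *: v i.
Variables (X' Y' F' : 'I_N -> 'M[R]_(n, r)) (Xh' : 'M[R]_(n, r)).
Hypothesis X'E : forall i, X' i = polar_retraction (X i) (w i).
Hypothesis hI' : is_iam X' Xh'.
Hypothesis Y'E : forall i, Y' i = mix V Y i + F' i - F i.
Hypothesis hFA' : forall i, fnorm (F' i) <= A.

Let e' i := X' i - Xh'.
Variable a' : R.
Hypothesis a'E : a' = avg (fun i => fnorm (e' i) ^+ 2).
Let Fb' := stack_mean F'.
Variable y' : R.
Hypothesis y'E : y' = avg (fun i => fnorm (Y' i - Fb') ^+ 2).
Variable nz' : R.
Hypothesis nz'E : nz' = avg (fun i => fnorm (F' i - rgrad (f_ i) (X' i)) ^+ 2).

Let hXh : stiefel Xh. Proof. by case: hI. Qed.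
Let hXh' : stiefel Xh'. Proof. by case: hI'. Qed.
Let s0 : 0 <= s. Proof. by case: hV => _ _ _ /andP[]. Qed.
Let V0 i j : 0 <= V i j. Proof. by case: hV. Qed.
Let V1 i : \sum_j V i j = 1. Proof. by case: hV. Qed.
Let a0 : 0 <= a. Proof. by rewrite aE; apply: avg_ge0 => i; exact: sqr_ge0. Qed.
Let b0 : 0 <= b. Proof. by rewrite bE; apply: avg_ge0 => i; exact: sqr_ge0. Qed.
Let y0 : 0 <= y. Proof. by rewrite yE; apply: avg_ge0 => i; exact: sqr_ge0. Qed.
Let a'0 : 0 <= a'. Proof. by rewrite a'E; apply: avg_ge0 => i; exact: sqr_ge0. Qed.
Let nz0 : 0 <= nz. Proof. by rewrite nzE; apply: avg_ge0 => i; exact: sqr_ge0. Qed.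

Let s3 : s <= 5 / 14.
Proof. by rewrite -(@ler_pXn2r _ 2) ?nnegrE //; apply: le_trans s2 _; lra. Qed.

Let wt i : tangent (X i) (w i).
Proof.
apply: tangentB; apply: tangentZ; last exact: proj_tangent_tangent.
exact: cons_dir_tangent.
Qed.

Lemma step_stiefel : stiefelN X'.
Proof. by move=> i; rewrite X'E; exact: polar_stiefel. Qed.
Let hX' := step_stiefel.

Lemma step_v i : fnorm (v i) <= 5 * A.
Proof. by rewrite (le_trans (fnorm_proj_tangent _ (hX i))). Qed.

Lemma step_b : b <= 25 * A ^+ 2.
Proof.
rewrite bE -[leRHS](avg_const _ N0); apply: avg_le => i.
have -> : 25 * A ^+ 2 = (5 * A) ^+ 2 by ring.
by rewrite ler_pXn2r ?nnegrE ?mulr_ge0 // step_v.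
Qed.

Let beb : be ^+ 2 * b <= (al * d1 / 10) ^+ 2.
Proof.
apply: le_trans (ler_wpM2l (sqr_ge0 be) step_b) _.
have -> : be ^+ 2 * (25 * A ^+ 2) = (5 * (be * A)) ^+ 2 by ring.
rewrite ler_pXn2r ?nnegrE ?mulr_ge0 ?invr_ge0 ?(ltW be0) ?(ltW al0) ?(ltW d10) //.
by have := beA; lra.
Qed.

Let em : fnorm (stack_mean e) <= 2^-1 * a.
Proof.
have -> : stack_mean e = stack_mean X - Xh by rewrite /e stack_meanB stack_mean_const.
by rewrite aE; exact: iam_mean.
Qed.

Let em2 : fnorm (stack_mean e) ^+ 2 <= d1 ^+ 2 / 4 * a.
Proof.
apply: le_trans (_ : (2^-1 * a) ^+ 2 <= _).
  by rewrite ler_pXn2r ?nnegrE ?mulr_ge0 ?invr_ge0 ?em ?a0 //.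
by have := ler_wpM2r a0 ha; lra.
Qed.

Let relax2 : avg (fun i => fnorm (e i + al *: cons_dir X V i) ^+ 2) <=
  (d1 ^+ 2 / 4 + (1 - al + al * s) ^+ 2 + al * d2 ^+ 2 * (1 + s)) * a.
Proof.
pose D i := \sum_j V i j * fnorm (e i - e j) ^+ 2.
have D0 i : 0 <= D i by apply: sumr_ge0 => j _; rewrite mulr_ge0 ?sqr_ge0.
apply: le_trans (_ : avg (fun i => fnorm (e i + al *: (mix V e i - e i)) ^+ 2 +
    al / 2 * d2 ^+ 2 * D i) <= _).
  apply: avg_le => i; apply: le_trans (cons_step hX hI hV i (ltW al0)) _.
  rewrite lerD2l -/(e i) -/(D i) mulrA ler_wpM2r // ler_wpM2l //.
    by rewrite divr_ge0 // ltW.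
  by rewrite ler_pXn2r ?nnegrE ?he // (le_trans _ d12) // mulr_ge0 // ltW.
rewrite avgD avgZ.
have h1 := avg_relax N0 hV e (introT andP (conj (ltW al0) al1)); rewrite -aE in h1.
have h2 : avg D <= 2 * (1 + s) * a by rewrite aE; exact: avg_mix_dist.
have h3 : al / 2 * d2 ^+ 2 * avg D <= al / 2 * d2 ^+ 2 * (2 * (1 + s) * a).
  by rewrite ler_wpM2l // mulr_ge0 ?sqr_ge0 // divr_ge0 // ltW.
have -> : (d1 ^+ 2 / 4 + (1 - al + al * s) ^+ 2 + al * d2 ^+ 2 * (1 + s)) * a =
  (d1 ^+ 2 / 4 * a + (1 - al + al * s) ^+ 2 * a) + al / 2 * d2 ^+ 2 * (2 * (1 + s) * a).
  by field.
apply: lerD h3; apply: le_trans h1 _.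
by apply: lerD em2 _.
Qed.

(** The new mean minimizes the sum of squared distances to the new points, so the old mean [Xh] may
    take its place; measuring from a fixed point of the manifold, [polar_dist] then removes the
    retraction. *)
Let a'_le : a' <= avg (fun i => fnorm (e i + al *: cons_dir X V i - be *: v i) ^+ 2).
Proof.
apply: le_trans (_ : avg (fun i => fnorm (X' i - Xh) ^+ 2) <= _).
  case: hI' => _ /(_ _ hXh) h; rewrite a'E /avg ler_wpM2l ?invr_ge0 //.
  under eq_bigr do rewrite /e' fnormC.
  by under [leRHS]eq_bigr do rewrite fnormC.
apply: avg_le => i; rewrite ler_pXn2r ?nnegrE // X'E.
rewrite (le_trans (polar_dist (hX i) (wt i) hXh)) // /w /e.
rewrite (_ : X i + _ - Xh = X i - Xh + al *: cons_dir X V i - be *: v i) //.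
by apply/matrixP => p q; rewrite !mxE; ring.
Qed.

Lemma step_contract : a' <= (1 - 7 / 10 * al) * a + 7 / 3 / al * (be ^+ 2 * b).
Proof.
(* Chosen so that [1 + c^-1] is exactly [7 / 3 / al], the weight of the gradient move. *)
pose c := al / (7 / 3 - al).
have al3 : 0 < 7 / 3 - al by have := al1; lra.
have c0 : 0 < c by rewrite divr_gt0.
apply: le_trans a'_le _.
apply: le_trans (_ : avg (fun i => (1 + c) * fnorm (e i + al *: cons_dir X V i) ^+ 2 +
   (1 + c^-1) * be ^+ 2 * fnorm (v i) ^+ 2) <= _).
  apply: avg_le => i; apply: le_trans (fnorm2D_young _ _ c0) _.
  by rewrite fnormN fnormZ (gtr0_norm be0) exprMn lerD2l mulrA.
rewrite avgD !avgZ -bE.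
have c1 : 1 + c^-1 = 7 / 3 / al by rewrite /c invf_div mulrBl divff ?gt_eqF //; ring.
rewrite c1 -[_ * be ^+ 2 * _]mulrA lerD2r.
have rr := relax_rate (introT andP (conj al0 al1)) s0 s2 (ltW d10) d1al _ d26.
have {}rr := rr (le_trans (mulr_ge0 (ler0n _ 5) (ltW d10)) d12).
apply: le_trans (ler_wpM2l _ relax2) _; first by rewrite addr_ge0 // ltW.
rewrite mulrA ler_wpM2r //.
have -> : 1 + c = 7 / 3 / (7 / 3 - al).
  by rewrite /c -[X in X + _](@divff _ (7 / 3 - al)) ?gt_eqF // -mulrDl subrK.
by rewrite mulrAC ler_pdivrMr // [leRHS]mulrC.
Qed.

(** The contraction gains [7 / 10 * al * d1 ^+ 2], while the gradient move, with
    [be ^+ 2 * b <= (al * d1 / 10) ^+ 2], adds at most [7 / 300 * al * d1 ^+ 2]. *)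
Lemma step_a : a' <= d1 ^+ 2.
Proof.
apply: le_trans step_contract _.
have h1 : 7 / 3 / al * (be ^+ 2 * b) <= 7 / 3 / al * (al * d1 / 10) ^+ 2.
  by rewrite ler_wpM2l // divr_ge0 // ltW.
have h2 : (1 - 7 / 10 * al) * a <= (1 - 7 / 10 * al) * d1 ^+ 2.
  by rewrite ler_wpM2l //; have := al1; lra.
have E : 7 / 3 / al * (al * d1 / 10) ^+ 2 = 7 / 300 * (al * d1 ^+ 2).
  by field; rewrite gt_eqF.
have h3 : 0 <= al * d1 ^+ 2 by rewrite mulr_ge0 ?sqr_ge0 // ltW.
by lra.
Qed.

Let w2 : avg (fun i => fnorm (w i) ^+ 2) <= 8 * a + 2 * (be ^+ 2 * b).
Proof.
apply: le_trans (avg_comb _ _ _ _) _.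
have hu : avg (fun i => fnorm (cons_dir X V i) ^+ 2) <= 4 * a.
  by rewrite aE; exact: (avg_cons_dir N0 Xh hX hV).
have al2 : al ^+ 2 <= 1 by rewrite expr_le1 // ltW.
have key (u b1 : R) : u <= 4 * a -> 0 <= u ->
    2 * (al ^+ 2 * u) + 2 * (be ^+ 2 * b1) <= 8 * a + 2 * (be ^+ 2 * b1).
  by move=> h1 u0; have := ler_wpM2r u0 al2; lra.
by rewrite bE; apply: (key _ _ hu); apply: avg_ge0 => i; exact: sqr_ge0.
Qed.

Lemma step_move : avg (fun i => fnorm (X' i - X i) ^+ 2) <= 8 * a + 2 * (be ^+ 2 * b).
Proof.
apply: le_trans _ w2; apply: avg_le => i; rewrite ler_pXn2r ?nnegrE // X'E.
apply: le_trans (polar_dist (hX i) (wt i) (hX i)) _.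
by rewrite addrAC subrr add0r.
Qed.

Let d := Xh' - Xh.
Let E := d + be *: stack_mean v.

(** [E] measures how far the move of the induced mean is from the Euclidean step
    [- be *: stack_mean v]. It has four second-order sources: the mean consensus direction, the
    retraction residual, and the gap between Euclidean and induced mean before and after the
    step. *)
Lemma step_E : fnorm E <= 6 * a + 2^-1 * a' + be ^+ 2 * b.
Proof.
pose rho i := X' i - (X i + w i).
have rho_le : fnorm (stack_mean rho) <= 4 * a + be ^+ 2 * b.
  apply: le_trans (fnorm_mean _) _.
  apply: le_trans (_ : 2^-1 * avg (fun i => fnorm (w i) ^+ 2) <= _).
    rewrite -avgZ; apply: avg_le => i; rewrite /rho X'E.
    exact: polar_second_order.
  by have := w2; lra.
have -> : E = al *: stack_mean (cons_dir X V) + stack_mean rho +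
    (Xh' - stack_mean X') - (Xh - stack_mean X).
  have -> : stack_mean rho = stack_mean X' - (stack_mean X +
      (al *: stack_mean (cons_dir X V) - be *: stack_mean v)).
    by rewrite /rho stack_meanB stack_meanD /w stack_meanB !stack_meanZ.
  rewrite /E /d; move: (stack_mean _) (stack_mean X') (stack_mean X) (stack_mean v).
  by move=> m1 m2 m3 m4; apply/matrixP => p q; rewrite !mxE; ring.
have h1 := mean_cons_dir N0 Xh hX hV; rewrite -aE in h1.
have h2 := iam_mean N0 hX hI; rewrite -aE fnormC in h2.
have h3 := iam_mean N0 hX' hI'; rewrite -a'E fnormC in h3.
apply: le_trans (fnormB _ _) _; apply: le_trans (lerD (fnormD _ _) (lexx _)) _.
apply: le_trans (lerD (lerD (fnormD _ _) (lexx _)) (lexx _)) _.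
have h4 : fnorm (al *: stack_mean (cons_dir X V)) <= (1 + s) * a.
  rewrite fnormZ (gtr0_norm al0) (le_trans _ h1) // ler_piMl //.
have h5 := ler_wpM2r a0 s3.
by have := a0; lra.
Qed.

Lemma step_d : fnorm d <= 3 / 25 * (al * d1).
Proof.
have dE : d = E - be *: stack_mean v by rewrite /E addrK.
have vm : fnorm (stack_mean v) <= 5 * A by apply: fnorm_mean_le => // i; exact: step_v.
rewrite dE (le_trans (fnormB _ _)) // fnormZ (gtr0_norm be0).
have h1 := ler_wpM2l (ltW be0) vm.
have h2 := step_E; have h3 := step_a; have h4 := ha; have h5 := beb.
have h6 : d1 ^+ 2 <= al * d1 / 640.
  by have := ler_wpM2r (ltW d10) d1al; rewrite expr2; lra.
have h7 : (al * d1 / 10) ^+ 2 <= al * d1 / 640.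
  have -> : (al * d1 / 10) ^+ 2 = al * (al * d1 ^+ 2) / 100 by field.
  have : al * (al * d1 ^+ 2) <= al * d1 ^+ 2.
    by rewrite ler_piMl // mulr_ge0 ?sqr_ge0 // ltW.
  have : al * d1 ^+ 2 <= d1 ^+ 2 by rewrite ler_piMl // sqr_ge0.
  by have := mulr_gt0 al0 d10; lra.
by have := mulr_gt0 al0 d10; have := beA; lra.
Qed.

(** Invariance agent by agent. The mixed error of each agent is governed by [d1], at most [d2 / 5],
    so relaxation pulls every error inwards by a multiple of [al * d2]; this outweighs the
    projection, the gradient move and the motion of the mean. *)
Lemma step_e i : fnorm (e' i) <= d2.
Proof.
have d20 : 0 < d2 by rewrite (lt_le_trans _ d12) // mulr_gt0.
have -> : e' i = (X' i - Xh) - d by rewrite /e' /d opprB addrA subrK.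
rewrite (le_trans (fnormB _ _)) //.
have h1 : fnorm (X' i - Xh) <= fnorm (e i + al *: cons_dir X V i) + be * fnorm (v i).
  rewrite X'E (le_trans (polar_dist (hX i) (wt i) hXh)) //.
  have -> : X i + w i - Xh = (e i + al *: cons_dir X V i) - be *: v i.
    by rewrite /w /e; apply/matrixP => p q; rewrite !mxE; ring.
  by rewrite (le_trans (fnormB _ _)) // fnormZ (gtr0_norm be0).
have h2 : be * fnorm (v i) <= al * d1 / 10.
  by have := ler_wpM2l (ltW be0) (step_v i); have := beA; lra.
have h3 := step_d.
(* The margin [2 / 5 * al * d2] is at least [2 * al * d1], enough for the gradient move,
   [al * d1 / 10], and for the move of the mean, [3 / 25 * (al * d1)]. *)
suff h4 : fnorm (e i + al *: cons_dir X V i) <= (1 - 2 / 5 * al) * d2.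
  have := ler_wpM2l (ltW al0) d12; have := mulr_gt0 al0 d20; lra.
have al4 : 0 <= 1 - 2 / 5 * al by have := al1; lra.
apply: fnorm_le_sqr; first by rewrite mulr_ge0 // ltW.
apply: le_trans (cons_step hX hI hV i (ltW al0)) _.
rewrite -/(e i); set D := \sum_j _.
have hD : D <= 4 * d2 ^+ 2.
  have -> : 4 * d2 ^+ 2 = \sum_j V i j * (4 * d2 ^+ 2) by rewrite -mulr_suml V1 mul1r.
  apply: ler_sum => j _; rewrite ler_wpM2l //.
  have -> : 4 * d2 ^+ 2 = (2 * d2) ^+ 2 by ring.
  rewrite ler_pXn2r ?nnegrE ?mulr_ge0 ?(ltW d20) // (le_trans (fnormB _ _)) //.
  by have := he i; have := he j; lra.
have D0 : 0 <= D by apply: sumr_ge0 => j _; rewrite mulr_ge0 ?sqr_ge0.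
have hq : al / 2 * (fnorm (e i) ^+ 2 * D) <= al / 18 * d2 ^+ 2.
  have hee : fnorm (e i) ^+ 2 <= 36^-1.
    have -> : 36^-1 = 6^-1 ^+ 2 :> R by field.
    by rewrite ler_pXn2r ?nnegrE // (le_trans (he i)).
  have : fnorm (e i) ^+ 2 * D <= 36^-1 * (4 * d2 ^+ 2) by rewrite ler_pM ?sqr_ge0.
  have al20 : 0 <= al / 2 by rewrite divr_ge0 // ltW.
  by move/(ler_wpM2l al20); lra.
(* Half of [d1] comes from the deviation, through [4 * (s ^+ 2 * N%:R) <= 1]; the remaining
   hundredth covers the mean, which is quadratic. *)
have hmix : fnorm (mix V e i) <= 51 / 100 * d1.
  have -> : mix V e i = (mix V e i - stack_mean e) + stack_mean e by rewrite subrK.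
  rewrite (le_trans (fnormD _ _)) //.
  have hm1 : fnorm (mix V e i - stack_mean e) <= d1 / 2.
    apply: fnorm_le_sqr; first by rewrite divr_ge0 // ltW.
    apply: le_trans (mix_dev_le N0 hV e i) _.
    have hd : avg (fun i => fnorm (e i - stack_mean e) ^+ 2) <= d1 ^+ 2.
      by have := avg_dev e N0; rewrite -aE; have := sqr_ge0 (fnorm (stack_mean e)); have := ha; lra.
    have hsN : 0 <= s ^+ 2 * N%:R by rewrite mulr_ge0 ?sqr_ge0.
    have := ler_wpM2l hsN hd; have := ler_wpM2r (sqr_ge0 d1) sN; lra.
  have := em; have := ha.
  have : d1 ^+ 2 <= d1 / 640.
    have := ler_wpM2r (ltW d10) d1al; rewrite expr2.
    by have : al * d1 <= d1 by [rewrite ler_piMl // ltW]; lra.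
  by have := d10; lra.
have hz : fnorm (e i + al *: (mix V e i - e i)) <= (1 - 7 / 8 * al) * d2.
  have -> : e i + al *: (mix V e i - e i) = (1 - al) *: e i + al *: mix V e i.
    by move: (e i) (mix V e i) => p q; apply/matrixP => k l; rewrite !mxE; ring.
  rewrite (le_trans (fnormD _ _)) // !fnormZ (gtr0_norm al0) ger0_norm ?subr_ge0 //.
  have al1' : 0 <= 1 - al by rewrite subr_ge0.
  have := ler_wpM2l al1' (he i); have := ler_wpM2l (ltW al0) hmix.
  by have := ler_wpM2l (ltW al0) d12; have := mulr_gt0 al0 d20; lra.
have hz2 : fnorm (e i + al *: (mix V e i - e i)) ^+ 2 <= ((1 - 7 / 8 * al) * d2) ^+ 2.
  have h0 : 0 <= 1 - 7 / 8 * al by have := al1; lra.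
  by rewrite ler_pXn2r ?nnegrE ?mulr_ge0 ?(ltW d20).
apply: le_trans (lerD hz2 hq) _; rewrite !exprMn -mulrDl ler_wpM2r ?sqr_ge0 //.
have : al ^+ 2 <= al by rewrite expr2 ler_piMr // ltW.
by have := al0; lra.
Qed.

Lemma step_local : local_region (fun=> Xh') d1 d2 X'.
Proof.
split => //; last exact: step_e.
have := step_a; rewrite a'E /avg mulrC ler_pdivrMr ?ltr0n // mulrC //.
Qed.

Let dF := avg (fun i => fnorm (F' i - F i) ^+ 2).

Lemma step_mean : stack_mean Y' = Fb'.
Proof.
rewrite (stack_mean_eq Y'E) stack_meanB stack_meanD (mean_mix hV) hYm.
by rewrite addrAC subrr add0r.
Qed.

(** Young's inequality with parameter [16 / 9] weights the mixed part by [25 / 9]; multiplied by the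
    contraction [8^-1] this stays below [9 / 25]. Centring the increments [F' i - F i] only
    decreases their mean square. *)
Lemma step_y : y' <= 9 / 25 * y + 25 / 16 * dF.
Proof.
pose B i := (F' i - F i) - (Fb' - Fb).
have hB : avg (fun i => fnorm (B i) ^+ 2) <= dF.
  have := avg_dev (fun i => F' i - F i) N0.
  rewrite stack_meanB -/Fb -/Fb' -/dF => ->.
  by rewrite lerDr sqr_ge0.
have hM : avg (fun i => fnorm (mix V Y i - Fb) ^+ 2) <= 8^-1 * y.
  by rewrite -hYm (le_trans (mix_dev N0 hV Y)) // hYm -yE ler_wpM2r.
apply: le_trans (_ : avg (fun i => 25 / 9 * fnorm (mix V Y i - Fb) ^+ 2 +
   25 / 16 * fnorm (B i) ^+ 2) <= _).
  rewrite y'E; apply: avg_le => i.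
  have -> : Y' i - Fb' = (mix V Y i - Fb) + B i.
    by rewrite Y'E /B; apply/matrixP => k l; rewrite !mxE; ring.
  have c0 : 0 < 16 / 9 :> R by lra.
  apply: le_trans (fnorm2D_young _ _ c0) _.
  have -> : 1 + 16 / 9 = 25 / 9 :> R by field.
  by have -> : 1 + (16 / 9)^-1 = 25 / 16 :> R by field.
rewrite avgD !avgZ; apply: lerD; last by rewrite ler_wpM2l.
have c1 : 0 <= 25 / 9 :> R by lra.
by apply: le_trans (ler_wpM2l c1 hM) _; have := y0; lra.
Qed.

Let dF_le : dF <= 4 * A ^+ 2.
Proof.
rewrite -[leRHS](avg_const _ N0); apply: avg_le => i.
have -> : 4 * A ^+ 2 = (2 * A) ^+ 2 by ring.
rewrite ler_pXn2r ?nnegrE ?mulr_ge0 // (le_trans (fnormB _ _)) //.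
by have := hFA i; have := hFA' i; lra.
Qed.

(** Increments are at most [2 * A], so the bound reproduces itself: [9 / 25 * 16 + 25 / 16 * 4] is
    below 16. *)
Lemma step_y_le : y' <= 16 * A ^+ 2.
Proof. by have := step_y; have := hy; have := dF_le; have := sqr_ge0 A; lra. Qed.

(** The five units are the mixed tracking error, at most [2 * A] by the choice of [t], and one each
    for [Fb], [F' i] and [F i]. *)
Lemma step_Y i : fnorm (Y' i) <= 5 * A.
Proof.
have -> : Y' i = ((mix V Y i - Fb) + Fb) + F' i - F i by rewrite Y'E subrK.
have h1 : fnorm (mix V Y i - Fb) <= 2 * A.
  apply: fnorm_le_sqr; first by rewrite mulr_ge0.
  rewrite -hYm; apply: le_trans (mix_dev_le N0 hV Y i) _; rewrite hYm -yE.
  have hsN : 0 <= s ^+ 2 * N%:R by rewrite mulr_ge0 ?sqr_ge0.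
  by have := ler_wpM2l hsN hy; have := ler_wpM2r (sqr_ge0 A) sN; lra.
have h2 : fnorm Fb <= A by apply: fnorm_mean_le.
apply: le_trans (fnormB _ _) _; apply: le_trans (lerD (fnormD _ _) (lexx _)) _.
apply: le_trans (lerD (lerD (fnormD _ _) (lexx _)) (lexx _)) _.
by have := hFA i; have := hFA' i; lra.
Qed.

Let lip i Z Z' : stiefel Z -> stiefel Z' ->
  fnorm (rgrad (f_ i) Z - rgrad (f_ i) Z') <= LG * fnorm (Z - Z').
Proof. by move=> hZ hZ'; exact: (rgrad_lip (hL i) (hLn i)). Qed.

Lemma step_dF : dF <= 16 * (LG ^+ 2 * a) + 4 * (LG ^+ 2 * (be ^+ 2 * b)) + 4 * nz + 4 * nz'.
Proof.
have h := @avg_diff_lip R N n r LG F F' (fun i => rgrad (f_ i) (X i))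
  (fun i => rgrad (f_ i) (X' i)) X X' (ltW LG0) (fun i => lip _ (hX' i) (hX i)).
apply: le_trans h _; rewrite nzE nz'E; apply: lerD; last exact: lexx.
apply: lerD; last exact: lexx.
have key (m : R) : m <= 8 * a + 2 * (be ^+ 2 * b) ->
    2 * (LG ^+ 2 * m) <= 16 * (LG ^+ 2 * a) + 4 * (LG ^+ 2 * (be ^+ 2 * b)).
  by move=> /(ler_wpM2l (sqr_ge0 LG)); lra.
exact: key step_move.
Qed.

Let f Z := avg (fun i => f_ i Z).
Let gr i := rgrad (f_ i) Xh.
Let p := stack_mean gr.
Let P := fnorm p.

Let pt : tangent Xh p.
Proof.
rewrite /tangent /= gram_mean (stack_mean_eq (y := fun=> 0)) ?stack_mean_const // => i.
exact: proj_tangent_tangent.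
Qed.

Let P_le : P <= A.
Proof.
apply: fnorm_mean_le => // i; apply: le_trans (hA i hXh).
exact: fnorm_proj_tangent.
Qed.

Let descent_f : f Xh' <= f Xh + dot p d + LG / 2 * fnorm d ^+ 2.
Proof.
have h : f Xh' <= avg (fun i => f_ i Xh + (dot d (gr i) + LG / 2 * fnorm d ^+ 2)).
  apply: avg_le => i.
  apply: le_trans (stiefel_descent (dphi i) (hL i) (hLn i) hXh hXh') _.
  rewrite addrA [dot d _]dotC lerD2l ler_wpM2r ?sqr_ge0 //.
  by rewrite /LG; have := Ln0; lra.
by rewrite avgD avgD avg_const // -dot_mean dotC addrA in h.
Qed.

(** The tracker [Y i] is not tangent at [X i], and its normal part is lost by the algorithm. The
    loss is small twice over: [p] is tangent at [Xh], so a normal vector at [X i] pairs with it only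
    through [e i]; and each [F j] is tangent at [X j], so the normal part of [Y i] is bounded by the
    tracking error plus [A] times consensus errors. *)
Let normal_part i : `|dot p (Y i - v i)| <=
  P * (fnorm (e i) * (fnorm (Y i - Fb) + A * (fnorm (e i) + avg (fun j => fnorm (e j))))).
Proof.
pose S := (X i)^T *m Y i + (Y i)^T *m X i.
have Ss : S^T = S by rewrite gram_sym.
have -> : Y i - v i = 2^-1 *: (X i *m S).
  by rewrite /v /proj_tangent opprB addrC subrK.
have h1 : `|dot p (X i *m S)| <= P * fnorm (e i) * fnorm S.
  have -> : dot p (X i *m S) = 2^-1 * dot ((e i)^T *m p + p^T *m e i) S.
    rewrite dotC dot_mulmx dotC dot_sym // trmx_mul trmxK; congr (_ * dot _ _).
    have -> : X i = e i + Xh by rewrite /e subrK.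
    rewrite [(e i + Xh)^T]linearD /= mulmxDl mulmxDr addrACA.
    by have -> : Xh^T *m p + p^T *m Xh = 0 := pt; rewrite addr0.
  rewrite normrM ger0_norm ?invr_ge0 //.
  apply: le_trans (ler_wpM2l _ (dot_norm _ _)) _; first by rewrite invr_ge0.
  have h2 := fnormD ((e i)^T *m p) (p^T *m e i).
  have h3 := fnormM (e i)^T p; have h4 := fnormM p^T (e i).
  rewrite !fnorm_tr in h3 h4.
  rewrite mulrA ler_wpM2r // /P.
  by lra.
have h2 : fnorm S <= 2 * (fnorm (Y i - Fb) + A * (fnorm (e i) + avg (fun j => fnorm (e j)))).
  pose T := (X i)^T *m (Y i - Fb) + (Y i - Fb)^T *m X i.
  have hT : fnorm T <= 2 * fnorm (Y i - Fb).
    rewrite (le_trans (fnormD _ _)) // -[fnorm (_ *m X i)]fnorm_tr trmx_mul trmxK.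
    by have := stiefel_tr_le (Y i - Fb) (hX i); lra.
  pose U := (X i)^T *m Fb + Fb^T *m X i.
  have hU : fnorm U <= 2 * (A * (fnorm (e i) + avg (fun j => fnorm (e j)))).
    rewrite /U gram_mean (le_trans (fnorm_mean _)) //.
    apply: le_trans (_ : avg (fun j => 2 * A * fnorm (e i) + 2 * A * fnorm (e j)) <= _).
      apply: avg_le => j.
      have -> : (X i)^T *m F j + (F j)^T *m X i =
          (X i - X j)^T *m F j + (F j)^T *m (X i - X j).
        have h : (X j)^T *m F j + (F j)^T *m X j = 0 by exact: hFt.
        rewrite [(X i - X j)^T]linearB /= mulmxBl mulmxBr addrACA -opprD h.
        by rewrite oppr0 addr0.
      have h3 := fnormM (X i - X j)^T (F j); have h4 := fnormM (F j)^T (X i - X j).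
      rewrite !fnorm_tr in h3 h4; rewrite (le_trans (fnormD _ _)) //.
      have h5 : fnorm (X i - X j) <= fnorm (e i) + fnorm (e j).
        by have -> : X i - X j = e i - e j by [rewrite /e opprB addrA subrK]; exact: fnormB.
      have h6 : fnorm (X i - X j) * fnorm (F j) <= (fnorm (e i) + fnorm (e j)) * A.
        by rewrite ler_pM.
      by lra.
    by rewrite avgD avg_const // avgZ; lra.
  have -> : S = T + U.
    rewrite /S /T /U; have -> : (Y i - Fb)^T = (Y i)^T - Fb^T by rewrite linearB.
    rewrite mulmxBl mulmxBr.
    move: (_ *m Y i) (_ *m X i) (_ *m Fb) (Fb^T *m _) => q1 q2 q3 q4.
    by apply/matrixP => k l; rewrite !mxE; ring.
  by rewrite (le_trans (fnormD _ _)) //; lra.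
rewrite dotZr normrM ger0_norm ?invr_ge0 //.
have h3 : 0 <= P * fnorm (e i) by rewrite mulr_ge0 // fnorm_ge0.
have := ler_wpM2l h3 h2; lra.
Qed.

Let mean_normal : `|dot p (stack_mean (fun i => Y i - v i))| <=
  1 / 1280 * (P ^+ 2 + y) + 2 * (P * (A * a)).
Proof.
pose m := avg (fun j => fnorm (e j)).
have m0 : 0 <= m by apply: avg_ge0 => j; exact: fnorm_ge0.
have m2 : m ^+ 2 <= a by rewrite aE; exact: avg_sqr.
rewrite dot_mean.
apply: le_trans (_ : avg (fun i => 320 * P ^+ 2 * fnorm (e i) ^+ 2 +
  (1 / 1280 * fnorm (Y i - Fb) ^+ 2 + (P * A * fnorm (e i) ^+ 2 +
   P * A * m * fnorm (e i)))) <= _).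
  rewrite /avg normrM ger0_norm ?invr_ge0 // ler_wpM2l ?invr_ge0 //.
  rewrite (le_trans (ler_norm_sum _ _ _)) //; apply: ler_sum => i _.
  apply: le_trans (normal_part i) _; rewrite -/m.
  (* Young's inequality, weighted so that only [1 / 1280] of the tracking error is charged; the
     large factor 320 on the other term is compensated by the smallness of [a] in
     [small_sqr_bound]. *)
  have := sqr_ge0 (640 * (P * fnorm (e i)) - fnorm (Y i - Fb)).
  by move: (fnorm (e i)) (fnorm (Y i - Fb)) => x z; lra.
rewrite avgD avgD avgD avgZ avgZ avgZ avgZ -aE -yE -/m.
have Pa := small_sqr_bound P al1 d10 d1al ha.
have PA0 : 0 <= P * A by rewrite mulr_ge0 // fnorm_ge0.
by have := ler_wpM2l PA0 m2; rewrite expr2; lra.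
Qed.

Let noise : fnorm (p - Fb) ^+ 2 <= 2 * (LG ^+ 2 * a) + 2 * nz.
Proof.
rewrite -stack_meanB; apply: le_trans (fnorm2_mean _ N0) _.
rewrite aE nzE -avgZ -!(avgZ 2) -avgD; apply: avg_le => i.
have -> : gr i - F i = (gr i - rgrad (f_ i) (X i)) - (F i - rgrad (f_ i) (X i)).
  by apply/matrixP => k l; rewrite !mxE; ring.
apply: le_trans (fnorm2B_le _ _) _; apply: lerD => //; rewrite ler_wpM2l //.
rewrite -exprMn ler_pXn2r ?nnegrE ?mulr_ge0 ?(ltW LG0) // /e fnormC fnormC.
by rewrite [fnorm (X i - Xh)]fnormC; exact: lip.
Qed.

Lemma step_descent (D : R) : D * be = d1 ^+ 2 ->
  f Xh' + 7 / 20 * (be * P ^+ 2) + 9 / 20 * (be * b) <=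
  f Xh + 101 / 200 * (be * y) + 200 * (D * a) + 2 * (D * a') + be * nz.
Proof.
move=> hD.
apply: (@descent_scalar R al be d1 A LG D P a a' b y nz (fnorm Fb ^+ 2)
  (6 * a + 2^-1 * a' + be ^+ 2 * b)) => //.
- exact: fnorm_ge0.
- exact: step_a.
- rewrite bE yE -hYm -avg_dev //; apply: avg_le => i.
  by rewrite ler_pXn2r ?nnegrE // fnorm_proj_tangent.
apply: le_trans descent_f _.
have dE : d = E - be *: stack_mean v by rewrite /E addrK.
have vE : stack_mean v = Fb - stack_mean (fun i => Y i - v i).
  by rewrite stack_meanB hYm opprB addrC subrK.
have pdE : dot p d = dot p E - be * dot p Fb + be * dot p (stack_mean (fun i => Y i - v i)).
  by rewrite dE dotDr dotNr dotZr vE dotDr dotNr; ring.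
(* Polarization: the sampled gradient yields [P ^+ 2] and [fnorm Fb ^+ 2] with a good sign, and the
   noise enters only through the square of [p - Fb]. *)
have pF : 2 * dot p Fb = P ^+ 2 + fnorm Fb ^+ 2 - fnorm (p - Fb) ^+ 2.
  by rewrite (fnorm2B p Fb) -/P; ring.
have pE : dot p E <= P * (6 * a + 2^-1 * a' + be ^+ 2 * b).
  by rewrite (le_trans (dot_le _ _)) // ler_wpM2l ?step_E // fnorm_ge0.
have d2E : fnorm d ^+ 2 <= 2 * (be ^+ 2 * b) + 2 * (6 * a + 2^-1 * a' + be ^+ 2 * b) ^+ 2.
  rewrite dE addrC; apply: le_trans (fnorm2D_le _ _) _; apply: lerD.
    rewrite fnormN fnormZ (gtr0_norm be0) exprMn ler_wpM2l // ler_wpM2l ?sqr_ge0 //.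
    by rewrite bE fnorm2_mean.
  rewrite ler_wpM2l // ler_pXn2r ?nnegrE ?fnorm_ge0 ?step_E //.
  by rewrite (le_trans _ step_E) // fnorm_ge0.
have := mean_normal; rewrite ler_norml => /andP[_ hn].
have h1 := ler_wpM2l (ltW be0) hn.
have h2 := ler_wpM2l (ltW be0) noise.
have LG2 : 0 <= LG / 2 by rewrite divr_ge0 // ltW.
have h3 := ler_wpM2l LG2 d2E.
rewrite pdE.
have {}pF := congr1 (fun x => be * x) pF.
move: pF pE h1 h2 h3; move: (6 * a + _) (dot p Fb) (dot p E) (dot p _) (fnorm d ^+ 2).
move: (fnorm (p - Fb) ^+ 2) (f Xh) => x1 x2 x3 x4 x5 x6 x7; lra.
Qed.

End Step.

(** * Sums along a trajectory *)

Section Summation.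
Variables (R : realType) (al be d1 LG D : R).
Hypothesis al0 : 0 < al.
Hypothesis al1 : al <= 1.
Hypothesis be0 : 0 < be.
Hypothesis d10 : 0 < d1.
Hypothesis d1al : d1 <= al / 640.
Hypothesis LG0 : 0 < LG.
Hypothesis beL : be * LG <= al * d1 / 5.
Hypothesis hD : D * be = d1 ^+ 2.
Variables (a b y nz p f : nat -> R) (fmin : R).
Hypothesis a_ge0 : forall k, 0 <= a k.
Hypothesis b_ge0 : forall k, 0 <= b k.
Hypothesis y_ge0 : forall k, 0 <= y k.
Hypothesis nz_ge0 : forall k, 0 <= nz k.
Hypothesis p_ge0 : forall k, 0 <= p k.
Hypothesis f_ge : forall k, fmin <= f k.
Hypothesis rec_a : forall k,
  a k.+1 <= (1 - 7 / 10 * al) * a k + 7 / 3 / al * (be ^+ 2 * b k).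
Hypothesis rec_y : forall k, y k.+1 <= 9 / 25 * y k +
  25 / 16 * (16 * (LG ^+ 2 * a k) + 4 * (LG ^+ 2 * (be ^+ 2 * b k)) + 4 * nz k + 4 * nz k.+1).
Hypothesis rec_f : forall k,
  f k.+1 + 7 / 20 * (be * p k) + 9 / 20 * (be * b k) <=
  f k + 101 / 200 * (be * y k) + 200 * (D * a k) + 2 * (D * a k.+1) + be * nz k.

Let S (g : nat -> R) K := \sum_(k < K.+1) g k.

Let S0 g : S g 0 = g 0%N. Proof. by rewrite /S big_ord1. Qed.
Let SS g K : S g K.+1 = S g K + g K.+1. Proof. by rewrite /S big_ord_recr. Qed.
Let S_ge0 g K : (forall k, 0 <= g k) -> 0 <= S g K.
Proof. by move=> g0; apply: sumr_ge0. Qed.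

Let sum_a K : 7 / 10 * al * S a K + a K.+1 <= a 0 + 7 / 3 / al * (be ^+ 2 * S b K).
Proof.
elim: K => [|K IH]; first by rewrite !S0; have := rec_a 0; lra.
by rewrite !SS; have := rec_a K.+1; move: IH; move: (7 / 3 / al) => c; lra.
Qed.

Let sum_y K : 16 / 25 * S y K + 9 / 25 * y K <= y 0 + 25 / 16 *
  (16 * (LG ^+ 2 * (S a K - a K)) + 4 * (LG ^+ 2 * (be ^+ 2 * (S b K - b K))) +
   8 * S nz K - 4 * nz K).
Proof.
elim: K => [|K IH]; first by rewrite !S0; have := nz_ge0 0; lra.
by rewrite !SS; have := rec_y K; move: IH; lra.
Qed.

Let sum_f K : f K.+1 + 7 / 20 * (be * S p K) + 9 / 20 * (be * S b K) <=
  f 0 + 101 / 200 * (be * S y K) + 200 * (D * S a K) +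
  2 * (D * (S a K - a 0 + a K.+1)) + be * S nz K.
Proof.
elim: K => [|K IH]; first by rewrite !S0; have := rec_f 0; lra.
by rewrite !SS; have := rec_f K.+1; move: IH; lra.
Qed.

(** All that the initial state and the noise can contribute to the sums along the trajectory. The
    weights are rounded up from the summed recursions: for instance 11 is 1 from the descent plus at
    most [99 / 10] through the tracking error. *)
Definition budget K : R := f 0 - fmin + 4 / 5 * (be * y 0) +
  300 * (D / al * a 0) + 11 * (be * S nz K).

(** The summed tracking error is replaced by sums of [a], [b] and noise, then the sum of [a] by that
    of [b]. Everything charged to [b] is so small that its coefficient only drops from [9 / 20] to
    [11 / 25]. *)
Let sum_main K : 7 / 20 * (be * S p K) + 11 / 25 * (be * S b K) <= budget K.
Proof.
have A0 := S_ge0 K a_ge0; have B0 := S_ge0 K b_ge0; have N0 := S_ge0 K nz_ge0.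
have Y0 := S_ge0 K y_ge0.
have D0 : 0 < D by rewrite -(pmulr_lgt0 _ be0) hD exprn_gt0.
have HA := sum_a K; have HY := sum_y K; have HF := sum_f K.
have fm := f_ge K.+1; have yK := y_ge0 K; have nK := nz_ge0 K; have a0 := a_ge0 0.
have aK1 := a_ge0 K.+1.
move: HA HY HF; rewrite /budget; set SA := S a K in A0 *; set SB := S b K in B0 *.
set SN := S nz K in N0 *; set SY := S y K in Y0 *; set SP := S p K.
move=> HA HY HF.
have bB0 : 0 <= be * SB by rewrite mulr_ge0 // ltW.
have DA0 : 0 <= D * SA by rewrite mulr_ge0 // ltW.
(* The gain of the loop from [b] to [a] and back: [D / al] times [be ^+ 2 / al] is [ep * be], and
   [ep <= 640 ^- 2]. *)
pose ep := (d1 / al) ^+ 2.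
have q1 : 640 * (d1 / al) <= 1.
  by rewrite mulrA ler_pdivrMr // mul1r; move: d1al; lra.
have q0 : 0 < d1 / al by rewrite divr_gt0.
have ep1 : 640 * ep <= d1 / al.
  by rewrite /ep expr2 mulrA ler_piMl // ltW.
have ep0 : 0 <= ep by exact: sqr_ge0.
have XE : D / al * (7 / 3 / al * (be ^+ 2 * SB)) = 7 / 3 * (ep * (be * SB)).
  by rewrite /ep exprMn -hD; field; rewrite gt_eqF.
have u0 : 0 <= D / al by rewrite divr_ge0 // ltW.
have HA2 := ler_wpM2l u0 HA.
rewrite [leRHS]mulrDr XE in HA2.
have E1 : D / al * (7 / 10 * al * SA + a K.+1) = 7 / 10 * (D * SA) + D / al * a K.+1.
  by field; rewrite gt_eqF.
rewrite E1 in HA2.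
have ua : 0 <= D / al * a K.+1 by rewrite mulr_ge0.
have HA3 := ler_wpM2l (ltW D0) HA.
have XE3 : D * (7 / 3 / al * (be ^+ 2 * SB)) = al * (7 / 3 * (ep * (be * SB))).
  by rewrite -XE; field; rewrite gt_eqF.
have X0 : 0 <= ep * (be * SB) by rewrite mulr_ge0.
have X1 : al * (7 / 3 * (ep * (be * SB))) <= 7 / 3 * (ep * (be * SB)).
  by rewrite ler_piMl // mulr_ge0 // divr_ge0.
rewrite [leRHS]mulrDr XE3 in HA3.
have alDA : 0 <= al * (D * SA) by rewrite mulr_ge0 // ltW.
have t1 : D * (a K.+1 - a 0) <= 7 / 3 * (ep * (be * SB)).
  by move: HA3 X1 alDA; lra.
have X2 : 640 * (ep * (be * SB)) <= 1 / 640 * (be * SB).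
  have := ler_wpM2r bB0 ep1; have := ler_wpM2r bB0 q1; lra.
have g1 : (be * LG) ^+ 2 <= D * be / 25.
  rewrite hD; have -> : d1 ^+ 2 / 25 = (d1 / 5) ^+ 2 by field.
  rewrite ler_pXn2r ?nnegrE ?mulr_ge0 ?divr_ge0 ?(ltW be0) ?(ltW LG0) ?(ltW d10) //.
  have : al * d1 <= d1 by rewrite ler_piMl // ltW.
  by move: beL; lra.
have g2 : be * (LG ^+ 2 * SA) <= 1 / 25 * (D * SA).
  rewrite -(ler_pM2l be0); have := ler_wpM2r A0 g1; lra.
have g3 : be * (LG ^+ 2 * (be ^+ 2 * SB)) <= 1 / 640 * (be * SB).
  have h1 : be * LG <= 1 / 640.
    apply: le_trans beL _.
    have : al * d1 <= d1 by rewrite ler_piMl // ltW.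
    by move: d1al al1 d10; lra.
  have h2 : (be * LG) ^+ 2 <= 1 / 640.
    have h0 : 0 <= be * LG by rewrite mulr_ge0 // ltW.
    have := ler_wpM2r h0 h1; move: h1; lra.
  have := ler_wpM2r bB0 h2; lra.
have LaK : 0 <= be * (LG ^+ 2 * a K).
  by rewrite mulr_ge0 ?(ltW be0) // mulr_ge0 ?sqr_ge0.
have LbK : 0 <= be * (LG ^+ 2 * (be ^+ 2 * b K)).
  by rewrite mulr_ge0 ?(ltW be0) // mulr_ge0 ?sqr_ge0 // mulr_ge0 ?sqr_ge0.
have bnK : 0 <= be * nz K by rewrite mulr_ge0 // ltW.
have byK : 0 <= be * y K by rewrite mulr_ge0 // ltW.
have by0 : 0 <= be * y 0 by rewrite mulr_ge0 // ltW.
have ua0 : 0 <= D / al * a 0 by rewrite mulr_ge0.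
have bN0 : 0 <= be * SN by rewrite mulr_ge0 // ltW.
have HY2 := ler_wpM2l (ltW be0) HY.
have t2 : 101 / 200 * (be * SY) <= 79 / 100 * (be * y 0) + 8 / 10 * (D * SA) +
    5 * (1 / 640 * (be * SB)) + 99 / 10 * (be * SN).
  move: HY2 g2 g3 LaK LbK bnK byK by0 DA0 bB0 bN0; lra.
have E2 : D * (SA - a 0 + a K.+1) = D * SA + D * (a K.+1 - a 0) by ring.
rewrite E2 in HF.
move: HF t1 t2 HA2 X2 X0 ua ua0 fm DA0 bB0 by0 bN0.
move: (D / al * a 0) (D / al * a K.+1) (ep * (be * SB)) (D * SA) (be * SB) (be * SY).
move: (be * SN) (be * SP) (D * (a K.+1 - a 0)) (be * y 0) (f K.+1) (f 0).
move=> x1 x2 x3 x4 x5 x6 x7 x8 x9 x10 x11 x12.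
by lra.
Qed.

Lemma budget_ge0 K : 0 <= budget K.
Proof.
apply: le_trans (sum_main K); rewrite addr_ge0 //.
  by rewrite mulr_ge0 ?divr_ge0 // mulr_ge0 ?S_ge0 // ltW.
by rewrite mulr_ge0 ?divr_ge0 // mulr_ge0 ?S_ge0 // ltW.
Qed.

Lemma sum_grad_le K : be * (\sum_(k < K.+1) p k) <= 3 * budget K.
Proof.
have := sum_main K; have := budget_ge0 K; rewrite -/(S p K).
have : 0 <= be * S b K by rewrite mulr_ge0 ?S_ge0 // ltW.
by lra.
Qed.

Lemma sum_consensus_le K :
  \sum_(k < K.+1) a k <= 10 / 7 / al * a 0 + 77 / 10 * (be / al ^+ 2 * budget K).
Proof.
rewrite -/(S a K); have HA := sum_a K; have HM := sum_main K; have HB := budget_ge0 K.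
have al2 : 0 < al ^+ 2 by rewrite exprn_gt0.
have P0 : 0 <= be * S p K by rewrite mulr_ge0 ?S_ge0 // ltW.
have c0 : 0 <= be / al ^+ 2 by rewrite divr_ge0 // ltW.
have h : be * S b K <= 25 / 11 * budget K by move: HM P0; lra.
have h2 := ler_wpM2l c0 h.
have aK := a_ge0 K.+1.
have h3 : 7 / 10 * al * S a K <= a 0 + 7 / 3 / al * (be ^+ 2 * S b K) by move: HA aK; lra.
have i0 : 0 <= 10 / 7 / al by rewrite divr_ge0 ?divr_ge0 // ltW.
have := ler_wpM2l i0 h3.
have -> : 10 / 7 / al * (7 / 10 * al * S a K) = S a K by field; rewrite gt_eqF.
have -> : 10 / 7 / al * (a 0 + 7 / 3 / al * (be ^+ 2 * S b K)) =
  10 / 7 / al * a 0 + 10 / 3 * (be / al ^+ 2 * (be * S b K)) by field; rewrite gt_eqF.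
have := mulr_ge0 c0 HB.
move: h2; move: (be / al ^+ 2) (10 / 7 / al * a 0) (be * S b K) (budget K) (S a K).
by move=> x1 x2 x3 x4 x5; lra.
Qed.

End Summation.

(** * Invariance of the local region and the resulting pathwise bounds *)

Section Trajectory.
Variables (R : realType) (N n r : nat).
Hypothesis N0 : (0 < N)%N.
Variables (V : 'M[R]_N) (s : R).
Hypothesis hV : consensus_matrix V s.
Hypothesis s2 : s ^+ 2 <= 8^-1.
Hypothesis sN : 4 * (s ^+ 2 * N%:R) <= 1.
Variables (f_ : 'I_N -> 'M[R]_(n, r) -> R) (L Ln : R).
Hypothesis dphi : forall i Z, differentiable (f_ i) Z.
Hypothesis hL : forall i Z Z',
  fnorm (egrad (f_ i) Z - egrad (f_ i) Z') <= L * fnorm (Z - Z').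
Hypothesis hLn : forall i Z, stiefel Z -> opnorm2 (egrad (f_ i) Z) <= Ln.
Hypothesis Ln0 : 0 <= Ln.
Variables (al be d1 d2 A D : R).
Let LG := L + 2 * Ln.
Hypothesis al0 : 0 < al.
Hypothesis al1 : al <= 1.
Hypothesis be0 : 0 < be.
Hypothesis d10 : 0 < d1.
Hypothesis d12 : 5 * d1 <= d2.
Hypothesis d26 : d2 <= 6^-1.
Hypothesis d1al : d1 <= al / 640.
Hypothesis beL : be * LG <= al * d1 / 5.
Hypothesis beA : 50 * (be * A) <= al * d1.
Hypothesis LG0 : 0 < LG.
Hypothesis A0 : 0 <= A.
Hypothesis hA : forall i Z, stiefel Z -> fnorm (egrad (f_ i) Z) <= A.
Hypothesis hD : D * be = d1 ^+ 2.
Variable Xh : ('I_N -> 'M[R]_(n, r)) -> 'M[R]_(n, r).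
Hypothesis hXh : iam_selection Xh.
Variables X Y F : nat -> 'I_N -> 'M[R]_(n, r).
Hypothesis hX0 : local_region Xh d1 d2 (X 0).
Hypothesis hXS : forall k, X k.+1 = fun i => polar_retraction (X k i)
  (al *: cons_dir (X k) V i - be *: proj_tangent (X k i) (Y k i)).
Hypothesis hY0 : forall i, Y 0 i = F 0 i.
Hypothesis hYS : forall k i, Y k.+1 i = mix V (Y k) i + F k.+1 i - F k i.
Hypothesis hFt : forall k i, stiefel (X k i) -> tangent (X k i) (F k i).
Hypothesis hFA : forall k i, stiefel (X k i) -> fnorm (F k i) <= A.

Definition traj_cons k : R := avg (fun i => fnorm (X k i - Xh (X k)) ^+ 2).
Definition traj_dir k : R := avg (fun i => fnorm (proj_tangent (X k i) (Y k i)) ^+ 2).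
Definition traj_track k : R := avg (fun i => fnorm (Y k i - stack_mean (F k)) ^+ 2).
Definition traj_noise k : R :=
  avg (fun i => fnorm (F k i - rgrad (f_ i) (X k i)) ^+ 2).
Definition traj_obj k : R := avg (fun i => f_ i (Xh (X k))).
Definition traj_grad k : R :=
  fnorm (stack_mean (fun i => rgrad (f_ i) (Xh (X k)))) ^+ 2.

Let inv k := [/\ local_region Xh d1 d2 (X k), traj_track k <= 16 * A ^+ 2,
  forall i, fnorm (Y k i) <= 5 * A & stack_mean (Y k) = stack_mean (F k)].

Let local_cons k : local_region Xh d1 d2 (X k) -> traj_cons k <= d1 ^+ 2.
Proof.
case=> _ h _; rewrite /traj_cons /avg mulrC ler_pdivrMr ?ltr0n //.
by rewrite mulrC.
Qed.

Let S_of k : inv k -> stiefelN (X k). Proof. by case=> -[]. Qed.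
Let I_of k : inv k -> is_iam (X k) (Xh (X k)). Proof. by move/S_of; exact: hXh. Qed.
Let C_of k : inv k -> traj_cons k <= d1 ^+ 2. Proof. by case=> /local_cons. Qed.
Let E_of k : inv k -> forall i, fnorm (X k i - Xh (X k)) <= d2. Proof. by case=> -[]. Qed.
Let X_of k i : X k.+1 i = polar_retraction (X k i)
  (al *: cons_dir (X k) V i - be *: proj_tangent (X k i) (Y k i)).
Proof. by rewrite hXS. Qed.
Let SS_of k : inv k -> stiefelN (X k.+1).
Proof. by move=> h; apply: (step_stiefel (S_of h) (X_of k)). Qed.

Lemma traj_inv k : inv k.
Proof.
elim: k => [|k IH].
  have hS : stiefelN (X 0) by case: hX0.
  have Y0 i : fnorm (Y 0 i) <= A by rewrite hY0 hFA.
  have Ym : stack_mean (Y 0) = stack_mean (F 0) by exact: stack_mean_eq.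
  split=> //.
    rewrite /traj_track -Ym.
    apply: le_trans (_ : avg (fun i => fnorm (Y 0 i) ^+ 2) <= _).
      by rewrite [leRHS]avg_dev // lerDr sqr_ge0.
    apply: le_trans (_ : A ^+ 2 <= _); last by have := sqr_ge0 A; lra.
    rewrite -[leRHS](avg_const _ N0); apply: avg_le => i.
    by rewrite ler_pXn2r ?nnegrE.
  by move=> i; have := Y0 i; have := A0; lra.
have [hl hy hY hm] := IH.
have hS' := SS_of IH.
have hI' := hXh hS'.
have hF i : fnorm (F k i) <= A by exact/hFA/S_of.
have hF' i : fnorm (F k.+1 i) <= A by exact: hFA.
split.
- have [] := step_local N0 hV s2 sN al0 al1 be0 d10 d12 d26 d1al beA A0 (S_of IH)
    (I_of IH) erefl erefl (C_of IH) (E_of IH) hY (X_of k) hI' erefl.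
  by split.
- exact: (step_y_le N0 hV s2 A0 erefl hy hm hF (hYS k) hF' erefl).
- exact: (step_Y N0 hV sN A0 erefl hy hm hF (hYS k) hF').
- exact: (step_mean hV hm (hYS k)).
Qed.

Let ge0 (g : 'I_N -> R) : 0 <= avg (fun i => g i ^+ 2).
Proof. by apply: avg_ge0 => i; exact: sqr_ge0. Qed.

Let rec_a k : traj_cons k.+1 <= (1 - 7 / 10 * al) * traj_cons k +
  7 / 3 / al * (be ^+ 2 * traj_dir k).
Proof.
have h := traj_inv k; have [hl hy hY hm] := h.
exact: (step_contract N0 hV s2 al0 al1 be0 d10 d12 d26 d1al (S_of h) (I_of h) erefl erefl
  (C_of h) (E_of h) (X_of k) (hXh (SS_of h)) erefl).
Qed.

Let rec_y k : traj_track k.+1 <= 9 / 25 * traj_track k + 25 / 16 *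
  (16 * (LG ^+ 2 * traj_cons k) + 4 * (LG ^+ 2 * (be ^+ 2 * traj_dir k)) +
   4 * traj_noise k + 4 * traj_noise k.+1).
Proof.
have h := traj_inv k; have [hl hy hY hm] := h.
apply: le_trans (step_y N0 hV s2 erefl hm (hYS k) erefl) _.
rewrite lerD2l ler_wpM2l ?divr_ge0 //.
exact: (step_dF N0 hV hL hLn al0 al1 LG0 (S_of h) erefl erefl erefl (X_of k) erefl).
Qed.

Let rec_f k : traj_obj k.+1 + 7 / 20 * (be * traj_grad k) + 9 / 20 * (be * traj_dir k) <=
  traj_obj k + 101 / 200 * (be * traj_track k) + 200 * (D * traj_cons k) +
  2 * (D * traj_cons k.+1) + be * traj_noise k.
Proof.
have h := traj_inv k; have [hl hy hY hm] := h.
exact: (step_descent N0 hV s2 dphi hL hLn Ln0 al0 al1 be0 d10 d12 d26 d1al beL beA LG0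
  A0 hA (S_of h) (I_of h) erefl erefl erefl erefl (C_of h) (E_of h) hY hm
  (fun i => hFt (S_of h i)) (fun i => hFA (S_of h i)) (X_of k) (hXh (SS_of h)) erefl hD).
Qed.

Variable fmin : R.
Hypothesis hfmin : forall Z, stiefel Z -> fmin <= avg (fun i => f_ i Z).

Definition traj_budget K : R := traj_obj 0 - fmin + 4 / 5 * (be * traj_track 0) +
  300 * (D / al * traj_cons 0) + 11 * (be * \sum_(k < K.+1) traj_noise k).

Let obj_ge k : fmin <= traj_obj k.
Proof. by apply: hfmin; case: (I_of (traj_inv k)). Qed.

Theorem traj_grad_le K :
  be * (\sum_(k < K.+1) traj_grad k) <= 3 * traj_budget K.
Proof.
apply: (sum_grad_le al0 al1 be0 d10 d1al LG0 beL hD _ _ _ _ _ obj_ge rec_a rec_y rec_f);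
  by move=> k; rewrite ?sqr_ge0 ?ge0.
Qed.

Theorem traj_cons_le K : \sum_(k < K.+1) traj_cons k <=
  10 / 7 / al * traj_cons 0 + 77 / 10 * (be / al ^+ 2 * traj_budget K).
Proof.
apply: (sum_consensus_le al0 al1 be0 d10 d1al LG0 beL hD _ _ _ _ _ obj_ge rec_a rec_y rec_f);
  by move=> k; rewrite ?sqr_ge0 ?ge0.
Qed.

End Trajectory.

(** * Expectations and measurability *)

Section LowerIntegral.
Import HBSimple HBNNSimple.
Context d (T : measurableType d) (R : realType) (P : probability T R).

(* For functions that need not be measurable, the library integral is the lower
   integral, the supremum over the simple functions below. *)
Lemma lower_integral_gt (f : T -> \bar R) (c : \bar R) : (forall w, 0 <= f w)%E ->
  (c < \int[P]_w f w)%E ->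
  exists h : {nnsfun T >-> R}, (forall w : T, (h w)%:E <= f w)%E /\ (c < \int[P]_w (h w)%:E)%E.
Proof.
move=> f0; rewrite ge0_integralTE // => /ereal_sup_gt [_ [h /= hf <-] ch].
by exists h; split => //; rewrite integralT_nnsfun.
Qed.

(** Summation and integration do not commute for lower integrals in the direction needed here. If
    every expectation exceeded [G / K.+1%:R], simple functions below the [f k] would still have
    integrals above it; these can be added, and their sum is below [g] off a null set. *)
Lemma min_expectation_le (f : nat -> T -> R) (g : T -> R) (G : R) (Z : set T) K :
  (forall k w, 0 <= f k w) -> (forall w, 0 <= g w) -> measurable_fun setT g ->
  measurable Z -> P Z = 0%E ->
  (forall w, ~ Z w -> \sum_(k < K.+1) f k w <= g w) ->
  (\int[P]_w (g w)%:E = G%:E)%E ->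
  exists k : 'I_K.+1, (\int[P]_w (f k w)%:E <= (G / K.+1%:R)%:E)%E.
Proof.
move=> f0 g0 mg mZ PZ fg gG; apply: contrapT => /forallNP hk.
pose c := G / K.+1%:R.
have /choice[h hh] : forall k : 'I_K.+1, exists h : {nnsfun T >-> R},
    (forall w : T, (h w)%:E <= (f k w)%:E)%E /\ (c%:E < \int[P]_w (h w)%:E)%E.
  move=> k; apply: lower_integral_gt; first by move=> w; rewrite lee_fin.
  by have /negP := hk k; rewrite -ltNge.
have hsum : (\int[P]_w (\sum_(k < K.+1) (h k w)%:E) <= \int[P]_w (g w)%:E)%E.
  apply: ae_ge0_le_integral => //.
  - by move=> w _; apply: sume_ge0 => k _; rewrite lee_fin.
  - by apply: emeasurable_sum => k; apply/measurable_EFinP.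
  - by move=> w _; rewrite lee_fin.
  - exact/measurable_EFinP.
  exists Z; split => // w /= /not_implyP[_ hw]; apply: contrapT => /fg hfg; apply: hw.
  rewrite sumEFin lee_fin; apply: le_trans hfg; apply: ler_sum => k _.
  by have [/(_ w)] := hh k; rewrite lee_fin.
move: hsum; rewrite gG ge0_integral_sum //; last 2 first.
- by move=> k; apply/measurable_EFinP.
- by move=> k w _; rewrite lee_fin.
apply/negP; rewrite -ltNge.
have -> : G%:E = (\sum_(k < K.+1) c%:E)%E.
  rewrite sumEFin sumr_const card_ord -mulr_natr /c mulfVK //.
have {hh} : forall k, (c%:E < \int[P]_w (h k w)%:E)%E by move=> k; have [] := hh k.
move: h; clearbody c; clear; elim: K => [|K IH] h hh; first by rewrite !big_ord1.
rewrite big_ord_recl [ltRHS]big_ord_recl; apply: lteD => //.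
by apply: (IH (fun k => h (lift ord0 k))) => k.
Qed.

End LowerIntegral.

(** * Measurability of matrix-valued maps *)

Section MatrixMeasurability.
Variable R : realType.

(** Every open set of matrices is a countable union of boxes with rational centre and radius
    [m.+1%:R^-1], and membership in a box is a finite conjunction of conditions on the entries. *)
Lemma borel_mx_measurable d (T : measurableType d) n r (X : T -> 'M[R]_(n, r)) :
  (forall a b, measurable_fun setT (fun w => X w a b)) ->
  measurable_fun setT (X : T -> borel_mx R n r).
Proof.
move=> mX; apply: (@measurability _ _ T (borel_mx R n r) setT X (@open 'M[R]_(n, r)) erefl).
move=> _ [U oU <-]; rewrite setTI.
pose B (qm : 'M[rat]_(n, r) * nat) : set 'M[R]_(n, r) :=
  [set x | forall a b, `|ratr (qm.1 a b) - x a b| < qm.2.+1%:R^-1].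
have UE : U = \bigcup_(qm in [set qm | B qm `<=` U]) B qm.
  apply/seteqP; split => [x Ux|x [qm /= BU /BU //]].
  have /nbhs_ballP[e /= e0 eU] : nbhs x U by exact: open_nbhs_nbhs.
  have [m me] : exists m : nat, 2 * m.+1%:R^-1 < e.
    have [m] := ltr_add_invr (divr_gt0 e0 (ltr0n R 2)).
    by rewrite add0r ltr_pdivlMr // mulrC => hm; exists m.
  have /choice[q hq] : forall ab : 'I_n * 'I_r, exists q : rat,
      `|ratr q - x ab.1 ab.2| < m.+1%:R^-1.
    move=> [a b] /=; have [|q] := @rat_in_itvoo R (x a b - m.+1%:R^-1) (x a b + m.+1%:R^-1).
      by rewrite ltrBlDr -addrA ltrDl addr_gt0 // invr_gt0 ltr0n.
    by rewrite in_itv /= => hq; exists q; rewrite ltr_distl.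
  exists (\matrix_(a, b) q (a, b), m); last by move=> a b; rewrite /= mxE; exact: (hq (a, b)).
  move=> y /= hy; apply: eU; split => // a b; rewrite /ball /=.
  have := hy a b; rewrite mxE => h; have h2 := hq (a, b).
  apply: le_lt_trans me.
  have -> : x a b - y a b = (x a b - ratr (q (a, b))) + (ratr (q (a, b)) - y a b).
    by rewrite addrA subrK.
  rewrite (le_trans (ler_normD _ _)) // distrC mulr_natl mulr2n.
  by rewrite lerD // ltW.
rewrite UE preimage_bigcup bigcup_mkcond.
apply: countable_bigcupT_measurable => // qm; case: ifP => // _.
have -> : X @^-1` B qm = \bigcap_(a in [set: 'I_n]) \bigcap_(b in [set: 'I_r])
    ((fun w => ratr (qm.1 a b) - X w a b) @^-1` [set x | `|x| < qm.2.+1%:R^-1]).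
  by apply/seteqP; split => [w hw a _ b _|w hw a b]; [exact: hw|exact: (hw a _ b)].
apply: fin_bigcap_measurable; first exact: finite_finset.
move=> a _; apply: fin_bigcap_measurable; first exact: finite_finset.
move=> b _; rewrite -[X in measurable X]setTI.
have mf : measurable_fun setT (fun w => ratr (qm.1 a b) - X w a b).
  by apply: measurable_funB.
apply: mf => //; apply: open_measurable.
have -> : [set x : R | `|x| < qm.2.+1%:R^-1] = ball 0 (qm.2.+1%:R^-1).
  by apply/seteqP; split => x; rewrite /ball /= sub0r normrN.
exact: ball_open.
Qed.

Lemma continuous_borel_mx n r (phi : 'M[R]_(n, r) -> R) : continuous phi ->
  measurable_fun setT (phi : borel_mx R n r -> R).
Proof.
move=> /continuousP cphi; apply: (measurability _ (RGenOpens.measurableE R)).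
move=> _ [_ [a [b ->] <-]]; rewrite setTI; apply: sub_sigma_algebra.
exact/cphi/interval_open.
Qed.

End MatrixMeasurability.

(** * Independence and Tonelli's theorem *)

Section Independence.
Context d (T : measurableType d) dX (U : measurableType dX) (R : realType).
Variables (P : probability T R) (D : probability U R) (C : set (set T)).
Hypothesis hC : C `<=` @measurable d T.
Variable xi : T -> U.
Hypothesis mxi : measurable_fun setT xi.

Lemma sigma_gen_measurable : <<s C >> `<=` @measurable d T.
Proof.
apply: smallest_sub => //; split => //.
- by move=> A mA; rewrite setTD; exact: measurableC.
- by move=> F h; exact: bigcupT_measurable.
Qed.

Lemma measurable_fun_sub d' (U' : measurableType d') (f : T -> U') :
  measurable_fun setT (f : g_sigma_algebraType C -> U') -> measurable_fun setT f.
Proof.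
by move=> mf _ Y mY; apply: sigma_gen_measurable; exact: mf.
Qed.

Let idC : T -> g_sigma_algebraType C := id.

Let midC : measurable_fun setT idC.
Proof. by move=> _ A mA; rewrite setTI; exact: sigma_gen_measurable. Qed.

Let pairC : T -> g_sigma_algebraType C * U := fun w => (idC w, xi w).

Let mpairC : measurable_fun setT pairC.
Proof. exact: measurable_fun_pair. Qed.

HB.instance Definition _ := isMeasurableFun.Build _ _ _ _ idC midC.
HB.instance Definition _ := isMeasurableFun.Build _ _ _ _ pairC mpairC.

Hypothesis hind : forall (E : set T) (B : set U), <<s C >> E -> measurable B ->
  P (E `&` xi @^-1` B) = (P E * D B)%E.

(* Tonelli's theorem for the joint law of the identity of [g_sigma_algebraType C]
   and [xi], which is a product by independence. *)
Lemma indep_integral (phi : g_sigma_algebraType C * U -> \bar R) :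
  measurable_fun setT phi -> (forall z, 0 <= phi z)%E ->
  (\int[P]_w phi (w, xi w) = \int[P]_w \int[D]_x phi (w, x))%E.
Proof.
move=> mphi phi0.
pose P' : probability _ R := distribution P idC.
pose Q : probability _ R := distribution P pairC.
have hr (E : set (g_sigma_algebraType C)) (B : set U) :
    measurable E -> measurable B -> Q (E `*` B) = (P' E * D B)%E.
  by move=> mE mB; exact: hind.
have QE A : measurable A -> Q A = (P' \x D)%E A.
  by move=> mA; rewrite (product_measure_unique hr mA).
transitivity (\int[Q]_z phi z)%E.
  by rewrite [RHS](ge0_integral_pushforward mpairC).
transitivity (\int[P' \x D]_z phi z)%E.
  by apply: eq_measure_integral => A mA _; exact: QE.
rewrite (fubini_tonelli1 _ mphi phi0).
rewrite [LHS](ge0_integral_pushforward midC) //; first exact: measurable_fun_fubini_tonelli_F.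
by move=> w _; exact: integral_ge0.
Qed.

End Independence.

(** For fixed [B], the two sides are finite measures in [E], a restriction and a multiple of [P],
    that agree on the pi-system [C]; hence they agree on the sigma-algebra it generates. *)
Lemma indep_sigma d (T : measurableType d) dX (U : measurableType dX) (R : realType)
    (P : probability T R) (D : probability U R) (C : set (set T)) (xi : T -> U) :
  C `<=` @measurable d T -> setI_closed C -> C setT -> measurable_fun setT xi ->
  (forall E B, C E -> measurable B -> P (E `&` xi @^-1` B) = (P E * D B)%E) ->
  forall E B, <<s C >> E -> measurable B -> P (E `&` xi @^-1` B) = (P E * D B)%E.
Proof.
move=> hC CI CT mxi hP E B CE mB.
have mxB : measurable (xi @^-1` B) by rewrite -[X in measurable X]setTI; exact: mxi.
have D0 : 0 <= fine (D B) by rewrite fine_ge0.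
have DE A : mscale (NngNum D0) P A = (P A * D B)%E.
  by change ((fine (D B))%:E * P A = P A * D B)%E; rewrite fineK ?fin_num_measure // muleC.
rewrite -DE; change (mrestr P mxB E = mscale (NngNum D0) P E).
apply: (@g_sigma_algebra_measure_unique _ R T C hC (fun=> setT) (fun=> CT) _
    (mrestr P mxB) (mscale (NngNum D0) P) CI _ _ E CE) => //.
- by rewrite bigcup_const.
- by move=> A CA; exact: (etrans (hP A B CA mB) (esym (DE A))).
- move=> _; change (P (setT `&` xi @^-1` B) < +oo)%E.
  by rewrite ltey_eq fin_num_measure //; exact: measurableI.
Qed.

Definition mx_measurable d (T : measurableType d) (R : realType) m n (X : T -> 'M[R]_(m, n)) :=
  forall a b, measurable_fun setT (fun w => X w a b).

Section Continuity.
Variable R : realType.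

Lemma fnorm_continuous m n (v : 'M[R]_(m, n)) : continuous (fun w : 'M[R]_(m, n) => fnorm (v - w)).
Proof.
have -> : (fun w : 'M[R]_(m, n) => fnorm (v - w)) = Num.sqrt \o
    (fun w => \sum_i \sum_j (v i j - w i j) * (v i j - w i j)).
  apply/funext => w; rewrite /= /fnorm dotE; congr Num.sqrt.
  by apply: eq_bigr => i _; apply: eq_bigr => j _; rewrite !mxE.
have cA : continuous (fun w : 'M[R]_(m, n) => \sum_i \sum_j (v i j - w i j) * (v i j - w i j)).
  apply: (continuous_big (op := +%R) (x0 := 0)) => [|i _]; first exact: add_continuous.
  apply: (continuous_big (op := +%R) (x0 := 0)) => [|j _ w]; first exact: add_continuous.
  have hw := nbhs_filter w.
  have ch : v i j - x i j @[x --> w] --> v i j - w i j.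
    by apply: cvgB; [exact: cvg_cst|exact: coord_continuous].
  exact: cvgM.
by move=> w; apply: continuous_comp; [exact: cA|exact: sqrt_continuous].
Qed.

Lemma locally_lipschitz_continuous m n p q (g : 'M[R]_(m, n) -> 'M[R]_(p, q)) :
  (forall v, exists C, forall w, fnorm (v - w) <= 1 -> fnorm (g v - g w) <= C * fnorm (v - w)) ->
  forall a b, continuous (fun v => g v a b).
Proof.
move=> hg a b v; have [C hC] := hg v; have fv := nbhs_filter v.
have cv : fnorm (v - w) @[w --> v] --> (0 : R).
  by rewrite -(fnorm0 R m n) -(subrr v); exact: fnorm_continuous.
apply/cvgrPdist_lt => e e0.
have C0 : 0 < e / (`|C| + 1) by rewrite divr_gt0 // ltr_wpDl.
near=> w.
have h1 : fnorm (v - w) <= 1.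
  rewrite ltW //; near: w; move/cvgrPdist_lt: (cv) => /(_ 1 ltr01); apply: filterS => w.
  by rewrite sub0r normrN ger0_norm.
have h2 : fnorm (v - w) < e / (`|C| + 1).
  by near: w; move/cvgrPdist_lt: (cv) => /(_ _ C0); apply: filterS => w; rewrite sub0r normrN ger0_norm.
have := fnorm_entry (g v - g w) a b; rewrite !mxE => /le_lt_trans; apply.
apply: (le_lt_trans (hC w h1)); rewrite ltr_pdivlMr ?ltr_wpDl // in h2.
apply: le_lt_trans h2; rewrite mulrC ler_wpM2l //.
by rewrite (le_trans (ler_norm C)) // lerDl.
Unshelve. all: by end_near.
Qed.

Lemma invsqrtmx_continuous m n a b :
  continuous (fun v : 'M[R]_(m, n) => invsqrtmx (1%:M + v^T *m v) a b).
Proof.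
apply: (@locally_lipschitz_continuous _ _ _ _ (fun v => invsqrtmx (1%:M + v^T *m v))) => v.
exists (2 * fnorm v + 1) => w vw; apply: (le_trans (invsqrtmx_lip v w)).
have -> : v^T *m v - w^T *m w = v^T *m (v - w) + (v - w)^T *m w.
  by rewrite [(v - w)^T]linearB /= mulmxBr mulmxBl addrA subrK.
have wv : fnorm w <= fnorm v + 1.
  by rewrite -[w](subrK v) (le_trans (fnormD _ _)) // addrC lerD2l fnormC.
have := fnormD (v^T *m (v - w)) ((v - w)^T *m w).
have := fnormM v^T (v - w); have := fnormM (v - w)^T w; rewrite !fnorm_tr.
have := fnorm_ge0 (v - w); move: wv; clear.
move: (fnorm (v - w)) (fnorm w) (fnorm v) (fnorm (_ *m _)) (fnorm (_ *m w)) => x y z p q.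
by move=> h0 h1 h2 h3 h4; nra.
Qed.

End Continuity.

Section MxMeasurable.
Context d (T : measurableType d) (R : realType).

Lemma mx_measurable_cst m n (A : 'M[R]_(m, n)) : mx_measurable (fun _ : T => A).
Proof. by move=> a b; exact: measurable_cst. Qed.

Lemma mx_measurableD m n (X Y : T -> 'M[R]_(m, n)) : mx_measurable X -> mx_measurable Y ->
  mx_measurable (fun w => X w + Y w).
Proof.
move=> hX hY a b; under eq_fun do rewrite mxE.
exact: measurable_funD (hX a b) (hY a b).
Qed.

Lemma mx_measurableZ m n c (X : T -> 'M[R]_(m, n)) : mx_measurable X ->
  mx_measurable (fun w => c *: X w).
Proof.
move=> hX a b; under eq_fun do rewrite mxE.
by apply: measurable_funM; [exact: measurable_cst|exact: hX].
Qed.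

Lemma mx_measurableB m n (X Y : T -> 'M[R]_(m, n)) : mx_measurable X -> mx_measurable Y ->
  mx_measurable (fun w => X w - Y w).
Proof.
move=> hX hY; under eq_fun do rewrite -[- Y _]scaleN1r.
exact: mx_measurableD hX (mx_measurableZ (-1) hY).
Qed.

Lemma mx_measurable_sum m n (I : Type) (s : seq I) (X : I -> T -> 'M[R]_(m, n)) :
  (forall i, mx_measurable (X i)) -> mx_measurable (fun w => \sum_(i <- s) X i w).
Proof.
move=> hX a b; under eq_fun do rewrite summxE.
by apply: measurable_sum => i; exact: hX.
Qed.

Lemma mx_measurableT m n (X : T -> 'M[R]_(m, n)) : mx_measurable X ->
  mx_measurable (fun w => (X w)^T).
Proof. by move=> hX a b; under eq_fun do rewrite mxE; exact: hX. Qed.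

Lemma mx_measurableM m n p (X : T -> 'M[R]_(m, n)) (Y : T -> 'M[R]_(n, p)) :
  mx_measurable X -> mx_measurable Y -> mx_measurable (fun w => X w *m Y w).
Proof.
move=> hX hY a b; under eq_fun do rewrite mxE.
by apply: measurable_sum => i; apply: measurable_funM; [exact: hX|exact: hY].
Qed.

Lemma mx_measurable_comp m n p q (g : 'M[R]_(m, n) -> 'M[R]_(p, q)) (X : T -> 'M[R]_(m, n)) :
  (forall a b, continuous (fun v => g v a b)) -> mx_measurable X ->
  mx_measurable (fun w => g (X w)).
Proof.
move=> cg mX a b.
exact: measurableT_comp (continuous_borel_mx (cg a b)) (borel_mx_measurable mX).
Qed.

Lemma measurable_fnorm2 m n (X : T -> 'M[R]_(m, n)) : mx_measurable X ->
  measurable_fun setT (fun w => fnorm (X w) ^+ 2).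
Proof.
move=> hX; under eq_fun do rewrite fnorm2 dotE.
apply: measurable_sum => i; apply: measurable_sum => j.
by apply: measurable_funM; exact: hX.
Qed.

Lemma mx_measurable_proj m n (X Y : T -> 'M[R]_(m, n)) : mx_measurable X -> mx_measurable Y ->
  mx_measurable (fun w => proj_tangent (X w) (Y w)).
Proof.
move=> hX hY; apply: mx_measurableB => //; apply: mx_measurableZ; apply: mx_measurableM => //.
by apply: mx_measurableD; apply: mx_measurableM => //; exact: mx_measurableT.
Qed.

Lemma mx_measurable_polar m n (X v : T -> 'M[R]_(m, n)) : mx_measurable X -> mx_measurable v ->
  mx_measurable (fun w => polar_retraction (X w) (v w)).
Proof.
move=> hX hv; apply: mx_measurableM; first exact: mx_measurableD.
apply: (mx_measurable_comp (g := fun v => invsqrtmx (1%:M + v^T *m v))) => //.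
exact: invsqrtmx_continuous.
Qed.

End MxMeasurable.

Lemma stiefel_measurable (R : realType) n r :
  measurable (@stiefel R n r : set (borel_mx R n r)).
Proof.
have mid : mx_measurable (fun X : borel_mx R n r => X : 'M[R]_(n, r)).
  by move=> a b; apply: continuous_borel_mx; exact: coord_continuous.
have mg := measurable_fnorm2 (mx_measurableB (mx_measurableM (mx_measurableT mid) mid)
  (mx_measurable_cst 1%:M)).
have := mg measurableT [set 0] (measurable_set1 0); rewrite setTI.
congr (measurable _); apply/seteqP; split => X; rewrite /stiefel /=.
  by move/eqP; rewrite sqrf_eq0 => /eqP /fnorm_eq0 /subr0_eq.
by move=> ->; rewrite subrr fnorm0 expr0n.
Qed.

Section Mean.
Context d (T : measurableType d) (R : realType) (P : probability T R).
Implicit Types (f g : T -> R) (c : R).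

(** Integrability travels with the value, so that expectations stay finite under linear combinations
    and [fine] can be trusted. *)
Definition has_mean f c :=
  P.-integrable setT (EFin \o f) /\ (\int[P]_x (f x)%:E = c%:E)%E.

Lemma has_mean_cst c : has_mean (fun=> c) c.
Proof.
split; first exact: finite_measure_integrable_cst.
rewrite integral_cst // -[RHS]mule1; congr (_ * _)%E; exact: probability_setT.
Qed.

Lemma has_meanD f g c c' : has_mean f c -> has_mean g c' ->
  has_mean (fun x => f x + g x) (c + c').
Proof.
move=> [fi fE] [gi gE]; split; first exact: (integrableD measurableT fi gi).
by under eq_integral do rewrite EFinD; rewrite integralD_EFin // fE gE.
Qed.

Lemma has_meanZ k f c : has_mean f c -> has_mean (fun x => k * f x) (k * c).
Proof.
move=> [fi fE]; split; first exact: (integrableZl measurableT k fi).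
by under eq_integral do rewrite EFinM; rewrite integralZl // fE.
Qed.

Lemma has_mean_sum I (s : seq I) (f : I -> T -> R) (c : I -> R) :
  (forall i, has_mean (f i) (c i)) -> has_mean (fun x => \sum_(i <- s) f i x) (\sum_(i <- s) c i).
Proof.
move=> fc; elim: s => [|i s IH].
  by rewrite big_nil; under eq_fun do rewrite big_nil; exact: has_mean_cst.
by rewrite big_cons; under eq_fun do rewrite big_cons; exact: has_meanD.
Qed.

Lemma has_mean_ge0 f b : measurable_fun setT f -> (forall x, 0 <= f x) ->
  (\int[P]_x (f x)%:E <= b%:E)%E -> exists2 c, 0 <= c <= b & has_mean f c.
Proof.
move=> mf f0 fb; have I0 : (0 <= \int[P]_x (f x)%:E)%E by apply: integral_ge0 => x _; rewrite lee_fin.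
have fi : (\int[P]_x (f x)%:E \is a fin_num)%E by rewrite ge0_fin_numE // (le_lt_trans fb) // ltry.
exists (fine (\int[P]_x (f x)%:E)%E); first by rewrite fine_ge0 //= -lee_fin fineK.
split; last by rewrite fineK.
apply/integrableP; split; first exact/measurable_EFinP.
under eq_integral do rewrite /= ger0_norm //.
by rewrite -ge0_fin_numE.
Qed.

Lemma has_mean_dominated f g c : measurable_fun setT f -> (forall x, `|f x| <= g x) ->
  has_mean g c -> exists c', has_mean f c'.
Proof.
move=> mf fg [gi _].
have fi : P.-integrable setT (EFin \o f).
  apply: le_integrable gi => //; first exact/measurable_EFinP.
  by move=> x _; rewrite /= lee_fin (le_trans (fg x)) // ler_norm.
exists (fine (\int[P]_x (f x)%:E)%E); split => //.
by rewrite fineK // integrable_fin_num.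
Qed.

Lemma has_mean_measurable f c : has_mean f c -> measurable_fun setT f.
Proof. by move=> [/integrableP[mf _] _]; exact/measurable_EFinP. Qed.

Lemma has_mean_nonneg f c : (forall x, 0 <= f x) -> has_mean f c -> 0 <= c.
Proof.
by move=> f0 [_ fE]; rewrite -lee_fin -fE integral_ge0 // => x _; rewrite lee_fin.
Qed.

Lemma min_mean_le (F : nat -> T -> R) g c (Z : set T) K :
  (forall k w, 0 <= F k w) -> (forall w, 0 <= g w) -> has_mean g c ->
  measurable Z -> P Z = 0%E -> (forall w, ~ Z w -> \sum_(k < K.+1) F k w <= g w) ->
  exists k : 'I_K.+1, ('E_P[F k] <= (c / K.+1%:R)%:E)%E.
Proof.
move=> F0 g0 hg mZ PZ Fg.
have [k hk] := min_expectation_le F0 g0 (has_mean_measurable hg) mZ PZ Fg (proj2 hg).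
by exists k; rewrite unlock.
Qed.

End Mean.

(** The cross term with the constant [s] has mean zero, so adding a centred sample raises the second
    moment by at most [q]. *)
Lemma centered_second_moment d (U : measurableType d) (R : realType) (D : probability U R)
    n r (g : U -> 'M[R]_(n, r)) (c s : 'M[R]_(n, r)) (q : R) : mx_measurable g ->
  (forall a b, \int[D]_x (g x a b)%:E = (c a b)%:E)%E ->
  (\int[D]_x (fnorm (g x - c) ^+ 2)%:E <= q%:E)%E ->
  (\int[D]_x (fnorm (s + (g x - c)) ^+ 2)%:E <= (fnorm s ^+ 2 + q)%:E)%E.
Proof.
move=> mg gc gq.
have mh : mx_measurable (fun x => g x - c) by apply: mx_measurableB => //; exact: mx_measurable_cst.
have [q' /andP[_ q'q] hq] := has_mean_ge0 (measurable_fnorm2 mh) (fun x => sqr_ge0 _) gq.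
(* The value of the integral alone does not give integrability; it comes from the second moment, as
   [y <= 1 + y ^+ 2]. *)
have h0 a b : has_mean D (fun x => (g x - c) a b) 0.
  have [|z hz] := has_mean_dominated (mh a b) _ (has_meanD (has_mean_cst D 1) hq).
    move=> x; apply: (le_trans (fnorm_entry _ a b)).
    have := sqr_ge0 (fnorm (g x - c) - 1); have := fnorm_ge0 (g x - c).
    by move: (fnorm _); clear => y; nra.
  have hg := has_meanD hz (has_mean_cst D (c a b)).
  have gE : (fun x => (g x - c) a b + c a b) = fun x => g x a b.
    by apply/funext => x; rewrite !mxE subrK.
  have [_] := hg; rewrite (eq_integral (fun x => (g x a b)%:E)) => [|x _].
    rewrite gc => -[zc]; have z0 : z = 0 by apply: (addIr (c a b)); rewrite add0r -zc.
    by rewrite z0 in hz.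
  by rewrite !mxE subrK.
have hd : has_mean D (fun x => dot s (g x - c)) 0.
  have -> : (fun x => dot s (g x - c)) = fun x => \sum_i \sum_j s i j * (g x - c) i j.
    by apply/funext => x; rewrite dotE.
  have := has_mean_sum (index_enum 'I_n)
    (fun i => has_mean_sum (index_enum 'I_r) (fun j => has_meanZ (s i j) (h0 i j))).
  by rewrite [X in has_mean _ _ X]big1 // => i _; rewrite big1 // => j _; rewrite mulr0.
have [_] := has_meanD (has_meanD (has_mean_cst D (fnorm s ^+ 2)) (has_meanZ 2 hd)) hq.
under eq_integral do rewrite -fnorm2D.
by move=> ->; rewrite lee_fin mulr0 addr0 lerD2l.
Qed.

(** * The second moment of a batch *)

Section SampleSum.
Context d (T : measurableType d) dX (U : measurableType dX) (R : realType).
Variables (P : probability T R) (D : probability U R) (C : set (set T)).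
Hypothesis hC : C `<=` @measurable d T.
Variables (xi : nat -> T -> U) (m : nat).
Hypothesis mxi : forall j, measurable_fun setT (xi j).
Hypothesis hind : forall (E : set T) (B : nat -> set U), <<s C >> E ->
  (forall j, measurable (B j)) ->
  P (E `&` \bigcap_(j in `I_m) (xi j @^-1` B j)) = (P E * \prod_(j < m) D (B j))%E.

(* A pi-system generating the sigma-algebra of the past and of the first [p] samples. *)
Let rect p : set (set T) := [set A | exists E B, [/\ <<s C >> E,
  forall j, measurable (B j) & A = E `&` \bigcap_(j in `I_p) (xi j @^-1` B j)]].

Let sC : sigma_algebra setT <<s C >> := smallest_sigma_algebra _ _.

Let CT : <<s C >> setT.
Proof. by have [h0 hD _] := sC; have := hD _ h0; rewrite setD0. Qed.

Let CI (E F : set T) : <<s C >> E -> <<s C >> F -> <<s C >> (E `&` F).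
Proof. exact: (@measurableI _ (g_sigma_algebraType C)). Qed.

Let rect_measurable p : rect p `<=` @measurable d T.
Proof.
move=> _ [E [B [hE mB ->]]]; apply: measurableI; first exact: sigma_gen_measurable hC _ hE.
apply: fin_bigcap_measurable => [|j _]; first exact: finite_II.
by rewrite -[X in measurable X]setTI; exact: mxi.
Qed.

Let rect_setI p : setI_closed (rect p).
Proof.
move=> _ _ [E [B [hE mB ->]]] [F [B' [hF mB' ->]]].
exists (E `&` F), (fun j => B j `&` B' j); split; [exact: CI|by move=> j; exact: measurableI|].
apply/seteqP; split => w /=.
  by move=> [[Ew hw] [Fw hw']]; split => // j jp; split; [exact: hw|exact: hw'].
by move=> [[Ew Fw] hw]; split; split => // j jp; have [] := hw j jp.
Qed.

Let rect_past p E : <<s C >> E -> rect p E.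
Proof.
move=> hE; exists E, (fun=> setT); split => //.
by apply/seteqP; split => w /=; [move=> Ew; split|case].
Qed.

Let rect_sample p j B : (j < p)%N -> measurable B -> rect p (xi j @^-1` B).
Proof.
move=> jp mB; exists setT, (fun l => if l == j then B else setT); split => //.
  by move=> l; case: ifP.
apply/seteqP; split => w /= hw.
  by split => // l _ /=; case: eqP => [->|].
by case: hw => _ /(_ j jp); rewrite /= eqxx.
Qed.

(** Independence is assumed for full batches of [m] samples; filling up with the whole space gives
    it for the first [p]. *)
Let prob_rect p E B : (p <= m)%N -> <<s C >> E -> (forall j, measurable (B j)) ->
  P (E `&` \bigcap_(j in `I_p) (xi j @^-1` B j)) = (P E * \prod_(j < p) D (B j))%E.
Proof.
move=> pm hE mB; pose B' j := if (j < p)%N then B j else setT.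
have := hind hE (B := B'); rewrite {1}/B'.
have -> : \bigcap_(j in `I_m) (xi j @^-1` B' j) = \bigcap_(j in `I_p) (xi j @^-1` B j).
  apply/seteqP; split => w hw j /= jp.
    by have /= := hw j (leq_trans jp pm); rewrite /B' jp.
  by rewrite /B'; case: ifP => // /hw.
move=> ->; last by move=> j; case: ifP.
congr (_ * _)%E; rewrite (big_ord_widen m (fun j => D (B j)) pm) [RHS]big_mkcond.
by apply: eq_bigr => j _; rewrite /B'; case: ifP => // _; exact: probability_setT.
Qed.

Let rect_indep p A B : (p < m)%N -> rect p A -> measurable B ->
  P (A `&` xi p @^-1` B) = (P A * D B)%E.
Proof.
move=> pm [E [B' [hE mB' ->]]] mB.
rewrite (prob_rect (ltnW pm) hE mB') -muleA.
pose B'' j := if j == p then B else B' j.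
have mB'' j : measurable (B'' j) by rewrite /B''; case: ifP.
have := prob_rect pm hE mB''; rewrite big_ord_recr /= {3}/B'' eqxx => h.
have -> : (\prod_(j < p) D (B' j) = \prod_(j < p) D (B'' j))%E.
  by apply: eq_bigr => j _; rewrite /B'' ltn_eqF.
rewrite -h -setIA; congr (P (_ `&` _)); apply/seteqP; split => w /=.
  move=> [hw hp] j /=; rewrite /B'' ltnS leq_eqVlt; case: eqP => [->|_] //= jp.
  exact: hw.
move=> hw; split.
  by move=> j jp; have := hw j (ltnW jp); rewrite /B'' /= (ltn_eqF jp).
by have := hw p (ltnSn p); rewrite /B'' /= eqxx.
Qed.

Variables (n r : nat) (g : T -> U -> 'M[R]_(n, r)) (c : T -> 'M[R]_(n, r)) (q : R).
Hypothesis mg : mx_measurable (fun z : g_sigma_algebraType C * U => g z.1 z.2).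
Hypothesis mc : mx_measurable (fun w : g_sigma_algebraType C => c w).
Hypothesis gc : forall w a b, (\int[D]_x (g w x a b)%:E = (c w a b)%:E)%E.
Hypothesis gq : forall w, (\int[D]_x (fnorm (g w x - c w) ^+ 2)%:E <= q%:E)%E.

Let S p w := \sum_(j < p) (g w (xi j w) - c w).

Let mid p : measurable_fun setT
  (fun w : g_sigma_algebraType (rect p) => w : g_sigma_algebraType C).
Proof. by move=> _ A mA; rewrite setTI; apply: sub_sigma_algebra; exact: rect_past. Qed.

Let mS p : mx_measurable (fun w : g_sigma_algebraType (rect p) => S p w).
Proof.
apply: mx_measurable_sum => j; apply: mx_measurableB; last first.
  by move=> a b; exact: measurableT_comp (mc a b) (@mid p).
have mj : measurable_fun setT (fun w : g_sigma_algebraType (rect p) => xi j w).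
  by move=> _ B mB; rewrite setTI; apply: sub_sigma_algebra; exact: rect_sample.
move=> a b; exact: measurableT_comp (mg a b) (measurable_fun_pair (@mid p) mj).
Qed.

(** Induction on the number of samples. Sample [xi p] is independent of the past together with the
    samples before it, which determine [S p]; Tonelli's theorem freezes these, and the new centred
    term adds at most [q]. *)
Lemma sample_sum_second_moment p : (p <= m)%N ->
  (\int[P]_w (fnorm (S p w) ^+ 2)%:E <= (p%:R * q)%:E)%E.
Proof.
elim: p => [_|p IH pm].
  under eq_integral do rewrite /S big_ord0 fnorm0 expr0n /=.
  by rewrite integral0 mul0r.
pose phi (z : g_sigma_algebraType (rect p) * U) :=
  (fnorm (S p z.1 + (g z.1 z.2 - c z.1)) ^+ 2)%:E.
have mphi : measurable_fun setT phi.
  apply/measurable_EFinP; apply: measurable_fnorm2; apply: mx_measurableD.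
    by move=> a b; exact: measurableT_comp (@mS p a b) measurable_fst.
  have m1 : measurable_fun setT
      (fun z : g_sigma_algebraType (rect p) * U => z.1 : g_sigma_algebraType C).
    exact: measurableT_comp (@mid p) measurable_fst.
  apply: mx_measurableB => a b; last exact: measurableT_comp (mc a b) m1.
  exact: measurableT_comp (mg a b) (measurable_fun_pair m1 measurable_snd).
have phi0 z : (0 <= phi z)%E by rewrite lee_fin sqr_ge0.
have hr := indep_sigma (rect_measurable (p := p)) (rect_setI (p := p)) (rect_past p CT)
  (mxi p) (fun E B => rect_indep pm).
have := indep_integral (rect_measurable (p := p)) (mxi p) hr mphi phi0.
rewrite [X in X = _](_ : _ = \int[P]_w (fnorm (S p.+1 w) ^+ 2)%:E)%E; last first.
  by apply: eq_integral => w _; rewrite /phi /S big_ord_recr.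
move=> ->.
have mSp : measurable_fun setT (fun w => fnorm (S p w) ^+ 2).
  by apply: measurable_fnorm2 => a b; exact: (measurable_fun_sub (rect_measurable (p := p)) (@mS p a b)).
have [s /andP[s0 sp] hs] := has_mean_ge0 mSp (fun w => sqr_ge0 _) (IH (ltnW pm)).
have mF : measurable_fun setT (fubini_F D phi) by exact: measurable_fun_fubini_tonelli_F.
have mI : measurable_fun setT (fubini_F D phi : T -> \bar R).
  exact: (measurable_fun_sub (rect_measurable (p := p)) mF).
apply: (@le_trans _ _ (\int[P]_w (fnorm (S p w) ^+ 2 + q)%:E)%E).
  apply: ge0_le_integral => //.
  - by move=> w _; exact: integral_ge0.
  - by apply/measurable_EFinP; apply: measurable_funD.
  move=> w _.
  have mw : measurable_fun setT (fun x : U => (w : g_sigma_algebraType C, x)).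
    exact: measurable_fun_pair.
  have mgw : mx_measurable (g w) by move=> a b; exact: measurableT_comp (@mg a b) mw.
  exact: (centered_second_moment (S p w) mgw (gc w) (gq w)).
under eq_integral do rewrite addrC.
have [_ ->] := has_meanD (has_mean_cst P q) hs.
by rewrite lee_fin -natr1 mulrDl mul1r addrC lerD2r.
Qed.

End SampleSum.

(** * The iterates as random variables *)

Section Iterates.
Variables (R : realType) (N n r : nat) (dXi dOm : measure_display).
Variables (Xi : 'I_N -> measurableType dXi) (D : forall i, probability (Xi i) R).
Variables (Om : measurableType dOm) (P : probability Om R).
Variables (f_ : 'I_N -> 'M[R]_(n, r) -> R).
Variables (G : forall i, 'M[R]_(n, r) -> Xi i -> 'M[R]_(n, r)).
Variables (xi : forall i : 'I_N, nat -> nat -> {RV P >-> Xi i}).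
Variables (Nk : nat -> nat) (W : 'M[R]_N) (t : nat) (alpha beta : R).
Variables (X0 : 'I_N -> 'M[R]_(n, r)) (L sigma : R).
Hypothesis hL : forall i X Y, fnorm (egrad (f_ i) X - egrad (f_ i) Y) <= L * fnorm (X - Y).
Hypothesis hGmeas : oracle_measurable G.
Hypothesis hGtan : oracle_tangent G.
Hypothesis hGmean : oracle_unbiased D f_ G.
Hypothesis hGvar : oracle_variance D f_ G sigma.
Hypothesis hNk : forall k, (0 < Nk k)%N.
Hypothesis hlaw : samples_law D xi Nk.
Hypothesis hind : samples_independent xi Nk.
Hypothesis hX0 : stiefelN X0.
Hypothesis N0 : (0 < N)%N.

Let X w k := iter_X G xi Nk W t alpha beta X0 w k.
Let Y w k := iter_Y G xi Nk W t alpha beta X0 w k.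

Definition past_gen k : set (set Om) :=
  [set E | exists i l j (B : set (Xi i)),
     [/\ (l < k)%N, (j < Nk l)%N, measurable B & E = xi i l j @^-1` B]].

Lemma past_gen_measurable k : past_gen k `<=` measurable.
Proof.
move=> _ [i [l [j [B [_ _ mB ->]]]]].
by rewrite -[X in measurable X]setTI; exact: measurable_funP.
Qed.

Lemma past_gen_mono k k' : (k <= k')%N -> past_gen k `<=` past_gen k'.
Proof.
move=> kk' _ [i [l [j [B [lk jl mB ->]]]]]; exists i, l, j, B; split => //.
exact: leq_trans kk'.
Qed.

Lemma past_id_measurable k k' : (k <= k')%N -> measurable_fun setT
  (fun w : g_sigma_algebraType (past_gen k') => w : g_sigma_algebraType (past_gen k)).
Proof.
move=> kk' _ A mA; rewrite setTI; move: A mA; apply: smallest_sub.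
  exact: smallest_sigma_algebra.
by move=> A hA; apply: sub_sigma_algebra; exact: past_gen_mono hA.
Qed.

Lemma past_mx_mono k k' p q (Z : Om -> 'M[R]_(p, q)) : (k <= k')%N ->
  mx_measurable (fun w : g_sigma_algebraType (past_gen k) => Z w) ->
  mx_measurable (fun w : g_sigma_algebraType (past_gen k') => Z w).
Proof.
move=> kk' mZ a b; exact: measurableT_comp (@mZ a b) (@past_id_measurable _ _ kk').
Qed.

(** The oracle is measurable only over the manifold, so the random point is required to stay on it
    for every outcome. *)
Lemma oracle_comp_measurable d (T : measurableType d) i (Z : T -> 'M[R]_(n, r))
    (y : T -> Xi i) : mx_measurable Z -> (forall w, stiefel (Z w)) -> measurable_fun setT y ->
  mx_measurable (fun w => G (Z w) (y w)).
Proof.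
move=> mZ sZ my a b.
have mp : measurable_fun setT (fun w => (Z w : borel_mx R n r, y w)).
  by apply: measurable_fun_pair => //; exact: borel_mx_measurable.
apply: (measurable_comp _ _ (@hGmeas i a b) mp).
  by apply: measurableX => //; exact: stiefel_measurable.
by move=> _ [w _ <-]; split => //; exact: sZ.
Qed.

Lemma batch_measurable k i (Z : Om -> 'M[R]_(n, r)) :
  mx_measurable (fun w : g_sigma_algebraType (past_gen k) => Z w) ->
  (forall w, stiefel (Z w)) ->
  mx_measurable (fun w : g_sigma_algebraType (past_gen k.+1) => batch_grad G xi Nk w k i (Z w)).
Proof.
move=> mZ sZ; apply: mx_measurableZ; apply: mx_measurable_sum => j.
apply: oracle_comp_measurable => //; first exact: past_mx_mono mZ.
move=> _ B mB; rewrite setTI; apply: sub_sigma_algebra.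
by exists i, k, j, B; split.
Qed.

Lemma iter_XS w k i : X w k.+1 i = next_X W t alpha beta (X w k) (Y w k) i.
Proof. by rewrite /X /Y /iter_X /iter_Y /=; case: (iterates _ _ _ _ _ _ _ _ _ k). Qed.

Lemma iter_YS w k i : Y w k.+1 i = \sum_j (W ^+ t) i j *: Y w k j
  + batch_grad G xi Nk w k.+1 i (X w k.+1 i) - batch_grad G xi Nk w k i (X w k i).
Proof. by rewrite /X /Y /iter_X /iter_Y /=; case: (iterates _ _ _ _ _ _ _ _ _ k). Qed.

Lemma iter_stiefel w k i : stiefel (X w k i).
Proof.
elim: k i => [|k IH] i; first exact: hX0.
rewrite iter_XS; apply: polar_stiefel => //.
by apply: tangentB; apply: tangentZ; exact: proj_tangent_tangent.
Qed.

(** The shift in the index matters: [X] at step [k] uses samples of earlier steps only, which makes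
    it independent of batch [k], while [Y] at step [k] already uses that batch. *)
Lemma iter_measurable k :
  (forall i, mx_measurable (fun w : g_sigma_algebraType (past_gen k) => X w k i)) /\
  (forall i, mx_measurable (fun w : g_sigma_algebraType (past_gen k.+1) => Y w k i)).
Proof.
elim: k => [|k [IX IY]].
  split => i; first exact: mx_measurable_cst.
  by apply: batch_measurable => //; exact: mx_measurable_cst.
have mX i : mx_measurable (fun w : g_sigma_algebraType (past_gen k.+1) => X w k i).
  exact: past_mx_mono (IX i).
have mX' i : mx_measurable (fun w : g_sigma_algebraType (past_gen k.+1) => X w k.+1 i).
  under eq_fun do rewrite iter_XS.
  apply: mx_measurable_polar => //; apply: mx_measurableB; apply: mx_measurableZ;
    apply: mx_measurable_proj => //.
  by apply: mx_measurable_sum => j; exact: mx_measurableZ.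
split => // i; under eq_fun do rewrite iter_YS.
apply: mx_measurableB; last first.
  by apply: (@past_mx_mono k.+1) => //; apply: batch_measurable => // w; exact: iter_stiefel.
apply: mx_measurableD; last by apply: batch_measurable => // w; exact: iter_stiefel.
by apply: mx_measurable_sum => j; apply: mx_measurableZ; exact: past_mx_mono (IY j).
Qed.

Lemma rgrad_measurable d (T : measurableType d) i (Z : T -> 'M[R]_(n, r)) :
  mx_measurable Z -> mx_measurable (fun w => rgrad (f_ i) (Z w)).
Proof.
move=> mZ; apply: mx_measurable_proj => //.
apply: (mx_measurable_comp (g := egrad (f_ i))) => //.
by apply: locally_lipschitz_continuous => v; exists L.
Qed.

Lemma noise_measurable k i : mx_measurable
  (fun w => batch_grad G xi Nk w k i (X w k i) - rgrad (f_ i) (X w k i)).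
Proof.
have [mX _] := iter_measurable k.
suff mZ : mx_measurable (fun w : g_sigma_algebraType (past_gen k.+1) =>
    batch_grad G xi Nk w k i (X w k i) - rgrad (f_ i) (X w k i)).
  by move=> a b; exact: (measurable_fun_sub (@past_gen_measurable k.+1) (@mZ a b)).
apply: mx_measurableB; first by apply: batch_measurable => // w; exact: iter_stiefel.
by apply: rgrad_measurable; exact: past_mx_mono (mX i).
Qed.

(** Given the past, the point is fixed and the samples are centred and independent, so the squared
    sum of deviations has mean at most [Nk k] times [sigma ^+ 2]; averaging divides by the square of
    [Nk k]. *)
Lemma batch_variance k i :
  (\int[P]_w (fnorm (batch_grad G xi Nk w k i (X w k i) - rgrad (f_ i) (X w k i)) ^+ 2)%:E
    <= (sigma ^+ 2 / (Nk k)%:R)%:E)%E.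
Proof.
have [mX _] := iter_measurable k.
have hI (E : set Om) (B : nat -> set (Xi i)) : <<s past_gen k >> E ->
    (forall j, measurable (B j)) ->
    P (E `&` \bigcap_(j in `I_(Nk k)) (xi i k j @^-1` B j))
    = (P E * \prod_(j < Nk k) D i (B j))%E.
  move=> hE mB; rewrite hind //; congr (_ * _)%E.
  by apply: eq_bigr => j _; exact: hlaw.
have mg : mx_measurable (fun z : g_sigma_algebraType (past_gen k) * Xi i => G (X z.1 k i) z.2).
  apply: oracle_comp_measurable.
  - by move=> a b; exact: measurableT_comp (@mX i a b) measurable_fst.
  - by move=> w; exact: iter_stiefel.
  - exact: measurable_snd.
have mc : mx_measurable (fun w : g_sigma_algebraType (past_gen k) => rgrad (f_ i) (X w k i)).
  exact: rgrad_measurable.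
have hm w a b : (\int[D i]_x (G (X w k i) x a b)%:E = (rgrad (f_ i) (X w k i) a b)%:E)%E.
  by rewrite -(hGmean i (iter_stiefel w k i)) unlock.
have hv w : (\int[D i]_x (fnorm (G (X w k i) x - rgrad (f_ i) (X w k i)) ^+ 2)%:E
    <= (sigma ^+ 2)%:E)%E.
  by have := hGvar i (iter_stiefel w k i); rewrite unlock.
have mxi j : measurable_fun setT (xi i k j) by exact: measurable_funP.
have hS := sample_sum_second_moment (@past_gen_measurable k) mxi hI mg mc hm hv (leqnn (Nk k)).
have Nk0 : (Nk k)%:R != 0 :> R by rewrite pnatr_eq0 -lt0n.
have SE w : \sum_(j < Nk k) (G (X w k i) (xi i k j w) - rgrad (f_ i) (X w k i)) =
    (Nk k)%:R *: (batch_grad G xi Nk w k i (X w k i) - rgrad (f_ i) (X w k i)).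
  rewrite sumrB sumr_const card_ord scalerBr /batch_grad scalerA divff // scale1r.
  by rewrite scaler_nat.
have mS : measurable_fun setT (fun w => fnorm (\sum_(j < Nk k)
    (G (X w k i) (xi i k j w) - rgrad (f_ i) (X w k i))) ^+ 2).
  under eq_fun do rewrite SE.
  by apply: measurable_fnorm2; apply: mx_measurableZ; exact: noise_measurable.
have [c /andP[_ cq] hc] := has_mean_ge0 mS (fun w => sqr_ge0 _) hS.
have [_] := has_meanZ ((Nk k)%:R^-1 ^+ 2) hc.
under eq_integral do rewrite SE fnormZ exprMn mulrA -exprMn ger0_norm // mulVf // expr1n mul1r.
move=> ->; rewrite lee_fin (le_trans (ler_wpM2l _ cq)) ?sqr_ge0 //.
by rewrite expr2 -mulrA mulKf // mulrC.
Qed.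

Let F w k i := batch_grad G xi Nk w k i (X w k i).

Lemma noise_mean k : exists2 b, 0 <= b <= sigma ^+ 2 / (Nk k)%:R &
  has_mean P (fun w => traj_noise f_ (X w) (F w) k) b.
Proof.
have /choice[c hc] : forall i, exists c, (0 <= c <= sigma ^+ 2 / (Nk k)%:R) /\
    has_mean P (fun w => fnorm (F w k i - rgrad (f_ i) (X w k i)) ^+ 2) c.
  move=> i; have mn := measurable_fnorm2 (noise_measurable k i).
  by have [c h1 h2] := has_mean_ge0 mn (fun w => sqr_ge0 _) (batch_variance k i); exists c.
exists (avg c); last by apply: has_meanZ; apply: has_mean_sum => i; have [] := hc i.
rewrite avg_ge0 => [|i]; last by have [/andP[]] := hc i.
rewrite -(avg_const (sigma ^+ 2 / (Nk k)%:R) N0) avg_le // => i.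
by have [/andP[]] := hc i.
Qed.

(** [Gamma3] reads this expectation through [fine], which would return 0 for an infinite value.
    Finiteness follows by domination, from the noise at step 0 and the deterministic initial
    gradients. *)
Lemma track_mean : exists c,
  has_mean P (fun w => stack_sqdist (Y w 0) (stack_mean (F w 0))) c.
Proof.
have mF i : mx_measurable (fun w => F w 0 i).
  have mZ : mx_measurable (fun w : g_sigma_algebraType (past_gen 1) => F w 0 i).
    by apply: batch_measurable => [|w]; [exact: mx_measurable_cst|exact: hX0].
  by move=> a b; exact: (measurable_fun_sub (@past_gen_measurable 1) (@mZ a b)).
have mS : measurable_fun setT (fun w => stack_sqdist (Y w 0) (stack_mean (F w 0))).
  apply: measurable_sum => i; apply: measurable_fnorm2; apply: mx_measurableB; first exact: mF.
  by apply: mx_measurableZ; apply: mx_measurable_sum => j; exact: mF.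
have [b _ hb] := noise_mean 0.
apply: (has_mean_dominated mS _ (has_meanZ N%:R (has_meanD (has_meanZ 2 hb)
  (has_mean_cst P (2 * avg (fun i => fnorm (rgrad (f_ i) (X0 i)) ^+ 2)))))).
move=> w; rewrite ger0_norm; last by apply: sumr_ge0 => i _; exact: sqr_ge0.
have NN : N%:R != 0 :> R by rewrite pnatr_eq0 -lt0n.
have -> : stack_sqdist (Y w 0) (stack_mean (F w 0)) =
    N%:R * avg (fun i => fnorm (F w 0 i - stack_mean (F w 0)) ^+ 2).
  by rewrite /avg mulVKf.
rewrite ler_pM2l ?ltr0n //.
have := avg_dev (F w 0) N0; have := sqr_ge0 (fnorm (stack_mean (F w 0))).
have h : avg (fun i => fnorm (F w 0 i) ^+ 2) <=
    2 * traj_noise f_ (X w) (F w) 0 + 2 * avg (fun i => fnorm (rgrad (f_ i) (X0 i)) ^+ 2).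
  rewrite -!avgZ -avgD; apply: avg_le => i.
  by rewrite -{1}(subrK (rgrad (f_ i) (X0 i)) (F w 0 i)); exact: fnorm2D_le.
by move=> h1 h2; lra.
Qed.

Lemma budget_mean D' Xh fmin : exists nb c, [/\ forall k, 0 <= nb k <= sigma ^+ 2 / (Nk k)%:R,
  has_mean P (fun w => stack_sqdist (Y w 0) (stack_mean (F w 0))) c &
  forall K, has_mean P (fun w => traj_budget f_ alpha beta D' Xh (X w) (Y w) (F w) fmin K)
    (avg (fun i => f_ i (Xh X0)) - fmin + 4 / 5 * (beta * (N%:R^-1 * c)) +
     300 * (D' / alpha * avg (fun i => fnorm (X0 i - Xh X0) ^+ 2)) +
     11 * (beta * \sum_(k < K.+1) nb k))].
Proof.
have /choice[nb hnb] : forall k, exists b, (0 <= b <= sigma ^+ 2 / (Nk k)%:R) /\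
    has_mean P (fun w => traj_noise f_ (X w) (F w) k) b.
  by move=> k; have [b] := noise_mean k; exists b.
have [c hc] := track_mean; exists nb, c; split => // [k|K]; first by have [] := hnb k.
apply: has_meanD; last first.
  by do 2 apply: has_meanZ; apply: has_mean_sum => k; have [] := hnb k.
apply: has_meanD; last first.
  exact: (has_mean_cst P (300 * (D' / alpha * avg (fun i => fnorm (X0 i - Xh X0) ^+ 2)))).
apply: has_meanD; first exact: (has_mean_cst P (avg (fun i => f_ i (Xh X0)) - fmin)).
by do 2 apply: has_meanZ; exact: has_meanZ.
Qed.

End Iterates.

(** * The constants of the theorem *)

Section Constants.
Variable R : realType.

(** Used with [u = alpha * Lt]. As [Phi <= 2], [rho ^+ 2] is at least [(1 - u) ^+ 2], hence
    [1 - rho <= u]; and [1 - rho ^+ 2 = u * (Phi - u)] is at most [2 * u]. *)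
Lemma contraction_factor (u Phi rho : R) : 0 < u -> u <= Phi -> Phi <= 2 ->
  rho = Num.sqrt (1 - (u * Phi - u ^+ 2)) -> rho < 1 ->
  [/\ 2 <= 2 / (1 - rho) ^+ 2, 2 / u ^+ 2 <= 2 / (1 - rho) ^+ 2 &
      u^-1 <= 2 / (1 - rho ^+ 2)].
Proof.
move=> u0 uP P2 rE r1.
have h : (1 - u) ^+ 2 <= 1 - (u * Phi - u ^+ 2) by nra.
have r0 : 0 <= rho by rewrite rE sqrtr_ge0.
have r2 : rho ^+ 2 = 1 - (u * Phi - u ^+ 2).
  by rewrite rE sqr_sqrtr // (le_trans _ h) // sqr_ge0.
have ur : 1 - u <= rho.
  by rewrite (le_trans (ler_norm _)) // -sqrtr_sqr rE ler_wsqrtr.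
have q0 : 0 < (1 - rho) ^+ 2 by rewrite exprn_gt0 // subr_gt0.
split.
- by rewrite ler_pdivlMr //; nra.
- by rewrite ler_pM2l // lef_pV2 ?posrE ?exprn_gt0 //; nra.
have w0 : 0 < 1 - rho ^+ 2 by nra.
rewrite ler_pdivlMr // mulrC ler_pdivrMr // r2; nra.
Qed.

(** A positive step size below an inverse forces the denominator to be positive, in particular
    excluding [0^-1 = 0]. *)
Lemma inv_bound (x q : R) : 0 < x -> x <= q^-1 -> 0 < q /\ x * q <= 1.
Proof.
move=> x0 xq; have q0 : 0 < q by rewrite -invr_gt0 (lt_le_trans x0).
by split => //; rewrite -ler_pdivlMr // div1r.
Qed.

(* The bound on [d1] comes from [D4 * G0], as [D4] has [be ^+ 2] in its denominator. *)
Lemma radius_bound (al be LG d1 rr G0 D4 D2 D1 Q : R) :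
  0 < al -> 0 < be -> 0 < LG -> 0 < d1 -> 1 <= rr -> 2 <= G0 ->
  D4 = 4 * rr * d1 ^+ 2 / (be ^+ 2 * LG) -> D4 <= D2 -> 0 <= D1 -> 0 <= Q ->
  be * (4 * (Q + 2 * (D2 * G0 + D4 * G0 + D1))) <= 1 ->
  be * LG <= al * d1 / 5 -> d1 <= al / 640.
Proof.
move=> al0 be0 LG0 d0 rr1 G2 D4E D42 D10 Q0 hb hL.
have D4q : D4 * be ^+ 2 * LG = 4 * rr * d1 ^+ 2.
  by rewrite D4E -mulrA mulfVK // gt_eqF // mulr_gt0 // exprn_gt0.
have D4p : 0 <= D4 by rewrite D4E !mulr_ge0 ?invr_ge0 ?mulr_ge0 ?sqr_ge0 ?ltW // (lt_le_trans ltr01).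
have h1 : 32 * (be * D4) <= 1.
  have h2 : 2 * D4 <= D2 * G0 by nra.
  have h3 : 2 * D4 <= D4 * G0 by nra.
  have h4 : be * D4 * 32 <= be * (4 * (Q + 2 * (D2 * G0 + D4 * G0 + D1))).
    rewrite -mulrA ler_wpM2l ?(ltW be0) //; lra.
  lra.
have h5 : 128 * d1 ^+ 2 <= be * LG.
  have h6 : 32 * (D4 * be ^+ 2 * LG) <= be * LG.
    have -> : 32 * (D4 * be ^+ 2 * LG) = 32 * (be * D4) * (be * LG) by ring.
    by rewrite ler_piMl // mulr_ge0 ?ltW.
  have := ler_wpM2r (sqr_ge0 d1) rr1; lra.
have h7 : d1 * (128 * d1) <= d1 * (al / 5).
  have -> : d1 * (128 * d1) = 128 * d1 ^+ 2 by ring.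
  apply: (le_trans h5); lra.
by rewrite ler_pM2l // in h7; lra.
Qed.

Lemma betabar_bound (al be A LG d1 : R) : 0 <= A -> 0 < LG ->
  be <= al * d1 / (5 * (10 * A + LG)) -> 0 < be ->
  be * LG <= al * d1 / 5 /\ 50 * (be * A) <= al * d1.
Proof.
move=> A0 LG0 h b0.
have {}h : be * (5 * (10 * A + LG)) <= al * d1 by rewrite -ler_pdivlMr //; lra.
have h1 : 0 <= be * A by rewrite mulr_ge0 // ltW.
have h2 : 0 < be * LG by rewrite mulr_gt0.
have -> : be * LG = be * (5 * (10 * A + LG)) / 5 - 10 * (be * A) by field.
by split; lra.
Qed.

(** The missing factor 2 comes from [N >= 2], since [Gamma1] contains the unaveraged sum of squares;
    then [10 / 7 <= 2 / Lt] as [Lt <= 19 / 14]. *)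
Lemma cons_constant (N a0 al Lt v Ga S : R) : 0 < al -> 0 < Lt -> Lt <= 19 / 14 ->
  (al * Lt)^-1 <= v -> 0 <= a0 -> 2 <= N -> S = N * a0 -> Ga = v * S ->
  10 / 7 / al * a0 <= Ga.
Proof.
move=> al0 Lt0 LtB hv a00 N2 -> ->.
have h : 10 / 7 / al <= 2 * (al * Lt)^-1.
  rewrite ler_pdivrMr // invfM mulrA mulrAC mulfVK ?gt_eqF //.
  rewrite ler_pdivlMr //; lra.
have i0 : 0 <= (al * Lt)^-1 by rewrite invr_ge0 mulr_ge0 ?ltW.
apply: (le_trans (ler_wpM2r a00 h)); rewrite mulrA ler_wpM2r //.
rewrite mulrC; apply: ler_pM => //.
Qed.

Lemma grad_constant (be al Lt G0 : R) : 0 < be -> 0 < al -> 0 < Lt -> Lt <= 19 / 14 ->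
  2 / (al * Lt) ^+ 2 <= G0 -> 77 / 10 * (be / al ^+ 2) <= 8 * be * G0.
Proof.
move=> be0 al0 Lt0 LtB hG.
have L2 : Lt ^+ 2 <= 2.
  have := ler_pM (ltW Lt0) (ltW Lt0) LtB LtB; rewrite -expr2; lra.
have h : 77 / 10 / al ^+ 2 <= 8 * (2 / (al * Lt) ^+ 2).
  rewrite exprMn ler_pdivrMr ?exprn_gt0 // invfM.
  have -> : 8 * (2 * (al ^- 2 * Lt ^- 2)) * al ^+ 2 = 16 / Lt ^+ 2 by field; rewrite !gt_eqF.
  rewrite ler_pdivlMr ?exprn_gt0 //; lra.
have -> : 77 / 10 * (be / al ^+ 2) = be * (77 / 10 / al ^+ 2) by ring.
have -> : 8 * be * G0 = be * (8 * G0) by ring.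
by rewrite ler_wpM2l ?(ltW be0) //; lra.
Qed.

(** [D4] equals [4 * rr * D / (be * LG)], hence is at least [400 * D], and [10 / 7 * 400] exceeds
    300. *)
Lemma offset_constant (al be LG d1 rr G0 D4 D2 Ga a0 D : R) :
  0 < al -> 0 < be -> 0 < LG -> 1 <= rr -> 0 <= G0 -> 0 <= a0 -> 0 <= D2 ->
  be * LG <= 100^-1 -> D * be = d1 ^+ 2 -> D4 = 4 * rr * d1 ^+ 2 / (be ^+ 2 * LG) ->
  10 / 7 / al * a0 <= Ga ->
  300 * (D / al * a0) <= D4 * G0 * al ^+ 2 * d1 ^+ 2 / 25 + Ga * (D2 + D4).
Proof.
move=> al0 be0 LG0 rr1 G00 a00 D20 bL DE D4E hGa.
have D0 : 0 <= D by rewrite -(pmulr_lge0 D be0) DE sqr_ge0.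
have q0 : 0 < be * LG by rewrite mulr_gt0.
have D4q : D4 * (be * LG) = 4 * rr * D.
  by rewrite D4E -DE; field; rewrite !gt_eqF.
have D40 : 0 <= D4.
  rewrite -(pmulr_lge0 D4 q0) D4q; apply: mulr_ge0 => //; lra.
have D4D : 400 * D <= D4.
  have h1 := ler_wpM2l D40 bL; rewrite D4q in h1.
  have h2 := ler_wpM2r D0 rr1; lra.
have g0 : 0 <= 10 / 7 / al * a0 by rewrite mulr_ge0 // divr_ge0 ?ltW //; lra.
have h1 : 0 <= D4 * G0 * al ^+ 2 * d1 ^+ 2 / 25.
  apply: divr_ge0 => //; apply: mulr_ge0; last exact: sqr_ge0.
  by apply: mulr_ge0; [exact: mulr_ge0|exact: sqr_ge0].
have h2 : 10 / 7 / al * a0 * (400 * D) <= Ga * (D2 + D4).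
  have E0 : 0 <= 400 * D by rewrite (mulr_ge0 (ler0n R 400) D0).
  have ED : 400 * D <= D2 + D4 by rewrite (le_trans D4D) // lerDr.
  exact: (ler_pM g0 E0 hGa ED).
have x0 : 0 <= D / al * a0 by rewrite mulr_ge0 // divr_ge0 // ltW.
have h3 : 10 / 7 / al * a0 * (400 * D) = 10 / 7 * (400 * (D / al * a0)) by ring.
rewrite h3 in h2; lra.
Qed.

(** [D3] is at least [1 / (2 * LG)], which is at least 50 times [be]. *)
Lemma noise_constant (be LG D3 : R) : 0 < be -> 0 < LG -> be * LG <= 100^-1 ->
  D3 = (1 + 4 * LG ^+ 2 * be ^+ 2) / (2 * LG) -> 11 * be <= D3.
Proof.
move=> be0 LG0 bL ->; rewrite ler_pdivlMr; last by lra.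
have := sqr_ge0 (LG * be); rewrite exprMn.
have -> : 11 * be * (2 * LG) = 22 * (be * LG) by ring.
by rewrite -mulrA; lra.
Qed.

Lemma sum_noise_le K (be sg2 G2 D3 : R) (nb : nat -> R) (Nk : nat -> nat) (c : nat -> R) :
  0 < be -> 11 * be <= D3 -> 0 <= G2 -> 0 <= sg2 ->
  (forall k, 0 <= nb k <= sg2 / (Nk k)%:R) -> (forall k, D3 <= c k) ->
  11 * (be * \sum_(k < K.+1) nb k) <=
  sg2 * \sum_(k < K.+1) (c k / (Nk k)%:R + 2 * be * G2 / (Nk k.+1)%:R).
Proof.
move=> be0 D3b G20 s0 hnb hc; rewrite !mulr_sumr; apply: ler_sum => k _.
have [_ h1] := andP (hnb k); have h2 : 0 <= (Nk k)%:R^-1 :> R by rewrite invr_ge0.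
have h3 : 0 <= 2 * be * G2 / (Nk k.+1)%:R by rewrite !mulr_ge0 ?invr_ge0 ?(ltW be0).
have h4 : 11 * (be * nb k) <= 11 * be * (sg2 / (Nk k)%:R).
  by rewrite mulrA ler_pM2l //; lra.
have h5 : 11 * be * (sg2 / (Nk k)%:R) <= c k * (sg2 / (Nk k)%:R).
  by rewrite ler_wpM2r ?mulr_ge0 // (le_trans D3b).
have h6 : 0 <= sg2 * (2 * be * G2 / (Nk k.+1)%:R) by rewrite mulr_ge0.
have -> : sg2 * (c k / (Nk k)%:R + 2 * be * G2 / (Nk k.+1)%:R) =
  c k * (sg2 / (Nk k)%:R) + sg2 * (2 * be * G2 / (Nk k.+1)%:R) by ring.
lra.
Qed.

Lemma tracking_constant (be y g E z C : R) : 0 <= be -> 0 <= y -> 0 <= E -> 2 * y <= g ->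
  z <= C -> 4 / 5 * (be * y) + z <= C + be / 2 * (g + E).
Proof.
move=> be0 y0 E0 yg zC; have := ler_wpM2l be0 yg; have := mulr_ge0 be0 E0.
have := mulr_ge0 be0 y0; have -> : be / 2 * (g + E) = (be * g + be * E) / 2 by ring.
by rewrite mulrCA; move: (be * y) (be * g) (be * E) => a b c; lra.
Qed.

End Constants.

(** * From the hypotheses on time and samples to the two rates *)

(** The logarithmic condition means that [s ^+ t] is at most the inverse of [2 * Num.sqrt N%:R]; the
    inequality turns because [ln s < 0]. For [s = 0], positivity of [t] suffices. *)
Lemma mixing_time (R : realType) (N t : nat) (s : R) : (0 < N)%N -> 0 <= s < 1 -> (0 < t)%N ->
  (s != 0 -> Num.ceil (ln (2 * Num.sqrt N%:R)^-1 / ln s) <= t%:Z) ->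
  4 * ((s ^+ t) ^+ 2 * N%:R) <= 1.
Proof.
move=> N0 /andP[s0 s1] t0 hs.
have [->|sn0] := eqVneq s 0; first by rewrite expr0n gtn_eqF // expr0n /= mul0r mulr0.
have {}s0 : 0 < s by rewrite lt_def sn0.
have q0 : 0 < 2 * Num.sqrt N%:R :> R by rewrite mulr_gt0 // sqrtr_gt0 ltr0n.
have := hs sn0; rewrite ceil_le_int ler_ndivrMr ?ln_lt0 ?s0 // => h.
have st : s ^+ t <= (2 * Num.sqrt N%:R)^-1.
  rewrite -ler_ln ?posrE ?exprn_gt0 ?invr_gt0 // lnXn //.
  by have <- : t%:Z%:~R * ln s = ln s *+ t by rewrite mulr_natl.
have -> : 4 * ((s ^+ t) ^+ 2 * N%:R) = (s ^+ t * (2 * Num.sqrt N%:R)) ^+ 2.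
  by rewrite !exprMn sqr_sqrtr //; ring.
by rewrite expr_le1 // ?mulr_ge0 ?exprn_ge0 ?(ltW s0) ?(ltW q0) // -ler_pdivlMr // div1r.
Qed.

Lemma rgrad_mean (R : realType) (N n r : nat) (f_ : 'I_N -> 'M[R]_(n, r) -> R) X :
  (forall i Z, differentiable (f_ i) Z) ->
  rgrad (fun Z => N%:R^-1 * \sum_i f_ i Z) X = stack_mean (fun i => rgrad (f_ i) X).
Proof.
move=> df; have dv i (v : 'M[R]_(n, r)) : derivable (f_ i) X v by exact: diff_derivable.
rewrite /rgrad /stack_mean -proj_tangent_sum -proj_tangentZ; congr proj_tangent.
apply/matrixP => a b; rewrite !mxE summxE.
have -> : (fun Z => N%:R^-1 * \sum_i f_ i Z) = N%:R^-1 \*: (\sum_i f_ i).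
  by apply/funext => Z; rewrite /= fct_sumE.
rewrite deriveZ; last exact: derivable_sum.
by rewrite derive_sum //; congr (_ * _); apply: eq_bigr => i _; rewrite mxE.
Qed.

(** The bound holds for all points at once off one null set of samples, so the random iterates need
    no further exception. There are countably many samples, enumerated through [pickle], and their
    exceptional events form a null set. *)
Lemma oracle_bounded_samples (R : realType) (N n r : nat) (dXi dOm : measure_display)
  (Xi : 'I_N -> measurableType dXi) (D : forall i, probability (Xi i) R)
  (Om : measurableType dOm) (P : probability Om R)
  (G : forall i, 'M[R]_(n, r) -> Xi i -> 'M[R]_(n, r))
  (xi : forall i : 'I_N, nat -> nat -> {RV P >-> Xi i}) (Nk : nat -> nat) (A1 : R) :
  oracle_bounded D G A1 -> samples_law D xi Nk ->
  exists Z : set Om, [/\ measurable Z, P Z = 0%E & forall w, ~ Z w ->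
    forall i k j X, (j < Nk k)%N -> stiefel X -> fnorm (G i X (xi i k j w)) <= A1].
Proof.
move=> hb hlaw.
have /(fun h i => cid (h i)) hc : forall i, exists B, [/\ measurable B, D i B = 0%E &
    forall x, ~ B x -> forall X, stiefel X -> fnorm (G i X x) <= A1].
  move=> i; have [B [mB B0 hB]] := hb i; exists B; split => // x nBx X hX.
  by apply: contrapT => h; apply: nBx; apply: hB => /= h'; exact/h/h'.
pose B i := sval (hc i); have hB i := svalP (hc i).
pose F m : set Om := if unpickle m is Some (i, k, j) then
  if (j < Nk k)%N then xi i k j @^-1` B i else set0 else set0.
have nF m : P.-negligible (F m).
  rewrite /F; case: unpickle => [[[i k] j]|]; last exact: negligible_set0.
  case: ifP => jN; last exact: negligible_set0.
  have [mB B0 _] := hB i; exists (xi i k j @^-1` B i); split => //.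
    by rewrite -[X in measurable X]setTI; exact: measurable_funP.
  by rewrite hlaw.
have [Z [mZ Z0 hZ]] := negligible_bigcup nF.
exists Z; split => // w nZ i k j X jN hX.
have [_ _] := hB i; apply => // Bw; apply/nZ/hZ; exists (pickle (i, k, j)) => //.
by rewrite /F pickleK jN.
Qed.

Theorem theorem1 (R : realType) (N n r : nat)
  (hN : (1 < N)%N) (hr : (0 < r)%N) (hrn : (r <= n)%N)
  (* retraction constant *)
  (M : R) (hM0 : 0 < M)
  (hM : forall X v : 'M[R]_(n, r), stiefel X -> tangent X v ->
     fnorm (polar_retraction X v - (X + v)) <= M * fnorm v ^+ 2)
  (* induced arithmetic mean *)
  (Xhat : ('I_N -> 'M[R]_(n, r)) -> 'M[R]_(n, r)) (hXhat : iam_selection Xhat)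
  (* objective *)
  (dXi : measure_display) (Xi : 'I_N -> measurableType dXi)
  (D : forall i, probability (Xi i) R)
  (Fobj : forall i, 'M[R]_(n, r) -> Xi i -> R)
  (f_ : 'I_N -> 'M[R]_(n, r) -> R)
  (hFobj : forall i X, (D i).-integrable setT (fun xi => (Fobj i X xi)%:E))
  (hf_ : forall i X, (f_ i X)%:E = 'E_(D i)[Fobj i X]%E)
  (hdiff : forall i X, differentiable (f_ i) X)
  (L : R)
  (hL : forall i X Y, fnorm (egrad (f_ i) X - egrad (f_ i) Y) <= L * fnorm (X - Y))
  (Ln : R)
  (hLn : maximum_of [set c | exists i X, stiefel X /\ c = opnorm2 (egrad (f_ i) X)] Ln)
  (fstar : R)
  (hfstar : minimum_of
     [set N%:R^-1 * (\sum_i f_ i X) | X in @stiefel R n r] fstar)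
  (* network *)
  (e : rel 'I_N) (he : connected_graph e)
  (W : 'M[R]_N) (hW : mixing_matrix e W)
  (svW : seq R) (hsvW : singular_values W svW)
  (t : nat) (lambda_min : R)
  (hlambda : minimum_of [set a | eigenvalue (W ^+ t) a] lambda_min)
  (* local region *)
  (delta1 delta2 Phi : R)
  (hd1 : 0 < delta1) (hd2 : 0 < delta2)
  (hd12 : delta1 <= (5 * Num.sqrt r%:R)^-1 * delta2) (hd26 : delta2 <= 6^-1)
  (hPhi1 : 1 <= Phi)
  (hPhi : forall X, local_region Xhat delta1 delta2 X ->
     forall i, Phi <= 2 - fnorm (X i - Xhat X) ^+ 2)
  (* stochastic oracle *)
  (G : forall i, 'M[R]_(n, r) -> Xi i -> 'M[R]_(n, r))
  (sigma A1 A2 : R)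
  (hGmeas : oracle_measurable G) (hGtan : oracle_tangent G)
  (hGmean : oracle_unbiased D f_ G) (hGvar : oracle_variance D f_ G sigma)
  (hGbnd : oracle_bounded D G A1)
  (hA2 : forall i X, stiefel X -> fnorm (egrad (f_ i) X) <= A2)
  (* sampling *)
  (dOm : measure_display) (Om : measurableType dOm) (P : probability Om R)
  (Nk : nat -> nat) (hNk : forall k, (0 < Nk k)%N)
  (xi : forall i : 'I_N, nat -> nat -> {RV P >-> Xi i})
  (hlaw : samples_law D xi Nk) (hind : samples_independent xi Nk)
  (* algorithm *)
  (X0 : 'I_N -> 'M[R]_(n, r)) (hX0 : local_region Xhat delta1 delta2 X0)
  (alpha beta : R) (halpha0 : 0 < alpha) (hbeta0 : 0 < beta) :
  let f := fun X => N%:R^-1 * (\sum_i f_ i X) in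
  let X := fun k w => iter_X G xi Nk W t alpha beta X0 w k in
  let Y := fun k w => iter_Y G xi Nk W t alpha beta X0 w k in
  let Fbar := fun k w => mean_batch_grad G xi Nk W t alpha beta X0 w k in
  let sigma2 := svW`_1 in
  let L_G := L + 2 * Ln in
  let Lt := 1 - lambda_min in
  let A := Num.max A1 A2 in
  let rho := Num.sqrt (1 - (alpha * Lt * Phi - alpha ^+ 2 * Lt ^+ 2)) in
  let Gamma0 := 2 / (1 - rho) ^+ 2 in
  let Gamma1 := 2 / (1 - rho ^+ 2) * stack_sqdist X0 (Xhat X0) in
  let Gamma2 := 2 / (1 - sigma2 ^+ t) ^+ 2 in
  let Gamma3 := 2 / (1 - sigma2 ^+ (2 * t))
    * (N%:R^-1 * fine 'E_P[fun w => stack_sqdist (Y 0%N w) (Fbar 0%N w)]%E) in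
  let D1 := (delta1 ^+ 2 + 5) * L_G + 2 * M * A in
  let D4 := 4 * r%:R * delta1 ^+ 2 / (beta ^+ 2 * L_G) in
  let Ctilde := delta2 ^+ 2 / r%:R in
  let D2 := 3 * L_G + 2 * alpha * A + 13 * L_G * Ctilde * alpha ^+ 2 + D4 in
  let D3 := (1 + 4 * L_G ^+ 2 * beta ^+ 2) / (2 * L_G) in
  let D3tilde := D3 + 5 * beta / 8 in
  let C0 := D4 * Gamma0 * alpha ^+ 2 * delta1 ^+ 2 / 25 + Gamma1 * (D2 + D4) in
  let C1 := D2 * Gamma0 + D4 * Gamma0 + D1 in
  let Gamma1tilde := 2 * L_G ^+ 2 * beta * Gamma1 in
  let Gamma3tilde := C0
    + beta / 2 * (Gamma3 + 16 * alpha ^+ 2 * L_G ^+ 2 * Gamma2 * Gamma1) in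
  let betabar := Num.min ((1 - rho) * delta1 / (10 * A + L_G))
                         (alpha * delta1 / (5 * (10 * A + L_G))) in
  (1 <= t)%N ->
  (sigma2 != 0 ->
     Num.ceil (ln (2 * Num.sqrt N%:R)^-1 / ln sigma2) <= t%:Z) ->
  alpha <= Num.min 1 (Num.min M^-1 (Phi / Lt)) ->
  beta <= Num.min betabar (Num.min (9 * L_G)^-1
    (4 * (alpha * delta1 * L_G * (16 * Gamma0 + Gamma2) + 2 * C1))^-1) ->
  forall K : nat,
  (\big[Order.min/+oo]_(k < K.+1)
      ((N%:R^-1)%:E * 'E_P[fun w => stack_sqdist (X k w) (Xhat (X k w))])
   <= ((8 * beta * Gamma0
        * (f (Xhat X0) - fstar + Gamma3tilde
           + sigma ^+ 2 * (\sum_(k < K.+1)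
               ((2 * Gamma2 * beta + D3 + beta / 2) / (Nk k)%:R
                + 2 * beta * Gamma2 / (Nk k.+1)%:R)))
        + Gamma1) / K.+1%:R)%:E)%E
  /\
  (\big[Order.min/+oo]_(k < K.+1)
      'E_P[fun w => (fnorm (rgrad f (Xhat (X k w))) ^+ 2)%R]
   <= ((Gamma1tilde
        + (16 + Gamma0 * alpha ^+ 2 * delta1 ^+ 2)
        * (f (Xhat X0) - fstar + Gamma3tilde
           + sigma ^+ 2 * (\sum_(k < K.+1)
               ((2 * beta * Gamma2 + D3tilde) / (Nk k)%:R
                + 2 * beta * Gamma2 / (Nk k.+1)%:R))))
       / (beta * K.+1%:R))%:E)%E.
Proof.
move=> f X Y Fbar sigma2 L_G Lt A rho Gamma0 Gamma1 Gamma2 Gamma3 D1 D4 Ctilde D2 D3 D3tilde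
  C0 C1 Gamma1tilde Gamma3tilde betabar t1 ht halpha hbeta K.
have N0 : (0 < N)%N by exact: ltnW.
have N2 : 2 <= N%:R :> R by rewrite (ler_nat R 2).
have [X0S _ _] := hX0; pose i0 := Ordinal N0.
have sig := second_singular_lt1 hN he hW hsvW; rewrite -/sigma2 in sig.
have [sig0 sig1] := andP sig.
have hV := mixing_pow t hN he hW hsvW; rewrite -/sigma2 in hV.
have s0 : 0 <= sigma2 ^+ t by exact: exprn_ge0.
have sN : 4 * ((sigma2 ^+ t) ^+ 2 * N%:R) <= 1 by exact: mixing_time.
(* From [sN] and [N >= 2]. *)
have s2 : (sigma2 ^+ t) ^+ 2 <= 8^-1.
  have := sqr_ge0 (sigma2 ^+ t); move: sN N2; move: (_ ^+ 2) (N%:R) => x y; clear; nra.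
have [al1 alP] : alpha <= 1 /\ alpha <= Phi / Lt.
  by move: halpha; rewrite !le_min => /and3P[].
have [bb1 bb2 b9 bC] : [/\ beta <= (1 - rho) * delta1 / (10 * A + L_G),
    beta <= alpha * delta1 / (5 * (10 * A + L_G)), beta <= (9 * L_G)^-1 &
    beta <= (4 * (alpha * delta1 * L_G * (16 * Gamma0 + Gamma2) + 2 * C1))^-1].
  by move: hbeta; rewrite !le_min => /and3P[/andP[]].
have LG0 : 0 < L_G by have [h _] := inv_bound hbeta0 b9; lra.
have Phi2 : Phi <= 2.
  have := hPhi _ hX0 i0; have := sqr_ge0 (fnorm (X0 i0 - Xhat X0)); lra.
have Lt0 : 0 < Lt.
  by have := lt_le_trans halpha0 alP; rewrite pmulr_rgt0 ?invr_gt0 //; lra.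
(* As [Lt] is positive, the least eigenvalue is not 1, so it is at least [- sigma2 ^+ t], and
   [sigma2 ^+ t <= 5 / 14]. *)
have LtB : Lt <= 19 / 14.
  have [heig _] := hlambda; have [l1|ls] := consensus_eigenvalue hV heig.
    by move: Lt0; rewrite /Lt l1 subrr ltxx.
  have s5 : sigma2 ^+ t <= 5 / 14 by move: s0 s2; move: (sigma2 ^+ t) => x; clear; nra.
  by rewrite /Lt; lra.
have uP : alpha * Lt <= Phi by rewrite -ler_pdivlMr.
have u0 : 0 < alpha * Lt by exact: mulr_gt0.
have A0 : 0 <= A.
  by rewrite le_max (le_trans (fnorm_ge0 (egrad (f_ i0) (X0 i0))) (hA2 i0 _ (X0S i0))) orbT.
have q0 : 0 < 10 * A + L_G by lra.
(* Read off from the first bound in [betabar], which is positive because [beta] is. *)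
have rho1 : rho < 1.
  have := lt_le_trans hbeta0 bb1; rewrite pmulr_lgt0 ?invr_gt0 // pmulr_lgt0 // subr_gt0.
  by [].
have rhoE : rho = Num.sqrt (1 - (alpha * Lt * Phi - (alpha * Lt) ^+ 2)) by rewrite exprMn.
have [G2 Gu G1] := contraction_factor u0 uP Phi2 rhoE rho1.
rewrite -/Gamma0 in G2 Gu.
have [bL bA] := betabar_bound A0 LG0 bb2 hbeta0.
have rr1 : 1 <= r%:R :> R by rewrite (ler_nat R 1).
have [_ bC1] := inv_bound hbeta0 bC.
have D40 : 0 <= D4.
  by apply: divr_ge0; rewrite ?mulr_ge0 ?sqr_ge0 // ltW.
have [Ln0 hLn'] : 0 <= Ln /\ forall i Z, stiefel Z -> opnorm2 (egrad (f_ i) Z) <= Ln.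
  have [_ hub] := hLn; have h i Z : stiefel Z -> opnorm2 (egrad (f_ i) Z) <= Ln.
    by move=> hZ; apply: hub; exists i, Z.
  by split => //; apply: le_trans (h i0 _ (X0S i0)); exact: opnorm2_ge0.
have C0' : 0 <= Ctilde by rewrite divr_ge0 ?sqr_ge0.
have D42 : D4 <= D2.
  rewrite lerDr !addr_ge0 // ?mulr_ge0 ?sqr_ge0 // ?(ltW LG0) ?(ltW halpha0) ?(ltW hd2) //.
have D10 : 0 <= D1.
  by rewrite addr_ge0 ?mulr_ge0 ?(ltW LG0) ?(ltW hM0) // addr_ge0 ?sqr_ge0.
have Ga20 : 0 <= Gamma2 by rewrite divr_ge0 ?sqr_ge0.
have d1al : delta1 <= alpha / 640.
  apply: (radius_bound halpha0 hbeta0 LG0 hd1 rr1 G2 (erefl D4) D42 D10 _ bC1 bL).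
  by rewrite !mulr_ge0 ?(ltW halpha0) ?(ltW LG0) ?(ltW hd1) // addr_ge0 // mulr_ge0 // (le_trans _ G2).
have d12 : 5 * delta1 <= delta2.
  have r1 : 1 <= Num.sqrt r%:R :> R by rewrite -[X in X <= _]sqrtr1 ler_wsqrtr.
  have r5 : 0 < 5 * Num.sqrt r%:R :> R by move: r1; move: (Num.sqrt _) => x; clear; lra.
  have := hd12; rewrite [_^-1 * _]mulrC ler_pdivlMr //.
  have := ler_wpM2l (ltW hd1) r1; rewrite mulr1 mulrCA.
  by move: (delta1 * Num.sqrt _) => x; clear; lra.
have be100 : beta * L_G <= 100^-1.
  apply: (le_trans bL); have := ler_pM (ltW halpha0) (ltW hd1) al1 d1al.
  by move: al1; move: (alpha * delta1) (alpha) => y x; clear; lra.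
pose D' := delta1 ^+ 2 / beta.
have D'E : D' * beta = delta1 ^+ 2 by rewrite mulfVK // gt_eqF.
have fmin Z : stiefel Z -> fstar <= avg (fun i => f_ i Z).
  by move=> hZ; have [_] := hfstar; apply; exists Z.
pose F k w i := batch_grad G xi Nk w k i (X k w i).
have [Z [mZ PZ hZ]] := oracle_bounded_samples hGbnd hlaw.
have hA i Z' : stiefel Z' -> fnorm (egrad (f_ i) Z') <= A.
  by move=> h; rewrite le_max hA2 ?orbT.
have XS w k : X k.+1 w = fun i => polar_retraction (X k w i)
    (alpha *: cons_dir (X k w) (W ^+ t) i - beta *: proj_tangent (X k w i) (Y k w i)).
  by apply/funext => i; exact: iter_XS.
have YS w k i : Y k.+1 w i = mix (W ^+ t) (Y k w) i + F k.+1 w i - F k w i.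
  exact: iter_YS.
have Ft w k i : stiefel (X k w i) -> tangent (X k w i) (F k w i).
  move=> hX; apply: tangentZ.
  elim/big_ind: _ => [|x y|j _]; [| |exact: hGtan].
    by rewrite /tangent /= trmx0 mulmx0 mul0mx addr0.
  by move=> hx hy; exact: tangentD.
have FA w : ~ Z w -> forall k i, stiefel (X k w i) -> fnorm (F k w i) <= A.
  move=> nZ k i hX; rewrite /F /batch_grad fnormZ ger0_norm ?invr_ge0 //.
  rewrite mulrC ler_pdivrMr ?ltr0n //; apply: (le_trans (fnorm_sum _ _ _)).
  apply: (@le_trans _ _ (\sum_(j < Nk k) A)).
    apply: ler_sum => j _; rewrite le_max; apply/orP; left; exact: hZ.
  by rewrite sumr_const card_ord mulr_natr.
pose budget w := traj_budget f_ alpha beta D' Xhat (X^~ w) (Y^~ w) (F^~ w) fstar K.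
have grad_le w : ~ Z w ->
    beta * \sum_(k < K.+1) traj_grad f_ Xhat (X^~ w) k <= 3 * budget w.
  move=> nZ; exact: (traj_grad_le (X := X^~ w) (Y := Y^~ w) (F := F^~ w) N0 hV s2 sN
    hdiff hL hLn' Ln0 halpha0 al1 hbeta0 hd1 d12 hd26
    d1al bL bA LG0 A0 hA D'E hXhat hX0 (XS w) (fun=> erefl) (YS w) (Ft w) (FA w nZ) fmin K).
have cons_le w : ~ Z w -> \sum_(k < K.+1) traj_cons Xhat (X^~ w) k <=
    10 / 7 / alpha * traj_cons Xhat (X^~ w) 0 + 77 / 10 * (beta / alpha ^+ 2 * budget w).
  move=> nZ; exact: (traj_cons_le (X := X^~ w) (Y := Y^~ w) (F := F^~ w) N0 hV s2 sN
    hdiff hL hLn' Ln0 halpha0 al1 hbeta0 hd1 d12 hd26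
    d1al bL bA LG0 A0 hA D'E hXhat hX0 (XS w) (fun=> erefl) (YS w) (Ft w) (FA w nZ) fmin K).
have [nb [c [hnb hc hB]]] := budget_mean W t alpha beta hL hGmeas hGmean hGvar hNk hlaw hind
  X0S N0 D' Xhat fstar.
have {hB} := hB K; rewrite -/budget; set Bv := (X in has_mean _ _ X) => hB.
pose a0 := avg (fun i => fnorm (X0 i - Xhat X0) ^+ 2).
have a00 : 0 <= a0 by apply: avg_ge0 => i; exact: sqr_ge0.
have Nn0 : N%:R != 0 :> R by rewrite pnatr_eq0 -lt0n.
have S0E : stack_sqdist X0 (Xhat X0) = N%:R * a0 by rewrite /a0 /avg mulVKf.
have hGa1 : 10 / 7 / alpha * a0 <= Gamma1.
  exact: (cons_constant halpha0 Lt0 LtB G1 a00 N2 S0E (erefl Gamma1)).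
have c0 : 0 <= c.
  by apply: has_mean_nonneg hc => w; apply: sumr_ge0 => i _; exact: sqr_ge0.
have y0 : 0 <= N%:R^-1 * c by rewrite mulr_ge0 ?invr_ge0.
have hGa3 : 2 * (N%:R^-1 * c) <= Gamma3.
  have -> : Gamma3 = 2 / (1 - (sigma2 ^+ t) ^+ 2) * (N%:R^-1 * c).
    by rewrite /Gamma3 unlock (proj2 hc) /= mulnC exprM.
  apply: ler_wpM2r => //; rewrite ler_pdivlMr; move: s2 (sqr_ge0 (sigma2 ^+ t)).
    by move: (_ ^+ 2) => x; clear; lra.
  by move: (_ ^+ 2) => x; clear; lra.
have hC0 : 300 * (D' / alpha * a0) <= C0.
  exact: (offset_constant halpha0 hbeta0 LG0 rr1 (le_trans (ler0n _ 2) G2) a00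
    (le_trans D40 D42) be100 D'E (erefl D4) hGa1).
have Ga10 : 0 <= Gamma1.
  apply: le_trans hGa1; apply: mulr_ge0 => //; apply: divr_ge0; last exact: ltW.
  by apply: divr_ge0.
have hGa3t : 4 / 5 * (beta * (N%:R^-1 * c)) + 300 * (D' / alpha * a0) <= Gamma3tilde.
  have e0 : 0 <= 16 * alpha ^+ 2 * L_G ^+ 2 * Gamma2 * Gamma1.
    apply: mulr_ge0 => //; apply: mulr_ge0 => //; apply: mulr_ge0; last exact: sqr_ge0.
    by apply: mulr_ge0; [exact: ler0n|exact: sqr_ge0].
  exact: tracking_constant (ltW hbeta0) y0 e0 hGa3 hC0.
have D3b : 11 * beta <= D3 by exact: (noise_constant hbeta0 LG0 be100 (erefl D3)).
have D30 : 0 <= D3 by apply: le_trans D3b; rewrite mulr_ge0 // ltW.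
(* The two rates differ in the noise coefficient at [Nk k]; both are at least [D3], which is all
   that is used. *)
have hBv (cc : nat -> R) : (forall k, D3 <= cc k) ->
    Bv <= f (Xhat X0) - fstar + Gamma3tilde + sigma ^+ 2 * (\sum_(k < K.+1)
      (cc k / (Nk k)%:R + 2 * beta * Gamma2 / (Nk k.+1)%:R)).
  move=> hcc; have := sum_noise_le K hbeta0 D3b Ga20 (sqr_ge0 sigma) hnb hcc.
  have -> : f (Xhat X0) = avg (f_^~ (Xhat X0)) by [].
  rewrite /Bv -/a0; move: hGa3t; clear.
  move: (sigma ^+ 2 * _) (11 * _) (300 * _) (4 / 5 * _) Gamma3tilde (avg _).
  by move=> x1 x2 x3 x4 x5 x6; lra.
have budget_ge0 w : 0 <= budget w.
  have be00 := ltW hbeta0; rewrite /budget /traj_budget.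
  apply: addr_ge0; first apply: addr_ge0; first apply: addr_ge0.
  - by rewrite subr_ge0; apply: fmin; case: (hXhat _ X0S).
  - apply: mulr_ge0; first exact: divr_ge0.
    by apply: mulr_ge0 => //; apply: avg_ge0 => i; exact: sqr_ge0.
  - apply: mulr_ge0; [exact: ler0n|apply: mulr_ge0 => //].
    by apply: divr_ge0; [apply: divr_ge0 => //; exact: sqr_ge0|exact: ltW].
  apply: mulr_ge0 => //; apply: mulr_ge0 => //; apply: sumr_ge0 => k _.
  by apply: avg_ge0 => i; exact: sqr_ge0.
have Bv0 : 0 <= Bv by exact: has_mean_nonneg hB.
split.
  (* The factor [N%:R] appears since [stack_sqdist] is a sum over agents; it cancels against the
     [N%:R^-1] of the statement. *)
  pose g w := N%:R * (10 / 7 / alpha * a0 + 77 / 10 * (beta / alpha ^+ 2) * budget w).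
  pose Gv := 10 / 7 / alpha * a0 + 77 / 10 * (beta / alpha ^+ 2) * Bv.
  have hg : has_mean P g (N%:R * Gv).
    apply: has_meanZ; apply: has_meanD; last exact: has_meanZ.
    exact: (has_mean_cst P (10 / 7 / alpha * a0)).
  have x0 : 0 <= 10 / 7 / alpha * a0.
    by apply: mulr_ge0 => //; apply: divr_ge0; [exact: divr_ge0|exact: ltW].
  have x1 : 0 <= 77 / 10 * (beta / alpha ^+ 2).
    apply: mulr_ge0; first exact: divr_ge0.
    by apply: divr_ge0; [exact: ltW|exact: sqr_ge0].
  have g0 w : 0 <= g w.
    by apply: mulr_ge0 => //; apply: addr_ge0 => //; apply: mulr_ge0.
  pose h k w := stack_sqdist (X k w) (Xhat (X k w)).
  have h0 k w : 0 <= h k w by apply: sumr_ge0 => i _; exact: sqr_ge0.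
  have hE k w : h k w = N%:R * traj_cons Xhat (X^~ w) k by rewrite /traj_cons /avg mulVKf.
  have hs w : ~ Z w -> \sum_(k < K.+1) h k w <= g w.
    move=> nZ; under eq_bigr do rewrite hE.
    rewrite -mulr_sumr ler_wpM2l //.
    by rewrite -[77 / 10 * _ * _]mulrA; exact: cons_le.
  have [k hk] := min_mean_le h0 g0 hg mZ PZ hs.
  apply: (@bigmin_inf _ _ _ _ k) => //.
  apply: (@le_trans _ _ ((N%:R^-1)%:E * (N%:R * Gv / K.+1%:R)%:E)%E).
    by apply: lee_wpmul2l => //; rewrite lee_fin invr_ge0.
  rewrite -EFinM lee_fin -mulrA mulKf // ler_wpM2r ?invr_ge0 //.
  rewrite addrC; apply: lerD => //.
  apply: (@le_trans _ _ (8 * beta * Gamma0 * Bv)); rewrite ?ler_wpM2r //.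
    exact: (grad_constant hbeta0 halpha0 Lt0 LtB Gu).
  apply: ler_wpM2l.
    by apply: mulr_ge0; [apply: mulr_ge0 => //; exact: ltW|apply: le_trans G2].
  apply: (hBv (fun=> 2 * Gamma2 * beta + D3 + beta / 2)) => j.
  rewrite addrAC lerDr addr_ge0 //.
    by apply: mulr_ge0; [apply: mulr_ge0|exact: ltW].
  by apply: divr_ge0 => //; exact: ltW.
pose g w := 3 / beta * budget w.
have hg : has_mean P g (3 / beta * Bv) by exact: has_meanZ.
have b3 : 0 <= 3 / beta by apply: divr_ge0 => //; exact: ltW.
have g0 w : 0 <= g w by exact: mulr_ge0.
pose h k w := fnorm (rgrad f (Xhat (X k w))) ^+ 2.
have h0 k w : 0 <= h k w by exact: sqr_ge0.
have hs w : ~ Z w -> \sum_(k < K.+1) h k w <= g w.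
  move=> nZ; rewrite /g mulrAC ler_pdivlMr // mulrC; apply: le_trans (grad_le w nZ).
  rewrite ler_pM2l //; apply: ler_sum => k _.
  by rewrite /h /f rgrad_mean.
have [k hk] := min_mean_le h0 g0 hg mZ PZ hs.
apply: (@bigmin_inf _ _ _ _ k) => //; apply: (le_trans hk); rewrite lee_fin.
set Bq := (X in (_ + _ * X) / _).
have hBq : Bv <= Bq.
  apply: (hBv (fun=> 2 * beta * Gamma2 + D3tilde)) => j; rewrite addrC -addrA lerDl addr_ge0 //.
    by apply: divr_ge0 => //; apply: mulr_ge0 => //; exact: ltW.
  by apply: mulr_ge0 => //; apply: mulr_ge0 => //; exact: ltW.
have t0 : 0 <= Gamma1tilde.
  apply: mulr_ge0 => //; apply: mulr_ge0; last exact: ltW.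
  by apply: mulr_ge0 => //; exact: sqr_ge0.
rewrite invfM [X in _ <= X]mulrA ler_wpM2r ?invr_ge0 //.
rewrite mulrAC ler_wpM2r ?invr_ge0 ?(ltW hbeta0) //.
apply: (le_trans (ler_wpM2l (ler0n R 3) hBq)).
apply: (@le_trans _ _ ((16 + Gamma0 * alpha ^+ 2 * delta1 ^+ 2) * Bq)); last by rewrite lerDr.
apply: ler_wpM2r; first exact: le_trans hBq.
have : 0 <= Gamma0 * alpha ^+ 2 * delta1 ^+ 2.
  apply: mulr_ge0; last exact: sqr_ge0.
  by apply: mulr_ge0; [exact: le_trans G2|exact: sqr_ge0].
by move: (_ * delta1 ^+ 2) => x; clear; lra.
Qed.
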